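(* Let $m>0$, $g>0$, $\tau>0$ and a surface $S=\{s=0\}$ as described in the context be given. There exist $b>0$ and $\mu>0$ such that for any $\tau$-periodic rotation of the surface whose angular velocity satisfies $|\omega(t)|<b$ and $|\dot\omega(t)|<b$ for all $t$, the equation of motion $$m\ddot\rho=-mg\,e_z+R-m[\dot\omega,\rho]-m[\omega,[\omega,\rho]]-2m[\omega,\dot\rho]-\mu\dot\rho,\qquad s(\rho)=0,$$ has a $\tau$-periodic solution $\rho(t)$ such that $f(t,\rho(t))>0$ for all $t$.
   Context: $(\cdot,\cdot)$ is the Euclidean scalar product, $|\cdot|$ the Euclidean norm and $[\cdot,\cdot]$ the cross product in $\mathbb{R}^3$. $Oxyz$ is a fixed orthonormal frame; gravity is $-mg\,e_z$. $O\xi\eta\zeta$ is a rotating orthonormal frame with the same origin $O$ and unit vectors $e_\xi(t),e_\eta(t),e_\zeta(t)$, depending smoothly on $t\in\mathbb{R}$ in a prescribed way; $\omega=\omega_\xi e_\xi+\omega_\eta e_\eta+\omega_\zeta e_\zeta$ is the angular velocity of $O\xi\eta\zeta$ with respect to $Oxyz$ (so that in the fixed frame $\frac{d}{dt}e_\xi=[\omega,e_\xi]$, and similarly for $e_\eta,e_\zeta$) and $\dot\omega=\dot\omega_\xi e_\xi+\dot\omega_\eta e_\eta+\dot\omega_\zeta e_\zeta$. The rotation is $\tau$-periodic if $e_\xi,e_\eta,e_\zeta$ are $\tau$-periodic functions of $t$. In the rotating coordinates the surface $S$ is given by $s(\xi,\eta,\zeta)=0$, with $s$ smooth; it is a closed,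 strictly convex smooth surface ($\nabla s\neq0$ on it), and $O$ lies inside the region it bounds. A point of mass $m$ moves on the rotating surface with viscous friction of coefficient $\mu>0$; in the rotating frame $\rho=\xi e_\xi+\eta e_\eta+\zeta e_\zeta$, $\dot\rho=\dot\xi e_\xi+\dot\eta e_\eta+\dot\zeta e_\zeta$, $\ddot\rho=\ddot\xi e_\xi+\ddot\eta e_\eta+\ddot\zeta e_\zeta$, and $R$ is the reaction force, directed along the normal to the surface at $\rho$ (determined by the constraint $s(\rho)=0$). A solution is a curve $\rho(t)=(\xi(t),\eta(t),\zeta(t))$ on $S$ satisfying the equation of motion, with $\tau$-periodicity understood for these coordinates. Finally $f(t,\xi,\eta,\zeta)=(e_z,e_\xi(t))\xi+(e_z,e_\eta(t))\eta+(e_z,e_\zeta(t))\zeta$ is the height $z$ of the point, so $f=0$ is the horizontal plane $z=0$ through $O$. *)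

(* Defs.v *)
From HB Require Import structures.
From mathcomp Require Import all_boot all_order all_algebra.
From mathcomp Require Import all_classical all_reals all_analysis.

Set Implicit Arguments.
Unset Strict Implicit.
Unset Printing Implicit Defensive.

Import Order.TTheory GRing.Theory Num.Theory.
Import numFieldNormedType.Exports.

Local Open Scope classical_set_scope.
Local Open Scope ring_scope.

Section Euclidean3.
Variable R : realType.
Implicit Types u v : 'rV[R]_3.

Definition dot u v : R := \sum_(i < 3) u 0 i * v 0 i.

(* The library norm `|u| on row vectors is the sup norm, hence this one. *)
Definition enorm u : R := Num.sqrt (dot u u).

(* Indices are taken in 'I_3 = Z/3, so that k + 1 and k + 2 wrap around. *)
Definition cross u v : 'rV[R]_3 :=
  \row_(k < 3) (u 0 (k + 1) * v 0 (k + 2) - u 0 (k + 2) * v 0 (k + 1)).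

Definition e_z : 'rV[R]_3 := delta_mx 0 2.

End Euclidean3.
Arguments e_z {R}.

Section Surface.
Variable R : realType.
Implicit Type s : 'rV[R]_3 -> R.

(* C^oo: the iterated directional derivatives of every order (the empty list
   of directions giving s itself) are Frechet differentiable everywhere. *)
Definition smooth s : Prop :=
  forall (vs : seq 'rV[R]_3) (x : 'rV[R]_3),
    differentiable (foldr (fun v (h : 'rV[R]_3 -> R) => 'D_v h) s vs) x.

Definition grad s (x : 'rV[R]_3) : 'rV[R]_3 :=
  \row_(i < 3) 'D_(delta_mx 0 i) s x.

Definition strictly_convex (K : set 'rV[R]_3) : Prop :=
  forall (x y : 'rV[R]_3) (l : R), K x -> K y -> x != y -> 0 < l < 1 ->
    interior K (l *: x + (1 - l) *: y).

(* {s = 0} is a regular smooth surface bounding a compact strictly convex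
   region K that has the origin in its interior. *)
Definition closed_strictly_convex_surface s : Prop :=
  [/\ smooth s,
      forall x, s x = 0 -> grad s x != 0 &
      exists K : set 'rV[R]_3,
        [/\ compact K, strictly_convex K, interior K 0 &
            [set x | s x = 0] = K `\` interior K]].

End Surface.

(* All vectors of space are written in the fixed frame Oxyz. A rotating frame
   e has e_xi = e 0, e_eta = e 1, e_zeta = e 2. *)
Section RotatingFrame.
Variable R : realType.
Implicit Types (e : 'I_3 -> R -> 'rV[R]_3) (q w : R -> 'rV[R]_3).

Definition smooth_curve (c : R -> 'rV[R]_3) : Prop :=
  forall (n : nat) (t : R), derivable (derive1n n c) t 1.

Definition rotating_frame e : Prop :=
  (forall i, smooth_curve (e i)) /\
  (forall t i j, dot (e i t) (e j t) = (i == j)%:R).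

(* The vector of space with coordinates x in the rotating frame at time t. *)
Definition in_space e (t : R) (x : 'rV[R]_3) : 'rV[R]_3 :=
  \sum_(i < 3) x 0 i *: e i t.

(* w holds the coordinates (omega_xi, omega_eta, omega_zeta). *)
Definition angular_velocity e w : Prop :=
  forall (t : R) i, derive1 (e i) t = cross (in_space e t (w t)) (e i t).

Definition height e (t : R) (x : 'rV[R]_3) : R :=
  \sum_(i < 3) dot e_z (e i t) * x 0 i.

(* q = (xi, eta, zeta); dots over rho and omega are derivatives relative to the
   rotating frame, i.e. derivatives of the coordinates. The reaction N t is
   along the normal, whose coordinates in the rotating frame are grad s. *)
Definition is_motion (m g mu : R) (s : 'rV[R]_3 -> R) e w q : Prop :=
  [/\ forall t : R, derivable q t 1,
      forall t : R, derivable (derive1 q) t 1,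
      forall t, s (q t) = 0 &
      exists N : R -> 'rV[R]_3,
        (forall t, exists l : R, N t = l *: in_space e t (grad s (q t))) /\
        forall t,
          let rho := in_space e t (q t) in
          let drho := in_space e t (derive1 q t) in
          let ddrho := in_space e t (derive1 (derive1 q) t) in
          let omega := in_space e t (w t) in
          let domega := in_space e t (derive1 w t) in
          m *: ddrho =
            - (m * g) *: e_z + N t - m *: cross domega rho
            - m *: cross omega (cross omega rho)
            - (2 * m) *: cross omega drho - mu *: drho].

End RotatingFrame.

(* Main.v *)
Require Import Defs.
From HB Require Import structures.
From mathcomp Require Import all_boot all_order all_algebra.
From mathcomp Require Import all_classical all_reals all_analysis.
From mathcomp Require Import ring lra.
Set Implicit Arguments. Unset Strict Implicit. Unset Printing Implicit Defensive.
Import Order.TTheory GRing.Theory Num.Theory.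
Import numFieldNormedType.Exports.
Local Open Scope classical_set_scope.
Local Open Scope ring_scope.

(** Why such a solution exists.

Divide by [m] and write the motion in rotating coordinates. With [k = mu / m]
it is a strongly damped equation [q'' = - k q' + Y(t, q, q') + l grad s(q)], in
which [Y] collects gravity and the inertial forces, and the multiplier [l] keeps
[q] on the surface. When [|omega|], [|omega'|] are small, [Y] is uniformly close
to the constant vector [- g a], where [a] is the vertical at time [0]: the
inertial forces are small, and the vertical moves little during one period,
hence, being periodic, at all times ([vertical_drift], [applied_gravity]). With
large friction the point hardly moves within a period, so the force that it
feels is nearly constant; a periodic solution should sit where the mean tangential
force vanishes, which happens close to the highest point [P] of the surface in
the direction [a].

To turn this into a proof, replace [l] by its value in terms of [q] and [q']
([constrained]); the equation then makes sense in a neighbourhood of the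
surface. For every [c] near the surface the equation corrected by a constant
force [- p(c)] has a slow [tau]-periodic solution with [q(0) = c], where [p(c)]
is the mean force along it. This is a contraction argument: a damped
linear equation with periodic right-hand side has a periodic solution bounded by
[sup / k], and large [k] makes the iteration contract. Moreover [p] is Lipschitz
in [c] ([periodic_family]).

It remains to find [c] with [p(c) = 0]. Let [c] run over the cap obtained by
projecting radially onto the surface a small disc of the plane tangent at [P].
There [p(c)] is close to the tangential part of [- g a], which pulls away from
the top on the rim of the cap, because the surface is strictly convex
([support_uniform], [polar_cap]). By a planar fixed point theorem ([disc_zero],
proved by a Sperner parity count) the two horizontal components of [p] vanish
somewhere, so [p(c)] is parallel to [a]. The remaining component is handled by
the constraint: along the periodic curve, [z = (s o q)'] satisfies
[z' = - k z - p(c) . grad s], and integrating over a period gives [p(c) = 0]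
and [s o q] constant ([closed_curve_level]). Hence [q] is a motion on the
surface that stays near the top, above the horizontal plane through the origin.

All constants are chosen before the frame is given, so they may not depend on
[a]; compactness of the surface makes them uniform. *)

(** * Primitives, mean value theorem, periodicity *)

Section Primitive.
Variable R : realType.

Lemma is_derive_continuous n (F : R -> 'rV[R]_n) (f : R -> 'rV[R]_n) :
  (forall t : R, is_derive t 1 F (f t)) -> continuous F.
Proof. by move=> dF t; apply/differentiable_continuous/derivable1_diffP. Qed.

Lemma is_derive_continuous1 (F f : R -> R) :
  (forall t : R, is_derive t 1 F (f t)) -> continuous F.
Proof. by move=> dF t; apply/differentiable_continuous/derivable1_diffP. Qed.

Lemma primitive_right (f : R -> R) : continuous f ->
  exists A : R -> R, forall t : R, -1 < t -> is_derive t 1 A (f t).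
Proof.
move=> cf; exists (fun x => \int[lebesgue_measure]_(t in `[(-1), x]) f t)%R => t t1.
have tt1 : t < t + 1 by rewrite ltrDl.
have intf : lebesgue_measure.-integrable `[(-1), t + 1] (EFin \o f).
  apply: continuous_compact_integrable; first exact: segment_compact.
  exact: continuous_subspaceT.
have [dA A'] := continuous_FTC1_closed tt1 intf t1 (cf t).
by split; [exact: dA|rewrite -derive1E].
Qed.

Lemma MVT_cst (F : R -> R) (a b : R) : a <= b ->
  (forall t : R, a <= t <= b -> is_derive t 1 F 0) -> F b = F a.
Proof.
move=> ab dF.
have dFo x : x \in `]a, b[%R -> is_derive x 1 F 0.
  by rewrite in_itv/= => /andP[ax xb]; apply: dF; rewrite !ltW.
have cF : {within `[a, b], continuous F}.
  apply: derivable_within_continuous => x xab.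
  by have [] := dF x; first by move: xab; rewrite in_itv.
have [c _] := @MVT_segment _ F (fun=> 0) _ _ ab dFo cF.
by rewrite mul0r => /eqP; rewrite subr_eq0 => /eqP.
Qed.

(** Integrals from a base point give a primitive on one half-line only; the one
on the other side comes from [f (- t)], and both agree up to a constant on an
overlap. *)
Lemma primitive1_exists (f : R -> R) : continuous f ->
  exists F : R -> R, F 0 = 0 /\ forall t : R, is_derive t 1 F (f t).
Proof.
move=> cf; have [A dA] := primitive_right cf.
have [|B0 dB0] := @primitive_right (fun t => f (- t)).
  by move=> t; apply: continuous_comp; [exact: opp_continuous|exact: cf].
pose B t := - B0 (- t).
have dB (t : R) : t < 1 -> is_derive t 1 B (f t).
  move=> t1.
  have t1' : -1 < - t by rewrite ltrN2.
  have dBt : is_derive (- t) 1 B0 (f t) by have := dB0 _ t1'; rewrite opprK.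
  have dN : is_derive t 1 (-%R : R -> R) (-1).
    exact: (is_deriveN (is_derive_id t (1 : R))).
  have dC := is_derive1_comp dBt dN.
  have := is_deriveN dC; rewrite mulrN1 opprK; exact.
pose F t := if t <= 0 then B t - B 0 else A t - A 0.
have AB (t : R) : -1 < t <= 0 -> A t - A 0 = B t - B 0.
  move=> /andP[t1 t0].
  suff : A 0 - B 0 = A t - B t by move=> ?; lra.
  apply: (@MVT_cst (fun t => A t - B t)) => // x /andP[tx x0].
  have dAx := dA x (lt_le_trans t1 tx).
  have dBx := dB x (le_lt_trans x0 ltr01).
  by have := is_deriveB dAx dBx; rewrite subrr.
exists F; split; first by rewrite /F lexx subrr.
move=> t; have [t1|t1] := ltP (-1) t.
  have dt : is_derive t 1 (fun x => A x - A 0) (f t).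
    have dAt := dA t t1.
    have := is_deriveB dAt (is_derive_cst (A 0) t 1); rewrite subr0; exact.
  apply: (near_eq_is_derive _ dt); near=> x; rewrite /F; case: ifPn => // x0; rewrite AB// x0 andbT.
  by near: x; exact: lt_nbhsr.
have dt : is_derive t 1 (fun x => B x - B 0) (f t).
  have dBt := dB t (lt_trans (le_lt_trans t1 (ltrN10 _)) ltr01).
  have := is_deriveB dBt (is_derive_cst (B 0) t 1); rewrite subr0; exact.
apply: (near_eq_is_derive _ dt); near=> x; rewrite /F ifT//; apply: ltW; near: x; apply: lt_nbhsl.
exact: (le_lt_trans t1 (ltrN10 _)).
Unshelve. all: by end_near. Qed.

Lemma is_derive_rV n (F f : R -> 'rV[R]_n) (t : R) :
  (forall i, is_derive t 1 (fun x => F x 0 i) (f t 0 i)) -> is_derive t 1 F (f t).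
Proof.
move=> dF; have D : derivable F t 1 by apply/derivable_mxP => i j; rewrite ord1.
apply: DeriveDef => //; rewrite derive_mx//; apply/rowP => i; rewrite mxE.
exact: derive_val.
Qed.

Lemma is_derive_coord n (F : R -> 'rV[R]_n) (d : 'rV[R]_n) (t : R) i :
  is_derive t 1 F d -> is_derive t 1 (fun x => F x 0 i) (d 0 i).
Proof.
move=> dF; have /derivable_mxP D := @ex_derive _ _ _ _ _ _ _ dF.
apply: DeriveDef => //.
by rewrite -(@derive_val _ _ _ _ _ _ _ dF) derive_mx ?mxE//; exact: ex_derive.
Qed.

Lemma continuous_rV (T : topologicalType) n (f : T -> 'rV[R]_n) :
  (forall i, continuous (fun x => f x 0 i)) -> continuous f.
Proof.
move=> cf x; apply/cvgrPdist_le => /= e e0; near=> y.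
rewrite /Num.Def.normr/= mx_normrE (bigmax_le _ (ltW e0))//= => -[i j] _.
rewrite !mxE/= ord1; move: j {i}; near: y; apply: filter_forall => j.
have /cvgrPdist_le := cf j x; exact.
Unshelve. all: by end_near. Qed.

Lemma continuous_row_coord (T : topologicalType) n (f : T -> 'rV[R]_n) i :
  continuous f -> continuous (fun x => f x 0 i).
Proof.
move=> cf x; apply: (@continuous_comp _ _ _ f (fun v => v 0 i)); first exact: cf.
exact: coord_continuous.
Qed.

Lemma primitive_exists n (f : R -> 'rV[R]_n) : continuous f ->
  exists F, F 0 = 0 /\ forall t : R, is_derive t 1 F (f t).
Proof.
move=> cf; have H i := primitive1_exists (@continuous_row_coord _ _ _ i cf).
pose F t := \row_i sval (cid (H i)) t.
exists F; split=> [|t].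
  by apply/rowP => i; rewrite !mxE; case: cid => /= G [].
apply: is_derive_rV => i; have := (svalP (cid (H i))).2 t.
by congr (is_derive _ _ _ _); apply/funext => x; rewrite mxE.
Qed.

(** Chosen among the primitives vanishing at [0], so as to be a total function of
[f]. *)
Definition primitive n (f : R -> 'rV[R]_n) : R -> 'rV[R]_n :=
  xget 0 [set F : R -> 'rV[R]_n | F 0 = 0 /\ forall t : R, is_derive t 1 F (f t)].

Lemma primitiveP n (f : R -> 'rV[R]_n) : continuous f ->
  primitive f 0 = 0 /\ forall t : R, is_derive t 1 (primitive f) (f t).
Proof.
by move=> /primitive_exists[F HF]; rewrite /primitive; case: xgetP => [G -> //|/(_ F)].
Qed.

Lemma primitive0 n (f : R -> 'rV[R]_n) : continuous f -> primitive f 0 = 0.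
Proof. by move=> /primitiveP[]. Qed.

Lemma is_derive_primitive n (f : R -> 'rV[R]_n) (t : R) : continuous f ->
  is_derive t 1 (primitive f) (f t).
Proof. by move=> /primitiveP[]. Qed.

Lemma ler_norm_rV n (x : 'rV[R]_n) (e : R) : 0 <= e ->
  (forall i, `|x 0 i| <= e) -> `|x| <= e.
Proof.
move=> e0 H; rewrite /Num.Def.normr/= mx_normrE (bigmax_le _ e0)//= => -[i j] _.
by rewrite ord1.
Qed.

Lemma norm_coord n (x : 'rV[R]_n) i : `|x 0 i| <= `|x|.
Proof.
rewrite [leRHS]/Num.Def.normr/= mx_normrE.
exact: (le_bigmax _ (fun ij : 'I_1 * 'I_n => `|x ij.1 ij.2|) (0, i)).
Qed.

Lemma MVT_ex (F f : R -> R) (a b : R) : a <= b ->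
  (forall t : R, is_derive t 1 F (f t)) ->
  exists2 c, a <= c <= b & F b - F a = f c * (b - a).
Proof.
move=> ab dF.
have cF : {within `[a, b], continuous F}.
  by apply: continuous_subspaceT; apply: is_derive_continuous1 dF.
have [c cab ->] := @MVT_segment _ F f _ _ ab (fun x _ => dF x) cF.
by exists c => //; move: cab; rewrite in_itv.
Qed.

Lemma MVT_le1 (F f : R -> R) (a b M : R) : a <= b ->
  (forall t : R, is_derive t 1 F (f t)) ->
  (forall t, a <= t <= b -> `|f t| <= M) -> `|F b - F a| <= M * (b - a).
Proof.
move=> ab dF fM.
have [c cab ->] := MVT_ex ab dF.
rewrite normrM (ger0_norm (_ : 0 <= b - a)) ?subr_ge0// ler_wpM2r ?subr_ge0// fM//.
Qed.

Lemma MVT_le n (F f : R -> 'rV[R]_n) (a b M : R) : a <= b ->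
  (forall t : R, is_derive t 1 F (f t)) ->
  (forall t, a <= t <= b -> `|f t| <= M) -> `|F b - F a| <= M * (b - a).
Proof.
move=> ab dF fM.
have M0 : 0 <= M by rewrite (le_trans _ (fM a _))// lexx.
apply: ler_norm_rV => [|i]; first by rewrite mulr_ge0// subr_ge0.
rewrite !mxE; apply: (@MVT_le1 (fun t => F t 0 i) (fun t => f t 0 i)) => // t.
  exact: is_derive_coord.
by move=> /fM; exact/le_trans/norm_coord.
Qed.

Lemma derive0_cst n (F : R -> 'rV[R]_n) :
  (forall t : R, is_derive t 1 F 0) -> forall s t, F s = F t.
Proof.
move=> dF s t; apply/rowP => i.
apply: (@is_derive_0_is_cst _ (fun t => F t 0 i)) => x.
by have := is_derive_coord i (dF x); rewrite mxE.
Qed.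

Lemma is_derive_shift_arg n (F : R -> 'rV[R]_n) (d : 'rV[R]_n) (t tau : R) :
  is_derive (t + tau) 1 F d -> is_derive t 1 (fun x => F (x + tau)) d.
Proof.
move=> dF; apply: (@is_derive_rV _ (fun x => F (x + tau)) (fun=> d)) => i.
have := is_derive_coord i dF => di.
have dS : is_derive t 1 (fun x : R => x + tau) 1 by exact: is_derive_shift.
have := @is_derive1_comp _ (fun x => F x 0 i) (fun x => x + tau) t _ _ di dS.
by rewrite mulr1.
Qed.

Lemma periodic_shift (V : zmodType) (g : R -> V) (tau : R) (z : int) :
  periodic g tau -> forall t, g (t + tau *~ z) = g t.
Proof.
move=> pg t; case: z => k; first by rewrite -pmulrn periodicn.
rewrite NegzE mulrNz -pmulrn -[in RHS](subrK (tau *+ k.+1) t).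
by rewrite periodicn.
Qed.

(** A single representative [t0] serves all functions of period [tau] at once. *)
Lemma periodic_reduce (tau : R) : 0 < tau -> forall t, exists2 t0, 0 <= t0 <= tau &
  forall (V : zmodType) (g : R -> V), periodic g tau -> g t = g t0.
Proof.
move=> tau0 t; pose z := Num.floor (t / tau).
have := mem_rg1_floor (t / tau); rewrite -/z => /andP[].
rewrite ler_pdivlMr// ltr_pdivrMr// => z1 z2.
exists (t - tau *~ z) => [|V g pg].
  apply/andP; split; first by rewrite subr_ge0 mulrzl in z1 *.
  move: z2; rewrite mulrDl mul1r mulrzl => z2; lra.
by rewrite -[LHS](periodic_shift (- z) pg) mulrNz.
Qed.

Lemma is_derive_ext (V : normedModType R) (F G : R -> V) (df dg : V) (t : R) :
  is_derive t 1 F df -> F =1 G -> df = dg -> is_derive t 1 G dg.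
Proof. by move=> dF /funext <- <-. Qed.

End Primitive.

(** * Periodic solutions of strongly damped equations *)

Section PeriodicLinear.
Variable R : realType.

Lemma is_derive_expRM (k t : R) : is_derive t 1 (fun x => expR (k * x)) (k * expR (k * t)).
Proof.
have dM : is_derive t 1 (fun x : R => k * x) k.
  by have := is_deriveZ k (is_derive_id t (1 : R)); rewrite scaler1 /GRing.scale/= ?mulr1; exact.
by have := is_derive1_comp (is_derive_expR (k * t)) dM; rewrite mulrC; exact.
Qed.

(** The function [exp (k t) (v t - M / k)] is nonincreasing; over a period it is
multiplied by [exp (k tau) > 1], so it cannot be positive. *)
Lemma periodic_linear_le (v f : R -> R) (k M tau : R) : 0 < tau -> 0 < k ->
  (forall t : R, is_derive t 1 v (- k * v t + f t)) -> periodic v tau ->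
  (forall t, f t <= M) -> forall t, v t <= M / k.
Proof.
move=> tau0 k0 dv pv fM t.
pose h x := expR (k * x) * (v x - M / k).
have dh (x : R) : is_derive x 1 h (expR (k * x) * (f x - M)).
  have dvx : is_derive x 1 (fun y => v y - M / k) (- k * v x + f x - 0).
    exact: is_deriveB (dv x) (is_derive_cst (M / k) x (1 : R)).
  apply: (is_derive_ext (is_deriveM (is_derive_expRM k x) dvx)) => //.
  rewrite /GRing.scale/=; field; exact: lt0r_neq0.
have tt : t <= t + tau by rewrite lerDl ltW.
have [c _ hc] := MVT_ex tt dh.
have : h (t + tau) - h t <= 0.
  by rewrite hc addrAC subrr add0r pmulr_lle0// pmulr_rle0 ?expR_gt0// subr_le0.
rewrite /h pv -mulrBl pmulr_rle0 ?subr_le0// subr_gt0 ltr_expR ltr_pM2l// ltrDl//.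
Qed.

Lemma periodic_linear_bound n (v f : R -> 'rV[R]_n) (k M tau : R) : 0 < tau -> 0 < k ->
  (forall t : R, is_derive t 1 v (- k *: v t + f t)) -> periodic v tau ->
  (forall t, `|f t| <= M) -> forall t, `|v t| <= M / k.
Proof.
move=> tau0 k0 dv pv fM t.
have M0 : 0 <= M by rewrite (le_trans _ (fM 0)).
apply: ler_norm_rV => [|i]; first by rewrite divr_ge0// ltW.
have dvi (x : R) : is_derive x 1 (fun y => v y 0 i) (- k * v x 0 i + f x 0 i).
  by have := is_derive_coord i (dv x); rewrite !mxE.
have fi x : `|f x 0 i| <= M by rewrite (le_trans (norm_coord _ _)).
rewrite ler_norml; apply/andP; split.
  rewrite lerNl.
  apply: (@periodic_linear_le (fun x => - v x 0 i) (fun x => - f x 0 i) k M tau) => //.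
  - by move=> x; apply: (is_derive_ext (is_deriveN (dvi x))) => //; ring.
  - by move=> x; rewrite pv.
  - by move=> x; rewrite lerNl; have := fi x; rewrite ler_norml => /andP[].
apply: (@periodic_linear_le (fun x => v x 0 i) (fun x => f x 0 i) k M tau) => //.
- by move=> x; rewrite pv.
- by move=> x; have := fi x; rewrite ler_norml => /andP[].
Qed.

(** Variation of constants: [v t = exp (- k t) (v0 + E t)]. *)
Lemma periodic_linear_exists1 (f : R -> R) (k tau : R) : 0 < tau -> 0 < k ->
  continuous f -> periodic f tau ->
  exists2 v : R -> R, periodic v tau & forall t : R, is_derive t 1 v (- k * v t + f t).
Proof.
move=> tau0 k0 cf pf.
have ck (c : R) : continuous (fun t : R => expR (c * t)).
  by apply: is_derive_continuous1; exact: is_derive_expRM.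
have [|E [E0 dE]] := @primitive1_exists _ (fun t => expR (k * t) * f t).
  by move=> t; apply: cvgM; [exact: ck|exact: cf].
have e1 : expR (k * tau) - 1 != 0.
  by rewrite subr_eq0 gt_eqF// expR_gt1 mulr_gt0.
(* the initial value for which [v tau = v 0] *)
pose v0 := E tau / (expR (k * tau) - 1).
pose v t := expR (- k * t) * (v0 + E t).
have dv (t : R) : is_derive t 1 v (- k * v t + f t).
  have dEt : is_derive t 1 (fun x => v0 + E x) (0 + expR (k * t) * f t).
    exact: is_deriveD (is_derive_cst v0 t (1 : R)) (dE t).
  apply: (is_derive_ext (is_deriveM (is_derive_expRM (- k) t) dEt)) => //.
  rewrite /GRing.scale/= /v add0r mulrA -expRD mulNr addNr expR0.
  ring.
exists v => // t.
(* [v (x + tau) - v x] solves the homogeneous equation and vanishes at [0] *)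
pose w x := expR (k * x) * (v (x + tau) - v x).
have dw (x : R) : is_derive x 1 w 0.
  have dS : is_derive x 1 (fun y : R => y + tau) 1 by exact: is_derive_shift.
  have d1 := @is_derive1_comp _ v (fun y => y + tau) x _ _ (dv _) dS.
  apply: (is_derive_ext (is_deriveM (is_derive_expRM k x) (is_deriveB d1 (dv x)))) => //.
  suff : expR (k * x) * ((- k * v (x + tau) + f (x + tau)) * 1 - (- k * v x + f x)) +
      (v (x + tau) - v x) * (k * expR (k * x)) = 0 by [].
  rewrite pf; ring.
have : w t = w 0 by exact: is_derive_0_is_cst.
rewrite {2}/w mulr0 expR0 mul1r add0r.
have -> : v tau - v 0 = 0.
  rewrite /v mulr0 expR0 mul1r E0 addr0 mulNr expRN /v0; field.
  by rewrite e1 gt_eqF// expR_gt0.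
by rewrite /w => /eqP; rewrite mulf_eq0 gt_eqF ?expR_gt0//= subr_eq0 => /eqP.
Qed.

Lemma periodic_linear_exists n (f : R -> 'rV[R]_n) (k tau : R) : 0 < tau -> 0 < k ->
  continuous f -> periodic f tau ->
  exists2 v : R -> 'rV[R]_n, periodic v tau &
    forall t : R, is_derive t 1 v (- k *: v t + f t).
Proof.
move=> tau0 k0 cf pf.
have H i : exists v : R -> R, periodic v tau /\
    forall t : R, is_derive t 1 v (- k * v t + f t 0 i).
  have [//|//||x|v pv dv] := @periodic_linear_exists1 (fun t => f t 0 i) k tau.
  - exact: continuous_row_coord.
  - by rewrite pf.
  - by exists v.
pose v t := \row_i sval (cid (H i)) t.
exists v => t; first by apply/rowP => i; rewrite !mxE; case: cid => /= w [].
apply: (@is_derive_rV _ _ v (fun t => - k *: v t + f t)) => i.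
rewrite !mxE; have := (svalP (cid (H i))).2 t.
by congr (is_derive _ _ _ _); apply/funext => x; rewrite mxE.
Qed.

Lemma periodic_primitive n (G v : R -> 'rV[R]_n) (tau : R) :
  (forall t : R, is_derive t 1 G (v t)) -> periodic v tau -> G tau = G 0 -> periodic G tau.
Proof.
move=> dG pv G0 t; apply/eqP; rewrite -subr_eq0.
have -> : 0 = (fun x => G (x + tau) - G x) 0 by rewrite /= add0r G0 subrr.
apply/eqP; apply: (@derive0_cst _ _ (fun x => G (x + tau) - G x)) => x.
have dS := is_derive_shift_arg (dG (x + tau)).
by have := is_deriveB dS (dG x); rewrite pv subrr.
Qed.

Lemma periodic_primitive_bound n (G v : R -> 'rV[R]_n) (tau D : R) : 0 < tau ->
  (forall t : R, is_derive t 1 G (v t)) -> periodic v tau -> G 0 = 0 -> G tau = 0 ->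
  (forall t, `|v t| <= D) -> forall t, `|G t| <= D * tau.
Proof.
move=> tau0 dG pv G0 Gtau vD t.
have pG : periodic G tau by apply: periodic_primitive dG pv _; rewrite G0.
have [t0 /andP[t00 t0tau] ->//] := periodic_reduce tau0 t.
have := MVT_le t00 dG (fun t _ => vD t); rewrite G0 subr0 subr0 => /le_trans; apply.
by rewrite ler_wpM2l// (le_trans _ (vD 0)).
Qed.

Lemma is_derive_scalel n (p : 'rV[R]_n) (t : R) : is_derive t 1 (fun x : R => x *: p) p.
Proof.
apply: (@is_derive_rV _ _ (fun x : R => x *: p) (fun=> p)) => i.
apply: (is_derive_ext (is_deriveZ (p 0 i) (is_derive_id t (1 : R)))) => [x|].
  by rewrite mxE mulrC.
by rewrite /GRing.scale/= mulr1.
Qed.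

Definition mean n (tau : R) (f : R -> 'rV[R]_n) := tau^-1 *: primitive f tau.

Lemma mean_dist n (tau r : R) (f : R -> 'rV[R]_n) p : 0 < tau -> continuous f ->
  (forall t, `|f t - p| <= r) -> `|mean tau f - p| <= r.
Proof.
move=> tau0 cf fr.
have dP (t : R) : is_derive t 1 (fun x => primitive f x - x *: p) (f t - p).
  exact: is_deriveB (is_derive_primitive t cf) (is_derive_scalel p t).
have := MVT_le (ltW tau0) dP (fun t _ => fr t).
rewrite primitive0// scale0r !subr0 => H.
rewrite /mean -[p in X in X <= _](@scalerK _ _ tau) ?gt_eqF//.
by rewrite -scalerBr normrZ gtr0_norm ?invr_gt0// mulrC ler_pdivrMr.
Qed.

Lemma mean_dist2 n (tau r : R) (f g : R -> 'rV[R]_n) : 0 < tau ->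
  continuous f -> continuous g ->
  (forall t, `|f t - g t| <= r) -> `|mean tau f - mean tau g| <= r.
Proof.
move=> tau0 cf cg fr.
have dP (t : R) : is_derive t 1 (fun x => primitive f x - primitive g x) (f t - g t).
  exact: is_deriveB (is_derive_primitive t cf) (is_derive_primitive t cg).
have := MVT_le (ltW tau0) dP (fun t _ => fr t).
rewrite !primitive0// !subr0 => H.
by rewrite -scalerBr normrZ gtr0_norm ?invr_gt0// mulrC ler_pdivrMr.
Qed.

(** Banach's fixed point theorem for the uniform distance. The map is given as a
relation [S], because an iteration step is characterised by a differential
equation rather than by a formula. *)
Lemma uniform_contraction (T : Type) n
    (X : set (T -> 'rV[R]_n)) (S : (T -> 'rV[R]_n) -> (T -> 'rV[R]_n) -> Prop)
    (v0 : T -> 'rV[R]_n) (V : R) :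
  X v0 -> (forall v, X v -> exists2 w, X w & S v w) ->
  (forall v w t, X v -> X w -> `|v t - w t| <= V) ->
  (forall v1 v2 w1 w2 D, X v1 -> X v2 -> S v1 w1 -> S v2 w2 ->
    (forall t, `|v1 t - v2 t| <= D) -> forall t, `|w1 t - w2 t| <= D / 2) ->
  (forall v, (forall e, 0 < e -> exists2 u, X u & forall t, `|u t - v t| <= e) -> X v) ->
  exists2 v, X v & S v v.
Proof.
move=> Xv0 XS XV ctr clX.
have [s [s0 ss]] : exists s : (T -> 'rV[R]_n) -> T -> 'rV[R]_n,
    (forall v, X v -> X (s v)) /\ forall v, X v -> S v (s v).
  have /choice[s Hs] : forall v, exists w, X v -> X w /\ S v w.
    by move=> v; have [/XS[w Xw Sw]|nX] := pselect (X v); [exists w|exists v].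
  by exists s; split=> v /Hs[].
pose y j := iter j s v0.
have Xy j : X (y j) by elim: j => //= j; exact: s0.
have V0 : inhabited T -> 0 <= V by case=> t; rewrite (le_trans _ (XV v0 v0 t _ _)).
have ym j m t : `|y j t - y (j + m)%N t| <= V * 2^-1 ^+ j.
  elim: j t => [|j IH] t; first by rewrite expr0 mulr1; exact: XV.
  by rewrite exprSr mulrA; apply: ctr IH t => //; exact: ss.
have small e : 0 < e -> exists N, inhabited T -> V * 2^-1 ^+ N <= e.
  move=> e0; have [[t]|nT] := pselect (inhabited T); last by exists 0%N.
  have := @cvg_geometric R V 2^-1; rewrite ger0_norm// invf_lt1// ltr1n => /(_ isT).
  move=> /cvgrPdist_le /(_ _ e0)[N _ /(_ N (leqnn N))] /=.
  rewrite sub0r normrN => H; exists N => _; exact: le_trans (ler_norm _) H.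
have cy t : cvgn (fun j => y j t).
  apply/cauchy_cvgP/cauchy_ballP => e e0; near_simpl.
  have [N HN] := small _ (divr_gt0 e0 (ltr0n _ 4)).
  exists ([set n | N <= n], [set n | N <= n])%N; first by split; exists N.
  move=> [i m] [/= Nn Nm]; rewrite -ball_normE /=.
  have h j : (N <= j)%N -> `|y N t - y j t| <= e / 4%:R.
    by move=> /subnKC <-; apply: le_trans (ym _ _ _) (HN (inhabits t)).
  rewrite -(subrKA (y N t)) (le_lt_trans (ler_normD _ _))//.
  have := h i Nn; have := h m Nm; rewrite [in X in _ -> X -> _]distrC => h1 h2.
  apply: (le_lt_trans (lerD h2 h1)); lra.
pose v t := lim (y j t @[j --> \oo]).
have yv i t : `|y i t - v t| <= V * 2^-1 ^+ i.
  have c1 : (fun m => `|y i t - y (i + m)%N t|) @ \oo --> `|y i t - v t|.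
    apply: cvg_norm; apply: cvgB; first exact: cvg_cst.
    have : (fun m => y (m + i)%N t) @ \oo --> v t by rewrite (@cvg_shiftn i _ (fun j => y j t)).
    by under eq_fun do rewrite addnC.
  rewrite -(cvg_lim _ c1)//; apply: limr_le; first by apply/cvg_ex; eexists; exact: c1.
  by apply: nearW => m; exact: ym.
have Xv : X v.
  apply: clX => e e0; have [N HN] := small e e0; exists (y N) => // t.
  exact: le_trans (yv _ _) (HN (inhabits t)).
exists v => //; rewrite -[X in S _ X](_ : s v = v); first exact: ss.
apply/funext => t; apply/eqP; rewrite -subr_eq0 -normr_le0.
apply/ler_addgt0Pl => e e0; rewrite addr0.
have [N HN] := small _ (divr_gt0 e0 (ltr0n _ 2)).
have {}HN := HN (inhabits t).
have h1 : `|s v t - y N.+1 t| <= V * 2^-1 ^+ N / 2.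
  by apply: ctr (ss _ Xv) (ss _ (Xy N)) _ t => // t'; rewrite distrC yv.
have h2 := yv N.+1 t; rewrite exprSr mulrA in h2.
rewrite -(subrKA (y N.+1 t)) (le_trans (ler_normD _ _))//; lra.
Unshelve. all: by end_near. Qed.

(** Take for [D] the supremum of [g]. *)
Lemma halving_le (T : Type) (g : T -> R) (D0 E : R) : (forall t, g t <= D0) ->
  (forall D, (forall t, g t <= D) -> forall t, g t <= D / 2 + E / 2) ->
  forall t, g t <= E.
Proof.
move=> gD0 H t; pose s := sup (range g).
have hs : has_sup (range g) by split; [exists (g t), t|exists D0 => _ [x _ <-]].
have gs x : g x <= s by apply: sup_upper_bound => //; exists x.
have : s <= s / 2 + E / 2.
  by apply: ge_sup; [exists (g t), t|move=> _ [x _ <-]; exact: H].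
by have := gs t; lra.
Qed.

Section Picard.
Variables (n : nat) (tau k V L M : R) (A : set 'rV[R]_n).
Variable Phi : R -> 'rV[R]_n -> 'rV[R]_n -> 'rV[R]_n.
Hypotheses (tau0 : 0 < tau) (k0 : 0 < k) (V0 : 0 <= V) (L0 : 0 <= L).
Hypothesis Phi_periodic : forall q v, periodic (fun t => Phi t q v) tau.
Hypothesis Phi_continuous : forall q v, continuous (fun t => Phi t q v).
Hypothesis Phi_bounded : forall t q v, A q -> `|v| <= V -> `|Phi t q v| <= M.
Hypothesis Phi_lipschitz : forall t q1 q2 v1 v2, A q1 -> A q2 ->
  `|v1| <= V -> `|v2| <= V ->
  `|Phi t q1 v1 - Phi t q2 v2| <= L * (`|q1 - q2| + `|v1 - v2|).
Hypotheses (kM : 2 * M <= k * V) (kL : 4 * L * (tau + 1) <= k).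

Let path (c : 'rV[R]_n) (v : R -> 'rV[R]_n) t := c + primitive v t.

Let force c v t := Phi t (path c v t) (v t).

(** The velocities of closed curves of speed at most [V]. *)
Let loop (v : R -> 'rV[R]_n) := [/\ continuous v, periodic v tau,
  primitive v tau = 0 & forall t, `|v t| <= V].

(** The curves of [loop] that start at [c] stay in [A]. *)
Let inner c := forall q, `|q - c| <= V * tau -> A q.

Let loop_primitive (v : R -> 'rV[R]_n) D : continuous v -> periodic v tau -> primitive v tau = 0 ->
  (forall t, `|v t| <= D) -> forall t, `|primitive v t| <= D * tau.
Proof.
move=> cv pv v0 vD; apply: periodic_primitive_bound tau0 _ pv _ v0 vD.
- by move=> t; exact: is_derive_primitive.
- exact: primitive0.
Qed.

Let loop_path c v : loop v -> inner c -> forall t, A (path c v t).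
Proof.
by move=> [cv pv v0 vV] ic t; apply: ic; rewrite addrAC subrr add0r loop_primitive.
Qed.

Let path_derive c (v : R -> 'rV[R]_n) (t : R) : continuous v -> is_derive t 1 (path c v) (v t).
Proof.
move=> cv; have := is_deriveD (is_derive_cst c t (1 : R)) (is_derive_primitive t cv).
by rewrite add0r.
Qed.

Let path_periodic c v : loop v -> periodic (path c v) tau.
Proof.
move=> [cv pv v0 _]; apply: periodic_primitive (fun t => path_derive c t cv) pv _.
by rewrite /path v0 primitive0.
Qed.

Let path_dist c1 c2 v1 v2 D d : loop v1 -> loop v2 -> `|c1 - c2| <= d ->
  (forall t, `|v1 t - v2 t| <= D) -> forall t, `|path c1 v1 t - path c2 v2 t| <= d + D * tau.
Proof.
move=> [cv1 pv1 v10 _] [cv2 pv2 v20 _] cd vD t.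
rewrite /path opprD addrACA (le_trans (ler_normD _ _))// lerD//.
apply: (@periodic_primitive_bound _ (fun t => primitive v1 t - primitive v2 t)
  (fun t => v1 t - v2 t)) => // [x|x||].
- exact: is_deriveB (is_derive_primitive x cv1) (is_derive_primitive x cv2).
- by rewrite pv1 pv2.
- by rewrite !primitive0// subrr.
- by rewrite v10 v20 subrr.
Qed.

Let force_continuous c v : loop v -> inner c -> continuous (force c v).
Proof.
move=> lv ic t; have [cv pv v0 vV] := lv.
have cq : continuous (path c v) by apply: is_derive_continuous => x; exact: path_derive.
apply/cvgrPdist_le => /= e e0.
have e2 : 0 < e / 2 by rewrite divr_gt0.
have e4 : 0 < e / 4 / (L + 1) by rewrite !divr_gt0// ltr_wpDl.
have /cvgrPdist_le /(_ _ e2) c1 := @Phi_continuous (path c v t) (v t) t.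
have /cvgrPdist_le /(_ _ e4) c2 := cq t.
have /cvgrPdist_le /(_ _ e4) c3 := cv t.
near=> x.
rewrite -(subrKA (Phi x (path c v t) (v t))) (le_trans (ler_normD _ _))//.
rewrite [leRHS](splitr e) lerD//; first by near: x.
have A1 := loop_path lv ic t; have A2 := loop_path lv ic x.
apply: le_trans (Phi_lipschitz x A1 A2 (vV _) (vV _)) _.
apply: (@le_trans _ _ (L * (e / 4 / (L + 1) + e / 4 / (L + 1)))).
  by rewrite ler_wpM2l// lerD//; near: x.
rewrite -mulrDl mulrA ler_pdivrMr ?ltr_wpDl//.
nra.
Unshelve. all: by end_near. Qed.

Let force_periodic c v : loop v -> periodic (force c v) tau.
Proof.
by move=> lv t; rewrite /force Phi_periodic path_periodic//; case: lv => _ ->.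
Qed.

Let force_dist c1 c2 v1 v2 D d : loop v1 -> loop v2 -> inner c1 -> inner c2 ->
  `|c1 - c2| <= d -> (forall t, `|v1 t - v2 t| <= D) ->
  forall t, `|force c1 v1 t - force c2 v2 t| <= L * (d + D * tau + D).
Proof.
move=> lv1 lv2 i1 i2 cd vD t.
have A1 := loop_path lv1 i1 t; have A2 := loop_path lv2 i2 t.
have [[_ _ _ V1] [_ _ _ V2]] := (lv1, lv2).
apply: le_trans (Phi_lipschitz t A1 A2 (V1 _) (V2 _)) _.
by rewrite ler_wpM2l// lerD// path_dist.
Qed.

(** Subtracting the mean of the force makes the right-hand side average to [0]
along the periodic [w]; then [w] has zero mean as well, and its primitive closes
up. *)
Let step c v w := loop w /\ forall t : R,
  is_derive t 1 w (- k *: w t + (force c v t - mean tau (force c v))).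

Let step_exists c v : loop v -> inner c -> exists2 w, loop w & step c v w.
Proof.
move=> lv ic; have [cv pv v0 vV] := lv.
have cf := force_continuous lv ic.
have [//|//|||w pw dw] := @periodic_linear_exists n
  (fun t => force c v t - mean tau (force c v)) k tau.
- by move=> t; apply: cvgB; [exact: cf|exact: cvg_cst].
- by move=> t; rewrite force_periodic.
have cw : continuous w by apply: is_derive_continuous dw.
suff lw : loop w by exists w.
split=> //.
  (* the integrated equation, whose increment over a period gives [primitive w tau = 0] *)
  have dZ (t : R) : is_derive t 1 (fun t => w t + k *: primitive w t -
      (primitive (force c v) t - t *: mean tau (force c v))) 0.
    have d1 := is_deriveD (dw t) (is_deriveZ k (is_derive_primitive t cw)).
    have d2 := is_deriveB (is_derive_primitive t cf) (is_derive_scalel (mean tau (force c v)) t).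
    apply: (is_derive_ext (is_deriveB d1 d2)) => //.
    by rewrite addrAC addrK scaleNr addNr.
  have /eqP := derive0_cst dZ tau 0.
  rewrite !primitive0// scaler0 scale0r !subr0 addr0 /mean scalerA divff ?gt_eqF//.
  rewrite scale1r subrr subr0 -[tau in w tau]add0r pw.
  by rewrite -subr_eq0 addrAC subrr add0r scaler_eq0 gt_eqF//= => /eqP.
move=> t.
have /(_ _ t) := @periodic_linear_bound n w _ k (2 * M) tau tau0 k0 dw pw.
have fM x : `|force c v x| <= M by apply: Phi_bounded => //; exact: loop_path.
have mM : `|mean tau (force c v)| <= M.
  by rewrite -[X in `|X|]subr0; apply: mean_dist => // x; rewrite subr0.
move=> H; apply: le_trans (H _) _.
  move=> x; rewrite (le_trans (ler_normB _ _))//; have := fM x; lra.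
by rewrite ler_pdivrMr// [V * k]mulrC.
Qed.

Let step_dist c1 c2 v1 v2 w1 w2 D d : loop v1 -> loop v2 -> inner c1 -> inner c2 ->
  step c1 v1 w1 -> step c2 v2 w2 -> 0 <= d ->
  `|c1 - c2| <= d -> (forall t, `|v1 t - v2 t| <= D) ->
  forall t, `|w1 t - w2 t| <= D / 2 + d / 2.
Proof.
move=> lv1 lv2 i1 i2 [lw1 dw1] [lw2 dw2] d0 cd vD t.
have fD := force_dist lv1 lv2 i1 i2 cd vD.
have mD := mean_dist2 tau0 (force_continuous lv1 i1) (force_continuous lv2 i2) fD.
have D0 : 0 <= D by rewrite (le_trans _ (vD 0)).
have := @periodic_linear_bound n (fun t => w1 t - w2 t)
  (fun t => (force c1 v1 t - force c2 v2 t) - (mean tau (force c1 v1) - mean tau (force c2 v2)))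
  k (2 * (L * (d + D * tau + D))) tau tau0 k0.
move=> /(_ _ _ _ t) H; apply: le_trans (H _ _ _) _.
- move=> x; apply: (is_derive_ext (is_deriveB (dw1 x) (dw2 x))) => //.
  by rewrite scalerBr opprD addrACA; congr (_ + _); rewrite !opprD !opprK addrACA.
- by have [[_ p1 _ _] [_ p2 _ _]] := (lw1, lw2) => x; rewrite p1 p2.
- by move=> x; rewrite (le_trans (ler_normB _ _))//; have := fD x; lra.
rewrite ler_pdivrMr//.
have h1 : L * (d + D * tau + D) <= L * (tau + 1) * (D + d).
  rewrite -mulrA ler_wpM2l//; have := mulr_ge0 (ltW tau0) d0; lra.
have h2 : 4 * L * (tau + 1) * (D + d) <= k * (D + d) by rewrite ler_wpM2r// addr_ge0.
have -> : (D / 2 + d / 2) * k = k * (D + d) / 2 by field.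
lra.
Qed.

Let loop_closed (v : R -> 'rV[R]_n) :
  (forall e, 0 < e -> exists2 u, loop u & forall t, `|u t - v t| <= e) -> loop v.
Proof.
move=> H; have cv : continuous v.
  move=> t; apply/cvgrPdist_le => /= e e0.
  have e3 : 0 < e / 3 by rewrite divr_gt0.
  have [u [cu _ _ _] uv] := H _ e3.
  have /cvgrPdist_le /(_ _ e3) c1 := cu t.
  near=> x.
  have h1 : `|u t - u x| <= e / 3 by near: x.
  have h2 := uv x; have := uv t; rewrite distrC => h3.
  rewrite -(subrKA (u t)) (le_trans (ler_normD _ _))//.
  rewrite -(subrKA (u x) (u t)).
  have := ler_normD (u t - u x) (u x - v x); lra.
split => //.
- move=> t; apply/eqP; rewrite -subr_eq0 -normr_le0; apply/ler_addgt0Pl => e e0.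
  have [u [_ pu _ _] uv] := H _ (divr_gt0 e0 (ltr0n _ 2)).
  have h1 := uv (t + tau); have h2 := uv t; rewrite pu distrC in h1.
  rewrite -(subrKA (u t)) addr0 (le_trans (ler_normD _ _))//; lra.
- apply/eqP; rewrite -normr_le0; apply/ler_addgt0Pl => e e0.
  have [u [cu pu u0 _] uv] := H _ (divr_gt0 e0 tau0).
  have dP (t : R) : is_derive t 1 (fun t => primitive u t - primitive v t) (u t - v t).
    exact: is_deriveB (is_derive_primitive t cu) (is_derive_primitive t cv).
  have := MVT_le (ltW tau0) dP (fun t _ => uv t).
  by rewrite u0 !primitive0// subrr sub0r subr0 normrN subr0 divfK ?gt_eqF// addr0.
- move=> t; apply/ler_addgt0Pl => e e0; have [u [_ _ _ uV] uv] := H _ e0.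
  rewrite -(subrK (u t) (v t)) (le_trans (ler_normD _ _))// lerD// distrC; exact: uv.
Unshelve. all: by end_near. Qed.

Let fixed_exists c : inner c -> exists v, step c v v.
Proof.
move=> ic; have loop0 : loop (fun=> 0).
  split=> [t|t||t]; [exact: cvg_cst|by []| |by rewrite normr0].
  have c0 : continuous (fun _ : R => 0 : 'rV[R]_n) by move=> t; exact: cvg_cst.
  have := @derive0_cst _ _ (primitive (fun _ : R => 0 : 'rV[R]_n)) (fun t => is_derive_primitive t c0).
  by move=> /(_ tau 0) ->; exact: primitive0.
have [|||||v _ sv] := @uniform_contraction R n loop (step c) (fun=> 0) (V + V).
- exact: loop0.
- by move=> v lv; exact: step_exists.
- by move=> v w t [_ _ _ vV] [_ _ _ wV]; rewrite (le_trans (ler_normB _ _))// lerD.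
- move=> v1 v2 w1 w2 D l1 l2 s1 s2 vD t.
  have := @step_dist c c v1 v2 w1 w2 D 0 l1 l2 ic ic s1 s2 (lexx _) _ vD t.
  by rewrite subrr normr0 mul0r addr0; exact.
- exact: loop_closed.
by exists v.
Qed.

(** Closed orbits through prescribed points, at the price of an unknown constant
force [p c]: the right-hand side has to have zero mean along the orbit, and [p c]
is the mean of [Phi] there. This is the first half of a Lyapunov-Schmidt
reduction: zeros of the finite-dimensional map [p] are genuine periodic
solutions. The condition [kM] keeps the speed below [V], and [kL] makes the
iteration halve distances. *)
Lemma periodic_family : exists (v : 'rV[R]_n -> R -> 'rV[R]_n) (p : 'rV[R]_n -> 'rV[R]_n),
  (forall c, inner c -> exists q : R -> 'rV[R]_n,
    [/\ periodic q tau, periodic (v c) tau, q 0 = c,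
        (forall t : R, is_derive t 1 q (v c t)) &
        [/\ forall t : R, is_derive t 1 (v c) (- k *: v c t + (Phi t (q t) (v c t) - p c)),
        forall t, `|v c t| <= V, forall t, `|q t - c| <= V * tau &
        forall p0 r, (forall t, `|Phi t (q t) (v c t) - p0| <= r) -> `|p c - p0| <= r]]) /\
  (forall c1 c2, inner c1 -> inner c2 ->
    `|p c1 - p c2| <= L * (2 + tau) * `|c1 - c2|).
Proof.
have /choice[v Hv] : forall c, exists v, inner c -> step c v v.
  by move=> c; have [/fixed_exists[v]|] := pselect (inner c); [exists v|exists (fun=> 0)].
exists v, (fun c => mean tau (force c (v c))); split.
  move=> c ic; have [lv dv] := Hv _ ic; have [cv pv v0 vV] := lv.
  exists (path c (v c)); split => //.
  - exact: path_periodic.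
  - by rewrite /path primitive0// addr0.
  - by move=> t; exact: path_derive.
  split => // [t|p0 r H].
    by rewrite /path addrAC subrr add0r loop_primitive.
  by apply: mean_dist => //; exact: force_continuous.
move=> c1 c2 i1 i2; have [l1 d1] := Hv _ i1; have [l2 d2] := Hv _ i2.
have vd t : `|v c1 t - v c2 t| <= `|c1 - c2|.
  apply: (@halving_le _ (fun t => `|v c1 t - v c2 t|) (V + V)) => [x|D vD x].
    have [[_ _ _ V1] [_ _ _ V2]] := (l1, l2).
    by rewrite (le_trans (ler_normB _ _))// lerD.
  exact: step_dist i1 i2 (Hv _ i1) (Hv _ i2) _ (lexx _) vD x.
have := mean_dist2 tau0 (force_continuous l1 i1) (force_continuous l2 i2)
  (force_dist l1 l2 i1 i2 (lexx _) vd).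
move=> /le_trans; apply; rewrite -mulrA ler_wpM2l//; lra.
Qed.

End Picard.
End PeriodicLinear.

(** * Bounded Lipschitz functions *)

Section BoundedLipschitz.
Variable R : realType.

(** Boundedness is included because products of bounded Lipschitz functions are
again Lipschitz. *)
Definition blip (T : normedModType R) (D : set T) (f : T -> R) :=
  exists C : R, [/\ 0 <= C, forall x, D x -> `|f x| <= C &
    forall x y, D x -> D y -> `|f x - f y| <= C * `|x - y|].

Section Calculus.
Variables (T : normedModType R) (D : set T).
Implicit Types f g : T -> R.

Lemma blip_cst (a : R) : blip D (fun=> a).
Proof. by exists `|a|; split=> // x y _ _; rewrite subrr normr0 mulr_ge0. Qed.

Lemma blip_ext f g : blip D f -> f =1 g -> blip D g.
Proof. by move=> bf /funext <-. Qed.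

Lemma blipD f g : blip D f -> blip D g -> blip D (fun x => f x + g x).
Proof.
move=> [C [C0 fC fL]] [C' [C'0 gC gL]]; exists (C + C'); split=> [|x Dx|x y Dx Dy].
- exact: addr_ge0.
- by rewrite (le_trans (ler_normD _ _))// lerD ?fC ?gC.
- by rewrite opprD addrACA (le_trans (ler_normD _ _))// mulrDl lerD ?fL ?gL.
Qed.

Lemma blipN f : blip D f -> blip D (fun x => - f x).
Proof.
move=> [C [C0 fC fL]]; exists C; split=> // [x Dx|x y Dx Dy]; first by rewrite normrN fC.
by rewrite -opprD normrN fL.
Qed.

Lemma blipB f g : blip D f -> blip D g -> blip D (fun x => f x - g x).
Proof. by move=> bf /blipN; exact: blipD. Qed.

Lemma blipM f g : blip D f -> blip D g -> blip D (fun x => f x * g x).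
Proof.
move=> [C [C0 fC fL]] [C' [C'0 gC gL]].
exists (C * C' + C * C'); split=> [|x Dx|x y Dx Dy].
- by rewrite addr_ge0// mulr_ge0.
- rewrite normrM (@le_trans _ _ (C * C'))//; first by rewrite ler_pM ?fC ?gC.
  by rewrite lerDl mulr_ge0.
- have -> : f x * g x - f y * g y = f x * (g x - g y) + (f x - f y) * g y by ring.
  rewrite (le_trans (ler_normD _ _))// [leRHS]mulrDl lerD// normrM.
    by rewrite -mulrA ler_pM ?fC ?gL.
  by rewrite mulrAC ler_pM ?gC ?fL// mulrC.
Qed.

Lemma blip_sum (I : Type) (s : seq I) (f : I -> T -> R) :
  (forall i, blip D (f i)) -> blip D (fun x => \sum_(i <- s) f i x).
Proof.
move=> bf; elim: s => [|i s IH].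
  have -> : (fun x => \sum_(i <- [::]) f i x) = fun=> 0 by apply/funext => x; rewrite big_nil.
  exact: blip_cst.
have -> : (fun x => \sum_(i <- i :: s) f i x) = fun x => f i x + \sum_(i <- s) f i x.
  by apply/funext => x; rewrite big_cons.
exact: blipD.
Qed.

Lemma blipV f (c : R) : 0 < c -> (forall x, D x -> c <= `|f x|) -> blip D f ->
  blip D (fun x => (f x)^-1).
Proof.
move=> c0 cf [C [C0 fC fL]].
have f0 x : D x -> f x != 0 by move=> Dx; rewrite -normr_gt0 (lt_le_trans c0)// cf.
exists (c^-1 + C / c ^+ 2); split=> [|x Dx|x y Dx Dy].
- by rewrite addr_ge0 ?divr_ge0 ?invr_ge0 ?exprn_ge0// ltW.
- rewrite normfV (@le_trans _ _ c^-1)//.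
    by rewrite lef_pV2 ?posrE ?cf// (lt_le_trans c0)// cf.
  by rewrite lerDl divr_ge0// exprn_ge0// ltW.
- have -> : (f x)^-1 - (f y)^-1 = (f y - f x) / (f x * f y).
    by field; rewrite !f0.
  rewrite normrM distrC normfV normrM mulrDl (@le_trans _ _ (C / c ^+ 2 * `|x - y|))//.
    rewrite mulrAC ler_pM ?invr_ge0 ?mulr_ge0 ?fL//.
    have fx := cf x Dx; have fy := cf y Dy.
    rewrite lef_pV2 ?posrE ?exprn_gt0 ?mulr_gt0 ?(lt_le_trans c0)// expr2.
    by rewrite ler_pM// ltW.
  by rewrite lerDr mulr_ge0// invr_ge0 ltW.
Qed.

Lemma blip_max0 f : blip D f -> blip D (fun x => Num.max 0 (f x)).
Proof.
move=> [C [C0 fC fL]]; exists C; split=> // [x Dx|x y Dx Dy].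
  by have := fC x Dx; case: (ltP 0 (f x)) => //; rewrite normr0.
have := fL x y Dx Dy.
case: (ltP 0 (f x)) => hx; case: (ltP 0 (f y)) => hy //;
  rewrite !ler_norml => /andP[h1 h2]; apply/andP; split; rewrite ?subr0; lra.
Qed.

Lemma blip_continuous f : blip D f -> {within D, continuous f}.
Proof.
move=> [C [C0 _ fL]]; apply/subspace_continuousP => x Dx.
apply/cvgrPdist_le => /= e e0.
have e1 : 0 < e / (C + 1) by rewrite divr_gt0// ltr_wpDl.
near=> y.
have Dy : D y by near: y; exact: withinT.
rewrite (le_trans (fL _ _ Dx Dy))// (@le_trans _ _ (C * (e / (C + 1))))//.
  rewrite ler_wpM2l//; near: y; apply: cvg_within.
  by have /cvgrPdist_le := @cvg_id _ (nbhs x) => /(_ _ e1).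
by rewrite mulrA ler_pdivrMr ?ltr_wpDl// mulrC ler_wpM2l ?lerDl// ltW.
Unshelve. all: by end_near. Qed.

Lemma blip_subset (E : set T) f : E `<=` D -> blip D f -> blip E f.
Proof.
by move=> ED [C [C0 fC fL]]; exists C; split=> // [x /ED/fC|x y /ED + /ED]; [|exact: fL].
Qed.

End Calculus.

Lemma blip_comp (T T' : normedModType R) (D : set T) (D' : set T')
    (h : T' -> T) (f : T -> R) (K : R) :
  (forall x, D' x -> D (h x)) -> 0 <= K ->
  (forall x y, D' x -> D' y -> `|h x - h y| <= K * `|x - y|) ->
  blip D f -> blip D' (fun x => f (h x)).
Proof.
move=> hD K0 hK [C [C0 fC fL]]; exists (C + C * K); split=> [|x Dx|x y Dx Dy].
- by rewrite addr_ge0// mulr_ge0.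
- by rewrite (le_trans (fC _ (hD _ Dx)))// lerDl mulr_ge0.
- rewrite (le_trans (fL _ _ (hD _ Dx) (hD _ Dy)))// mulrDl.
  by rewrite (@le_trans _ _ (C * (K * `|x - y|)))// ?ler_wpM2l ?hK// mulrA lerDr mulr_ge0.
Qed.

Lemma blip_rV (T : normedModType R) (D : set T) n (f : T -> 'rV[R]_n) :
  (forall i, blip D (fun x => f x 0 i)) -> exists C, [/\ 0 <= C, forall x, D x -> `|f x| <= C &
    forall x y, D x -> D y -> `|f x - f y| <= C * `|x - y|].
Proof.
move=> /choice[C HC]; exists (\sum_i C i).
have C0 i : 0 <= C i by have [] := HC i.
have Cle i : C i <= \sum_i C i by rewrite (bigD1 i)//= lerDl sumr_ge0.
split=> [|x Dx|x y Dx Dy]; first exact: sumr_ge0.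
  apply: ler_norm_rV => [|i]; first exact: sumr_ge0.
  by rewrite (le_trans _ (Cle i))//; have [_ + _] := HC i; apply.
apply: ler_norm_rV => [|i]; first by rewrite mulr_ge0// sumr_ge0.
rewrite !mxE (@le_trans _ _ (C i * `|x - y|)) ?ler_wpM2r//.
by have [_ _] := HC i; apply.
Qed.

Lemma blip_coord n (r : R) i : 0 <= r -> blip [set x : 'rV[R]_n | `|x| <= r] (fun x => x 0 i).
Proof.
move=> r0; exists (r + 1); split=> [|x /= xr|x y _ _].
- by rewrite addr_ge0.
- by rewrite (le_trans (norm_coord _ _))// (le_trans xr)// lerDl.
- have := norm_coord (x - y) i; rewrite !mxE => /le_trans; apply.
  by rewrite ler_peMl// lerDr.
Qed.

End BoundedLipschitz.

Section Smooth.
Variable R : realType.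
Implicit Types (s : 'rV[R]_3 -> R).

Lemma deriveE_grad s (x v : 'rV[R]_3) : differentiable s x -> 'D_v s x = dot (grad s x) v.
Proof.
move=> ds; rewrite deriveE// [in LHS](row_sum_delta v) linear_sum /dot.
by apply: eq_bigr => i _; rewrite linearZ/= -deriveE// mxE /GRing.scale/= mulrC.
Qed.

Lemma is_derive_comp_grad s (c : R -> 'rV[R]_3) (d : 'rV[R]_3) (t : R) : 
  differentiable s (c t) -> is_derive t 1 c d ->
  is_derive t 1 (fun t => s (c t)) (dot (grad s (c t)) d).
Proof.
move=> ds dc; have dc' : differentiable c t by apply/derivable1_diffP.
have dsc : differentiable (s \o c) t by exact: differentiable_comp.
apply: DeriveDef; first exact/derivable1_diffP.
rewrite deriveE// diff_comp//= -deriveE// -deriveE// derive_val; exact: deriveE_grad.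
Qed.

Lemma ler_norm_dot (x y : 'rV[R]_3) : `|dot x y| <= 3 * `|x| * `|y|.
Proof.
rewrite /dot (le_trans (ler_norm_sum _ _ _))//.
rewrite (@le_trans _ _ (\sum_(i < 3) `|x| * `|y|))//.
  by apply: ler_sum => i _; rewrite normrM ler_pM// norm_coord.
by rewrite sumr_const card_ord -mulrA mulr_natl.
Qed.

Lemma compact_ball_rV n (r : R) : compact [set x : 'rV[R]_n | `|x| <= r].
Proof.
apply: bounded_closed_compact.
  by exists r; split; [exact: num_real|move=> M rM x /= /le_trans; apply; exact: ltW].
have -> : [set x : 'rV[R]_n | `|x| <= r] = (fun x => `|x|) @^-1` [set y | y <= r] by [].
by apply: closed_comp; [move=> x _; exact: norm_continuous|exact: closed_le].
Qed.

Lemma continuous_bounded_ball n (f : 'rV[R]_n -> R) (r : R) : continuous f ->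
  exists2 B, 0 <= B & forall x, `|x| <= r -> `|f x| <= B.
Proof.
move=> cf; have /compact_bounded : compact (f @` [set x : 'rV[R]_n | `|x| <= r]).
  by apply: continuous_compact; [exact: continuous_subspaceT|exact: compact_ball_rV].
move=> /ex_strict_bound_gt0[B B0 HB]; exists B; first exact: ltW.
by move=> x xr; apply/ltW/HB; exists x.
Qed.

(** Mean value theorem along segments, the gradient being bounded on a compact
ball. *)
Lemma blip_C1 s (r : R) : 0 <= r -> (forall x, differentiable s x) ->
  (forall i, continuous ('D_(delta_mx 0 i) s)) ->
  blip [set x | `|x| <= r] s.
Proof.
move=> r0 ds cDs.
have [B B0 sB] := @continuous_bounded_ball _ s r (fun x => differentiable_continuous (ds x)).
have /choice[G HG] : forall i, exists B, 0 <= B /\ forall x : 'rV[R]_3, `|x| <= r -> `|'D_(delta_mx 0 i) s x| <= B.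
  by move=> i; have [C C0 HC] := @continuous_bounded_ball _ _ r (cDs i); exists C.
have G0 i : 0 <= G i by have [] := HG i.
have gG x : `|x| <= r -> `|grad s x| <= \sum_i G i.
  move=> xr; apply: ler_norm_rV => [|i]; first exact: sumr_ge0.
  rewrite mxE (@le_trans _ _ (G i))//; first by have [_] := HG i; apply.
  by rewrite (bigD1 i)//= lerDl sumr_ge0.
exists (B + 3 * \sum_i G i); split=> [|x /= xr|x y /= xr yr].
- by rewrite addr_ge0// mulr_ge0// sumr_ge0.
- by rewrite (le_trans (sB _ xr))// lerDl mulr_ge0// sumr_ge0.
pose c (t : R) := y + t *: (x - y).
have dc (t : R) : is_derive t 1 c (x - y).
  have := is_deriveD (is_derive_cst y t (1 : R)) (is_derive_scalel (x - y) t).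
  by rewrite add0r.
have dsc (t : R) : is_derive t 1 (fun t => s (c t)) (dot (grad s (c t)) (x - y)).
  exact: is_derive_comp_grad.
have [t /andP[t0 t1]] := MVT_ex (@ler01 R) dsc.
have -> : c 1 = x by rewrite /c scale1r addrC subrK.
have -> : c 0 = y by rewrite /c scale0r addr0.
rewrite subr0 mulr1 /c => ->.
rewrite (le_trans (ler_norm_dot _ _))// ler_wpM2r// (@le_trans _ _ (3 * \sum_i G i))// ?lerDr//.
rewrite ler_wpM2l// gG//.
have -> : y + t *: (x - y) = t *: x + (1 - t) *: y.
  by rewrite scalerBr scalerBl scale1r addrCA.
rewrite (le_trans (ler_normD _ _))// !normrZ ger0_norm// ger0_norm ?subr_ge0//.
have t1' : 0 <= 1 - t by rewrite subr_ge0.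
have := ler_wpM2l t0 xr; have := ler_wpM2l t1' yr; lra.
Qed.

End Smooth.

(** * Zeros of planar vector fields *)

Section Sperner.

(** The doors of Sperner's argument. *)
Let edge (a b : 'I_3) :=
  ((a == 0 :> nat) && (b == 1 :> nat)) || ((a == 1 :> nat) && (b == 0 :> nat)).

Lemma edge_triangle (a b c : 'I_3) : edge a b (+) edge b c (+) edge a c ->
  forall d, d \in [:: a; b; c].
Proof.
move=> + d; rewrite /edge !inE -!val_eqE.
by case: a => [[|[|[|//]]] ?]; case: b => [[|[|[|//]]] ?]; case: c => [[|[|[|//]]] ?];
  case: d => [[|[|[|//]]] ?].
Qed.

Let telescope_addb (f : nat -> bool) n :
  \big[addb/false]_(i < n) (f i (+) f i.+1) = f 0%N (+) f n.
Proof.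
elim: n => [|n IH]; first by rewrite big_ord0 addbb.
by rewrite big_ord_recr /= IH; case: (f 0%N); case: (f n); case: (f n.+1).
Qed.

(** Cut each cell into two triangles by an antidiagonal. Summed modulo [2] over
all triangles, the doors in the interior cancel, and the boundary conditions
leave exactly one change between the labels [0] and [1], on the bottom side.
So some triangle has an odd number of doors. *)
Lemma sperner_grid (n : nat) (l : nat -> nat -> 'I_3) :
  (forall j, (j <= n)%N -> l 0%N j != 1 :> nat) -> (forall j, (j <= n)%N -> l n j != 0 :> nat) ->
  (forall i, (i <= n)%N -> l i 0%N != 2 :> nat) -> (forall i, (i <= n)%N -> l i n = 2 :> nat) ->
  exists i j, [/\ (i < n)%N, (j < n)%N & forall d, d \in
    [:: l i j; l i.+1 j; l i j.+1; l i.+1 j.+1]].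
Proof.
move=> left right bottom top.
pose H i j := edge (l i j) (l i.+1 j); pose V i j := edge (l i j) (l i j.+1).
pose D i j := edge (l i.+1 j) (l i j.+1).
pose T1 i j := H i j (+) D i j (+) V i j.
pose T2 i j := D i j (+) H i j.+1 (+) V i.+1 j.
have [[i [j [ilt jlt T]]]|none] :=
    pselect (exists i j, [/\ (i < n)%N, (j < n)%N & T1 i j || T2 i j]).
  exists i, j; split=> // d; case/orP: T.
    move=> /edge_triangle /(_ d); rewrite !inE => /or3P[] ->; by rewrite ?orbT.
  rewrite /T2 /D /H /V => T; have := @edge_triangle (l i.+1 j) (l i j.+1) (l i.+1 j.+1) T d.
  by rewrite !inE => /or3P[] ->; rewrite ?orbT.
have : \big[addb/false]_(i < n) \big[addb/false]_(j < n) (T1 i j (+) T2 i j) = false.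
  rewrite big1// => i _; rewrite big1// => j _.
  apply/negbTE/negP => T; apply: none; exists i, j; split=> //.
  by move: T; case: (T1 i j); case: (T2 i j).
have -> : \big[addb/false]_(i < n) \big[addb/false]_(j < n) (T1 i j (+) T2 i j) =
    \big[addb/false]_(i < n) (H i 0%N (+) H i n) (+) \big[addb/false]_(j < n) (V 0%N j (+) V n j).
  rewrite -[X in _ (+) X](@eq_bigr _ _ _ _ _ _ (fun j : 'I_n => \big[addb/false]_(i < n) (V i j (+) V i.+1 j))); last first.
    by move=> j _; rewrite (telescope_addb (V^~ j)).
  rewrite [X in _ (+) X]exchange_big -big_split; apply: eq_bigr => i _ /=.
  rewrite -(telescope_addb (H i)) -big_split; apply: eq_bigr => j _ /=.
  by rewrite /T1 /T2; case: (H i j); case: (D i j); case: (V i j); case: (H i j.+1); case: (V i.+1 j).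
rewrite [X in _ (+) X]big1 => [|j _]; last first.
  have jn := ltnW (ltn_ord j).
  have := left j jn; have := left j.+1 (ltn_ord j); have := right j jn; have := right j.+1 (ltn_ord j).
  rewrite /V /edge; case: (l 0%N j) => [[|[|[|//]]] ?]; case: (l 0%N j.+1) => [[|[|[|//]]] ?];
  by case: (l n j) => [[|[|[|//]]] ?]; case: (l n j.+1) => [[|[|[|//]]] ?].
pose f i := l i 0%N == 1 :> nat.
have -> : \big[addb/false]_(i < n) (H i 0%N (+) H i n) = \big[addb/false]_(i < n) (f i (+) f i.+1).
  apply: eq_bigr => i _; have ilt := ltnW (ltn_ord i).
  have := top i ilt; have := top i.+1 (ltn_ord i); have := bottom i ilt; have := bottom i.+1 (ltn_ord i).
  rewrite /H /edge /f => + + -> ->.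
  by case: (l i 0%N) => [[|[|[|//]]] ?]; case: (l i.+1 0%N) => [[|[|[|//]]] ?].
rewrite telescope_addb /f addbF (negbTE (left 0%N _))//.
have := right 0%N (leq0n _); have := bottom n (leqnn n).
by case: (l n 0%N) => [[|[|[|//]]] ?].
Qed.

End Sperner.

Section PlanarZero.
Variable R : realType.

Local Notation square r := [set z : (R * R)%type | -r <= z.1 <= r /\ -r <= z.2 <= r].

Lemma compact_square (r : R) : compact (square r).
Proof.
have -> : square r = `[- r, r] `*` `[- r, r].
  by apply/seteqP; split => -[x y] /=; rewrite !in_itv.
by apply: compact_setX; exact: segment_compact.
Qed.

Lemma blip_fst_square (r : R) : 0 <= r -> blip (square r) (fun z => z.1).
Proof.
move=> r0; exists (r + 1); split=> [|z [/andP[h1 h2] _]|y z _ _]; first by rewrite addr_ge0.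
  by rewrite ler_norml; apply/andP; split; lra.
rewrite (@le_trans _ _ `|y - z|)//; first by rewrite [leRHS]prod_normE le_max lexx.
by rewrite ler_peMl// lerDr.
Qed.

Lemma blip_snd_square (r : R) : 0 <= r -> blip (square r) (fun z => z.2).
Proof.
move=> r0; exists (r + 1); split=> [|z [_ /andP[h1 h2]]|y z _ _]; first by rewrite addr_ge0.
  by rewrite ler_norml; apply/andP; split; lra.
rewrite (@le_trans _ _ `|y - z|)//; first by rewrite [leRHS]prod_normE le_max lexx orbT.
by rewrite ler_peMl// lerDr.
Qed.

(** Poincare-Miranda in the plane. Otherwise [G1 ^ 2 + G2 ^ 2] has a positive
minimum [E]. Label the vertices of a fine grid by the signs of [G1] and [G2]; in
a cell with three labels each [Gi] takes values of both signs, so at the vertex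
labelled [0] both are of the order of the mesh, and [G1 ^ 2 + G2 ^ 2 < E]. *)
Lemma square_zero (G1 G2 : (R * R)%type -> R) (r : R) : 0 < r ->
  blip (square r) G1 -> blip (square r) G2 ->
  (forall y, -r <= y <= r -> G1 (-r, y) <= 0 < G1 (r, y)) ->
  (forall x, -r <= x <= r -> G2 (x, -r) <= 0 < G2 (x, r)) ->
  exists z, [/\ square r z, G1 z = 0 & G2 z = 0].
Proof.
move=> r0 bG1 bG2 lr bt.
have [C1 [C10 _ L1]] := bG1; have [C2 [C20 _ L2]] := bG2.
have [z zS zmin] : exists2 z, z \in square r & forall t, t \in square r ->
    G1 z ^+ 2 + G2 z ^+ 2 <= G1 t ^+ 2 + G2 t ^+ 2.
  apply: (@compact_EVT_min _ _ (fun z => G1 z ^+ 2 + G2 z ^+ 2)).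
  - by exists (0, 0) => /=; rewrite oppr_le0 ltW.
  - exact: compact_square.
  - by apply: blip_continuous; apply: blipD; apply: blipM.
rewrite inE in zS.
have [E0|E0] := ltP 0 (G1 z ^+ 2 + G2 z ^+ 2); last first.
  have h1 := sqr_ge0 (G1 z); have h2 := sqr_ge0 (G2 z).
  exists z; split=> //; apply/eqP; rewrite -sqrf_eq0; apply/eqP; lra.
exfalso.
set E := G1 z ^+ 2 + G2 z ^+ 2 in E0 zmin.
have [n [n0 small]] : exists n, (0 < n)%N /\ (C1 ^+ 2 + C2 ^+ 2) * (2 * (2 * r / n%:R)) ^+ 2 < E.
  pose K := (C1 ^+ 2 + C2 ^+ 2) * (4 * r) ^+ 2.
  have K0 : 0 <= K by rewrite mulr_ge0 ?addr_ge0 ?sqr_ge0.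
  have KE0 : 0 <= K / E by rewrite divr_ge0// ltW.
  have := archi_boundP KE0; set n := Num.bound _ => Kn.
  have n0 : (0 < n)%N by rewrite -(ltr0n R) (le_lt_trans KE0).
  have n0R : 0 < n%:R :> R by rewrite ltr0n.
  exists n; split=> //.
  have -> : (C1 ^+ 2 + C2 ^+ 2) * (2 * (2 * r / n%:R)) ^+ 2 = K / n%:R / n%:R.
    by rewrite /K; field; rewrite gt_eqF.
  rewrite (@le_lt_trans _ _ (K / n%:R))//.
    by rewrite ler_pdivrMr// ler_peMr ?ler1n// divr_ge0// ler0n.
  by rewrite ltr_pdivrMr// mulrC -ltr_pdivrMr.
pose p i : R := - r + i%:R * (2 * r / n%:R).
have n0R : 0 < n%:R :> R by rewrite ltr0n.
have h0 : 0 < 2 * r / n%:R by rewrite divr_gt0// mulr_gt0.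
have pS i : (i <= n)%N -> - r <= p i <= r.
  move=> ilen; apply/andP; split; first by rewrite /p lerDl mulr_ge0// ltW.
  rewrite /p mulrA -lerBrDl opprK ler_pdivrMr//.
  have : i%:R <= n%:R :> R by rewrite ler_nat.
  nra.
have p0 : p 0%N = - r by rewrite /p mul0r addr0.
have pn : p n = r by rewrite /p; field; rewrite gt_eqF.
pose l i j : 'I_3 := if 0 < G2 (p i, p j) then inord 2 else
  if 0 < G1 (p i, p j) then inord 1 else inord 0.
have [|||| i [j [ilt jlt cell]]] := @sperner_grid n l.
- move=> j jn; rewrite /l p0; have /andP[h _] := lr _ (pS j jn).
  by rewrite [0 < G1 _]ltNge h/=; case: ifP => _; rewrite inordK.
- move=> j jn; rewrite /l pn; have /andP[_ h] := lr _ (pS j jn).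
  by rewrite h; case: ifP => _; rewrite inordK.
- move=> i ilen; rewrite /l p0; have /andP[h _] := bt _ (pS i ilen).
  by rewrite [0 < G2 _]ltNge h/=; case: ifP => _; rewrite inordK.
- by move=> i ilen; rewrite /l pn; have /andP[_ ->] := bt _ (pS i ilen); rewrite inordK.
have pstep i' : p i' - p i'.+1 = - (2 * r / n%:R) by rewrite /p -natr1; ring.
have near_pts d : exists a b, [/\ square r (p a, p b),
    `|(p i, p j) - (p a, p b)| <= 2 * r / n%:R & l a b = d].
  have hS a : (a == i) || (a == i.+1) -> `|p i - p a| <= 2 * r / n%:R.
    case/orP => /eqP ->; first by rewrite subrr normr0 ltW.
    by rewrite pstep normrN gtr0_norm.
  have hS' a : (a == j) || (a == j.+1) -> `|p j - p a| <= 2 * r / n%:R.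
    case/orP => /eqP ->; first by rewrite subrr normr0 ltW.
    by rewrite pstep normrN gtr0_norm.
  have mk a b : (a == i) || (a == i.+1) -> (b == j) || (b == j.+1) ->
      square r (p a, p b) /\ `|(p i, p j) - (p a, p b)| <= 2 * r / n%:R.
    move=> ha hb; split; last by rewrite prod_normE/= ge_max hS// hS'.
    by split; apply: pS; [case/orP: ha => /eqP ->|case/orP: hb => /eqP ->] => //; exact: ltnW.
  have := cell d; rewrite !inE => /or4P[] /eqP ->.
  - by exists i, j; have [] := mk i j; rewrite ?eqxx.
  - by exists i.+1, j; have [] := mk i.+1 j; rewrite ?eqxx ?orbT.
  - by exists i, j.+1; have [] := mk i j.+1; rewrite ?eqxx ?orbT.
  - by exists i.+1, j.+1; have [] := mk i.+1 j.+1; rewrite ?eqxx ?orbT.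
set h := 2 * r / n%:R in small h0 near_pts.
have [a0 [b0 [S0 d0 l0]]] := near_pts (inord 0).
have [a1 [b1 [S1 d1 l1]]] := near_pts (inord 1).
have [a2 [b2 [S2 d2 l2]]] := near_pts (inord 2).
have [G20 G10] : G2 (p a0, p b0) <= 0 /\ G1 (p a0, p b0) <= 0.
  move: l0; rewrite /l; case: ltP => [_ q|h2]; first by move/(congr1 val): q; rewrite /= !inordK.
  by case: ltP => [_ q|h1 _]; first by move/(congr1 val): q; rewrite /= !inordK.
have G11 : 0 < G1 (p a1, p b1).
  move: l1; rewrite /l; case: ltP => [_ q|_]; first by move/(congr1 val): q; rewrite /= !inordK.
  by case: ltP => // _ q; move/(congr1 val): q; rewrite /= !inordK.
have G22 : 0 < G2 (p a2, p b2).
  move: l2; rewrite /l; case: ltP => // _.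
  by case: ltP => _ q; move/(congr1 val): q; rewrite /= !inordK.
have far (a b : R * R) : `|(p i, p j) - a| <= h -> `|(p i, p j) - b| <= h -> `|a - b| <= 2 * h.
  move=> ha hb; rewrite -(subrKA (p i, p j)) (le_trans (ler_normD _ _))//.
  by rewrite [X in X + _]distrC mulr_natl mulr2n lerD.
have q1 := le_trans (L1 _ _ S0 S1) (ler_wpM2l C10 (far _ _ d0 d1)).
have q2 := le_trans (L2 _ _ S0 S2) (ler_wpM2l C20 (far _ _ d0 d2)).
have h2 : 0 <= 2 * h by rewrite mulr_ge0// ltW.
have Ch1 : 0 <= C1 * (2 * h) by rewrite mulr_ge0.
have Ch2 : 0 <= C2 * (2 * h) by rewrite mulr_ge0.
have w1 : G1 (p a0, p b0) ^+ 2 <= (C1 * (2 * h)) ^+ 2.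
  rewrite -(sqrrN (G1 _)) ler_sqr ?nnegrE ?oppr_ge0//.
  by move: q1; rewrite ler_norml => /andP[+ _]; lra.
have w2 : G2 (p a0, p b0) ^+ 2 <= (C2 * (2 * h)) ^+ 2.
  rewrite -(sqrrN (G2 _)) ler_sqr ?nnegrE ?oppr_ge0//.
  by move: q2; rewrite ler_norml => /andP[+ _]; lra.
have := zmin (p a0, p b0); rewrite inE => /(_ S0).
move: small; rewrite mulrDl -!exprMn; lra.
Qed.

(** Reduces to [square_zero] by adding a large multiple of the radial field,
switched on outside the disc of radius [e]: this produces the sign conditions on
the sides of the square, and creates no zero since the field points outwards
there. *)
Lemma disc_zero (F1 F2 : (R * R)%type -> R) (e r : R) : 0 < e -> e < r ->
  blip (square r) F1 -> blip (square r) F2 ->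
  (forall z, square r z -> e ^+ 2 <= z.1 ^+ 2 + z.2 ^+ 2 -> 0 < z.1 * F1 z + z.2 * F2 z) ->
  exists z, [/\ square r z, F1 z = 0 & F2 z = 0].
Proof.
move=> e0 er bF1 bF2 out.
have r0 : 0 < r by exact: lt_trans er.
have [C1 [C10 F1C _]] := bF1; have [C2 [C20 F2C _]] := bF2.
have re : 0 < (r ^+ 2 - e ^+ 2) * r by rewrite mulr_gt0// subr_gt0 ltr_sqr ?nnegrE ?ltW.
pose M := (C1 + C2 + 1) / ((r ^+ 2 - e ^+ 2) * r).
have M0 : 0 < M by rewrite divr_gt0// ltr_wpDl// addr_ge0.
pose w (z : R * R) := Num.max 0 (z.1 ^+ 2 + z.2 ^+ 2 - e ^+ 2).
have w0 z : 0 <= w z by rewrite le_max lexx.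
pose G1 z := F1 z + M * w z * z.1; pose G2 z := F2 z + M * w z * z.2.
have b1 := blip_fst_square (ltW r0); have b2 := blip_snd_square (ltW r0).
have bw : blip (square r) w.
  apply: blip_max0; apply: blipB; last exact: blip_cst.
  by apply: blipD; apply: blipM.
have bMw : blip (square r) (fun z => M * w z) by apply: blipM => //; exact: blip_cst.
have wr a : r ^+ 2 - e ^+ 2 <= w (r, a) /\ r ^+ 2 - e ^+ 2 <= w (- r, a).
  by rewrite !le_max /= sqrrN; split; apply/orP; right; have := sqr_ge0 a; lra.
have wr' a : r ^+ 2 - e ^+ 2 <= w (a, r) /\ r ^+ 2 - e ^+ 2 <= w (a, - r).
  by rewrite !le_max /= sqrrN; split; apply/orP; right; have := sqr_ge0 a; lra.
have big (y : R) : r ^+ 2 - e ^+ 2 <= y -> C1 + C2 + 1 <= M * y * r.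
  move=> hy; rewrite (@le_trans _ _ (M * (r ^+ 2 - e ^+ 2) * r))//.
    by rewrite -mulrA /M divfK// gt_eqF.
  by rewrite ler_wpM2r ?(ltW r0)// ler_wpM2l// ltW.
have rr : - r <= r by lra.
have hF1 z : square r z -> - C1 <= F1 z <= C1 by move=> /F1C; rewrite ler_norml.
have hF2 z : square r z -> - C2 <= F2 z <= C2 by move=> /F2C; rewrite ler_norml.
have [||y yr|x xr|z [zS z1 z2]] := @square_zero G1 G2 r r0.
- by apply: blipD => //; exact: blipM.
- by apply: blipD => //; exact: blipM.
- rewrite /G1 /= mulrN.
  have [/big h1 /big h2] := wr y.
  have /andP[h3 h4] : - C1 <= F1 (- r, y) <= C1 by apply: hF1; rewrite /= lexx.
  have /andP[h5 h6] : - C1 <= F1 (r, y) <= C1 by apply: hF1; rewrite /= lexx rr.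
  by apply/andP; split; lra.
- rewrite /G2 /= mulrN.
  have [/big h1 /big h2] := wr' x.
  have /andP[h3 h4] : - C2 <= F2 (x, - r) <= C2 by apply: hF2; rewrite /= lexx.
  have /andP[h5 h6] : - C2 <= F2 (x, r) <= C2 by apply: hF2; rewrite /= lexx rr.
  by apply/andP; split; lra.
have [zin|zout] := ltP (z.1 ^+ 2 + z.2 ^+ 2) (e ^+ 2).
  have wz : w z = 0 by apply/max_idPl; rewrite subr_le0 ltW.
  by exists z; split; [|rewrite -z1 /G1 wz mulr0 mul0r addr0|rewrite -z2 /G2 wz mulr0 mul0r addr0].
have := out z zS zout.
have : z.1 * G1 z + z.2 * G2 z = 0 by rewrite z1 z2 !mulr0 addr0.
have : 0 <= M * w z * (z.1 ^+ 2 + z.2 ^+ 2).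
  by rewrite mulr_ge0 ?addr_ge0 ?sqr_ge0// mulr_ge0// ltW.
rewrite /G1 /G2; lra.
Qed.

End PlanarZero.

(** * The scalar product *)

Section Dot.
Variable R : realType.
Implicit Types u v w : 'rV[R]_3.

Lemma dotE u v : dot u v = u 0 0 * v 0 0 + u 0 1 * v 0 1 + u 0 2 * v 0 2.
Proof.
rewrite /dot !big_ord_recl big_ord0 addr0 addrA.
by congr (_ + _ * _ + _ * _); congr (_ _ _); apply: val_inj.
Qed.

Lemma dotC u v : dot u v = dot v u.
Proof. by rewrite !dotE; ring. Qed.
Lemma dotDl u v w : dot (u + v) w = dot u w + dot v w.
Proof. by rewrite !dotE !mxE; ring. Qed.
Lemma dotDr u v w : dot w (u + v) = dot w u + dot w v.
Proof. by rewrite !dotE !mxE; ring. Qed.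
Lemma dotNl u v : dot (- u) v = - dot u v.
Proof. by rewrite !dotE !mxE; ring. Qed.
Lemma dotNr u v : dot u (- v) = - dot u v.
Proof. by rewrite !dotE !mxE; ring. Qed.
Lemma dotBl u v w : dot (u - v) w = dot u w - dot v w.
Proof. by rewrite dotDl dotNl. Qed.
Lemma dotBr u v w : dot w (u - v) = dot w u - dot w v.
Proof. by rewrite dotDr dotNr. Qed.
Lemma dotZl (k : R) u v : dot (k *: u) v = k * dot u v.
Proof. by rewrite !dotE !mxE; ring. Qed.
Lemma dotZr (k : R) u v : dot u (k *: v) = k * dot u v.
Proof. by rewrite !dotE !mxE; ring. Qed.
Lemma dot0l v : dot 0 v = 0.
Proof. by rewrite !dotE !mxE; ring. Qed.
Lemma dot0r v : dot v 0 = 0.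
Proof. by rewrite dotC dot0l. Qed.

Lemma dot_ge_norm u : `|u| ^+ 2 <= dot u u.
Proof.
have d0 : 0 <= dot u u by rewrite dotE -!expr2 !addr_ge0 ?sqr_ge0.
rewrite -(@sqr_sqrtr _ (dot u u))// ler_sqr ?nnegrE ?sqrtr_ge0//.
apply: ler_norm_rV => [|i]; first exact: sqrtr_ge0.
rewrite -ler_sqr ?nnegrE ?sqrtr_ge0// sqr_sqrtr// -normrX ger0_norm ?sqr_ge0//.
by rewrite /dot (bigD1 i)//= -expr2 lerDl sumr_ge0// => j _; rewrite -expr2 sqr_ge0.
Qed.

Lemma dot_ge0 u : 0 <= dot u u.
Proof. exact: le_trans (sqr_ge0 _) (dot_ge_norm u). Qed.

Lemma dot_gt0 u : u != 0 -> 0 < dot u u.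
Proof. by move=> u0; apply: lt_le_trans (dot_ge_norm u); rewrite exprn_gt0// normr_gt0. Qed.

Lemma norm_ge_dot u (r : R) : 0 < r -> r ^+ 2 <= dot u u -> r / 2 <= `|u|.
Proof.
move=> r0 ru; rewrite leNgt; apply/negP => ulow.
have h1 := ler_norm_dot u u; rewrite ger0_norm ?dot_ge0// in h1.
have h2 : `|u| * `|u| < r / 2 * (r / 2) by rewrite ltr_pM.
have := mulr_gt0 r0 r0; move: ru; rewrite expr2; lra.
Qed.

Lemma norm_le1_dot u : dot u u = 1 -> `|u| <= 1.
Proof. by move=> u1; rewrite -ler_sqr ?nnegrE// expr1n -u1 dot_ge_norm. Qed.

Lemma blip_dot (T : normedModType R) (D : set T) (f h : T -> 'rV[R]_3) :
  (forall i, blip D (fun x => f x 0 i)) -> (forall i, blip D (fun x => h x 0 i)) ->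
  blip D (fun x => dot (f x) (h x)).
Proof. by move=> bf bh; apply: blip_sum => i; exact: blipM. Qed.

Lemma is_derive_dot (F G : R -> 'rV[R]_3) (f g : 'rV[R]_3) (t : R) :
  is_derive t 1 F f -> is_derive t 1 G g ->
  is_derive t 1 (fun t => dot (F t) (G t)) (dot f (G t) + dot (F t) g).
Proof.
move=> dF dG; have d i := is_deriveM (is_derive_coord i dF) (is_derive_coord i dG).
apply: (is_derive_ext (is_deriveD (is_deriveD (d 0) (d 1)) (d 2))) => [x|].
  by rewrite dotE.
by rewrite !dotE /GRing.scale/=; ring.
Qed.

Lemma continuous_dotr (T : topologicalType) (F : T -> 'rV[R]_3) u :
  continuous F -> continuous (fun t => dot u (F t)).
Proof.
move=> cF; have -> : (fun t => dot u (F t)) =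
    fun t => u 0 0 * F t 0 0 + u 0 1 * F t 0 1 + u 0 2 * F t 0 2.
  by apply/funext => t; rewrite dotE.
have cc i : continuous (fun t => u 0 i * F t 0 i).
  by move=> t; apply: cvgM; [exact: cvg_cst|exact: (@continuous_row_coord _ _ _ _ i cF)].
by move=> t; apply: cvgD; [apply: cvgD|]; exact: cc.
Qed.

End Dot.

Section Calculus1.
Variable R : realType.

Lemma gt0_of_close (x y A d : R) : 0 < d -> d <= y -> - A <= x - y -> A <= d / 2 -> 0 < x.
Proof. lra. Qed.

Lemma derive_gt0_right (f : R -> R) (t d : R) : is_derive t 1 f d -> 0 < d ->
  exists2 e, 0 < e & forall h, 0 < h < e -> f t < f (t + h).
Proof.
move=> df d0; have /derivable1_diffP dd := @ex_derive _ _ _ _ _ _ _ df.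
have /derivable1_diffP := dd => /cvg_ex[/= l fl].
have ld : l = d.
  by rewrite -(@derive_val _ _ _ _ _ _ _ df); apply/esym/cvg_lim.
rewrite {}ld in fl.
have /cvgrPdist_lt /(_ _ d0) := fl.
move=> [e /= e0 He]; exists e => // h /andP[h0 he].
have := He h; rewrite /ball_ /= sub0r normrN gtr0_norm// => /(_ he (lt0r_neq0 h0)).
rewrite [h%:A]mulr1 [h + t]addrC => /(le_lt_trans (ler_norm _)); rewrite /GRing.scale/=.
by rewrite ltrBlDl ltrDr pmulr_rgt0 ?invr_gt0// subr_gt0.
Qed.

Lemma derive_lt0_right (f : R -> R) (t d : R) : is_derive t 1 f d -> d < 0 ->
  exists2 e, 0 < e & forall h, 0 < h < e -> f (t + h) < f t.
Proof.
move=> /is_deriveN df d0; have [|e e0 He] := derive_gt0_right df; first by rewrite oppr_gt0.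
by exists e => // h /He; rewrite ltrN2.
Qed.

End Calculus1.

(** * The convex body *)

Section Body.
Variables (R : realType) (s : 'rV[R]_3 -> R) (K : set 'rV[R]_3).
Hypothesis ds : forall x, differentiable s x.
Hypothesis grad_neq0 : forall x, s x = 0 -> grad s x != 0.
Hypothesis cK : compact K.
Hypothesis scK : strictly_convex K.
Hypothesis K0 : interior K 0.
Hypothesis boundaryE : [set x | s x = 0] = K `\` interior K.
Implicit Types (x y c v a : 'rV[R]_3).

Lemma interior_ballP x : interior K x <-> exists2 e : R, 0 < e & forall y, `|y - x| < e -> K y.
Proof.
split=> [/nbhs_normP[e /= e0 He]|[e e0 He]].
  by exists e => // y yx; apply: He; rewrite /= distrC.
suff : nbhs x K by [].
by apply: filterS (nbhsx_ballx x e e0) => y; rewrite -ball_normE /= distrC; exact: He.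
Qed.

Lemma interior_body x : interior K x -> K x.
Proof. exact: interior_subset. Qed.

Lemma on_surface x : s x = 0 <-> K x /\ ~ interior K x.
Proof.
have : [set x | s x = 0] x = (K `\` interior K) x by rewrite boundaryE.
by move=> /= ->; split.
Qed.

Lemma surface_body x : s x = 0 -> K x.
Proof. by move=> /on_surface[]. Qed.

Lemma body_ball : exists2 r : R, 0 < r & forall x, `|x| <= r -> K x.
Proof.
have [e e0 He] := (interior_ballP 0).1 K0.
exists (e / 2) => [|x xe]; first by rewrite divr_gt0.
by apply: He; rewrite subr0 (le_lt_trans xe)// gtr_pMr// invf_lt1// ltr1n.
Qed.

Lemma body_bounded : exists2 r : R, 0 < r & forall x, K x -> `|x| <= r.
Proof.
have /ex_strict_bound_gt0[r r0 Hr] := compact_bounded cK.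
by exists r => // x Kx; apply/ltW/Hr.
Qed.

Lemma convex_interior x y (l : R) : interior K x -> K y -> 0 < l <= 1 ->
  interior K (l *: x + (1 - l) *: y).
Proof.
move=> ix Ky /andP[l0]; rewrite le_eqVlt => /predU1P[->|l1].
  by rewrite scale1r subrr scale0r addr0.
have [<-|xy] := eqVneq x y; first by rewrite -scalerDl addrC subrK scale1r.
by apply: scK => //; [exact: interior_body|rewrite l0].
Qed.

Lemma convex_body x y (l : R) : K x -> K y -> 0 <= l <= 1 -> K (l *: x + (1 - l) *: y).
Proof.
move=> Kx Ky /andP[]; rewrite le_eqVlt => /predU1P[<- _|l0].
  by rewrite scale0r add0r subr0 scale1r.
rewrite le_eqVlt => /predU1P[->|l1]; first by rewrite scale1r subrr scale0r addr0.
have [<-|xy] := eqVneq x y; first by rewrite -scalerDl addrC subrK scale1r.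
by apply/interior_body/scK => //; rewrite l0.
Qed.

Lemma convex_body0 x (l : R) : K x -> 0 <= l <= 1 -> K (l *: x).
Proof.
by move=> Kx l01; have := convex_body Kx (interior_body K0) l01; rewrite scaler0 addr0.
Qed.

Lemma closed_body : closed K.
Proof. exact: compact_closed (@norm_hausdorff _ _) cK. Qed.

(** Intermediate value theorem along the segment. *)
Lemma segment_sign x y : (forall t, 0 <= t <= 1 -> s (y + t *: (x - y)) != 0) ->
  0 < s y * s x.
Proof.
move=> nz; pose f t := s (y + t *: (x - y)).
have df (t : R) : is_derive t 1 f (dot (grad s (y + t *: (x - y))) (x - y)).
  apply: is_derive_comp_grad => //.
  have := is_deriveD (is_derive_cst y t (1 : R)) (is_derive_scalel (x - y) t).
  by rewrite add0r.
have f0 : f 0 = s y by rewrite /f scale0r addr0.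
have f1 : f 1 = s x by rewrite /f scale1r addrC subrK.
have cf : {within `[0, 1], continuous f}.
  by apply: continuous_subspaceT; apply: is_derive_continuous1 df.
have nz0 : s y != 0 by rewrite -f0 nz// lexx ler01.
have nz1 : s x != 0 by rewrite -f1 nz// lexx ler01.
rewrite lt_neqAle eq_sym mulf_neq0//= leNgt; apply/negP => neg.
have [|t] := @IVT R f 0 1 0 (@ler01 R) cf.
  rewrite f0 f1 ge_min le_max; move: neg; rewrite neq_lt in nz0.
  case/orP: nz0 => h; first by rewrite nmulr_rlt0// => h'; rewrite (ltW h) (ltW h') orbT.
  by rewrite pmulr_rlt0// => h'; rewrite (ltW h) (ltW h') orbT.
by rewrite in_itv /= => t01 /eqP; exact/negP/nz.
Qed.

Lemma interior_neq0 x : interior K x -> s x != 0.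
Proof. by move=> ix; apply/eqP => /on_surface[]. Qed.

Definition inner_sg : R := Num.sg (s 0).

Lemma inner_sg2 : inner_sg * inner_sg = 1.
Proof. by rewrite -expr2 /inner_sg sqr_sg interior_neq0. Qed.

Lemma interior_sign x : interior K x -> 0 < inner_sg * s x.
Proof.
move=> ix; have := @segment_sign x 0 _.
rewrite /inner_sg {1}[s 0]numEsg => H.
have := H; rewrite -mulrA [`|s 0| * _]mulrC mulrA pmulr_lgt0//; last by rewrite normr_gt0 interior_neq0.
apply=> t t01; rewrite add0r subr0; apply: interior_neq0.
have := convex_interior K0 (interior_body ix).
move=> /(_ (1 - t)); rewrite scaler0 add0r subKr => HH.
have /andP[t0] := t01; rewrite le_eqVlt => /predU1P[->|t1]; first by rewrite scale1r.
by apply: HH; rewrite subr_gt0 t1 gerBl.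
Qed.

(** Oriented outwards, whatever the sign of [s] inside. *)
Definition normal x := - inner_sg *: grad s x.

Lemma normal_neq0 x : s x = 0 -> normal x != 0.
Proof.
move=> /grad_neq0 g0; rewrite scaler_eq0 negb_or oppr_eq0 g0 andbT.
by apply/eqP => s0; have := inner_sg2; rewrite s0 mul0r => /eqP; rewrite eq_sym oner_eq0.
Qed.

Lemma is_derive_ray x v (t : R) :
  is_derive t 1 (fun t => inner_sg * s (x + t *: v)) (- dot (normal (x + t *: v)) v).
Proof.
have dl : is_derive t 1 (fun t : R => x + t *: v) v.
  have := is_deriveD (is_derive_cst x t (1 : R)) (is_derive_scalel v t).
  by rewrite add0r.
have := is_deriveZ inner_sg (is_derive_comp_grad (ds (x + t *: v)) dl).
move=> /is_derive_ext; apply => //.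
by rewrite /normal dotZl mulNr opprK.
Qed.

(** Moving from [x] towards an interior point enters the interior, where
[inner_sg * s] is positive, so the derivative of [s] in this direction has the
right sign; every point of [K] is a limit of interior points [(1 - l) *: y]. *)
Lemma support_le x y : s x = 0 -> K y -> dot (normal x) (y - x) <= 0.
Proof.
move=> sx Ky.
have int_le z : interior K z -> dot (normal x) (z - x) <= 0.
  move=> iz; rewrite leNgt; apply/negP => pos.
  have := is_derive_ray x (z - x) 0; rewrite scale0r addr0.
  move=> /derive_lt0_right; rewrite oppr_lt0 => /(_ pos)[e e0 He].
  pose h := Num.min (e / 2) 1.
  have h01 : 0 < h <= 1 by rewrite lt_min ltr01 divr_gt0//= ge_min lexx orbT.
  have he : 0 < h < e.
    by have /andP[-> _] := h01; rewrite /= gt_min gtr_pMr// invf_lt1// ltr1n.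
  have := He h he; rewrite scale0r addr0 add0r sx mulr0.
  have := interior_sign (convex_interior iz (surface_body sx) h01).
  have -> : h *: z + (1 - h) *: x = x + h *: (z - x).
    by rewrite scalerBr scalerBl scale1r addrCA.
  by move=> h1 h2; have := lt_trans h1 h2; rewrite ltxx.
have H l : 0 < l <= 1 -> dot (normal x) (y - x) <= l * dot (normal x) y.
  move=> l01; have := int_le _ (convex_interior K0 Ky l01).
  rewrite scaler0 add0r dotBr dotBr dotZr; lra.
rewrite leNgt; apply/negP => pos.
have := H 1; rewrite ltr01 lexx => /(_ isT) H1.
have ny : 0 < dot (normal x) y by rewrite mul1r in H1; exact: lt_le_trans pos _.
pose q := dot (normal x) (y - x) / dot (normal x) y.
have q0 : 0 < q by rewrite divr_gt0.
have := H (Num.min (q / 2) 1); rewrite lt_min ltr01 divr_gt0//= ge_min lexx orbT => /(_ isT).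
apply/negP; rewrite -ltNge (@le_lt_trans _ _ (q / 2 * dot (normal x) y))//.
  by rewrite ler_wpM2r ?(ltW ny)// ge_min lexx.
by rewrite /q mulrAC divfK ?gt_eqF//; lra.
Qed.

(** The midpoint of [x] and [y] is interior, hence can be pushed along the normal
at [x] without leaving [K], so equality would contradict [support_le]. *)
Lemma support_lt x y : s x = 0 -> K y -> y != x -> dot (normal x) (y - x) < 0.
Proof.
move=> sx Ky yx; rewrite lt_neqAle support_le// andbT; apply/eqP => d0.
have half : 0 < (2^-1 : R) < 1 by rewrite invr_gt0 ltr0n invf_lt1// ltr1n.
have := scK Ky (surface_body sx) yx half.
set m := _ + _ => /interior_ballP[e e0 He].
have mx : m - x = 2^-1 *: (y - x).
  by apply/rowP => i; rewrite /m !mxE; lra.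
have n0 : 0 < `|normal x| by rewrite normr_gt0 normal_neq0.
pose h := e / 2 / `|normal x|.
have h0 : 0 < h by rewrite !divr_gt0.
have Kz : K (m + h *: normal x).
  apply: He; rewrite addrAC subrr add0r normrZ gtr0_norm// /h divfK ?gt_eqF//.
  by rewrite gtr_pMr// invf_lt1// ltr1n.
have := support_le sx Kz; rewrite addrAC mx dotDr (dotZr 2^-1) d0 mulr0 add0r (dotZr h).
by rewrite pmulr_rle0// leNgt dot_gt0// normal_neq0.
Qed.

Lemma compact_surface : compact [set x | s x = 0].
Proof.
rewrite boundaryE setDE; apply: compact_closedI => //.
by apply: open_closedC; exact: open_interior.
Qed.

(** The Minkowski functional of [K]; it parametrises the surface by directions. *)
Definition gauge x : R := inf [set l | 0 < l /\ K (l^-1 *: x)].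

Lemma has_inf_gauge x : has_inf [set l : R | 0 < l /\ K (l^-1 *: x)].
Proof.
have [r r0 Hr] := body_ball.
split; last by exists 0 => l [/ltW].
exists (`|x| / r + 1); have l0 : 0 < `|x| / r + 1 by rewrite ltr_wpDl// divr_ge0// ltW.
split=> //; apply: Hr; rewrite normrZ gtr0_norm ?invr_gt0// mulrC ler_pdivrMr//.
by rewrite mulrDr mulr1 mulrC divfK ?gt_eqF// lerDl ltW.
Qed.

Lemma gauge_le x (l : R) : 0 < l -> K (l^-1 *: x) -> gauge x <= l.
Proof. by move=> l0 Kl; apply: ge_inf => //; have [] := has_inf_gauge x. Qed.

Lemma gauge_ge0 x : 0 <= gauge x.
Proof. by apply: lb_le_inf; [have [] := has_inf_gauge x|move=> l [/ltW]]. Qed.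

Lemma gauge_lt x (l : R) : gauge x < l -> K (l^-1 *: x).
Proof.
move=> /(inf_lt (has_inf_gauge x).1)[k [k0 Kk] kl].
have l0 : 0 < l by exact: lt_trans kl.
have := @convex_body0 _ (k / l) Kk; rewrite scalerA mulrAC divff ?gt_eqF// mul1r; apply.
by rewrite ler_pdivrMr// mul1r (ltW kl) divr_ge0// ltW.
Qed.

Lemma gauge_ge_norm (r : R) x : 0 < r -> (forall x, K x -> `|x| <= r) -> `|x| / r <= gauge x.
Proof.
move=> r0 Hr; apply: lb_le_inf; first by have [] := has_inf_gauge x.
move=> l [l0 /Hr]; rewrite normrZ gtr0_norm ?invr_gt0// => h.
by rewrite ler_pdivrMr// -ler_pdivrMl.
Qed.

Lemma gauge_gt0 x : x != 0 -> 0 < gauge x.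
Proof.
have [r r0 Hr] := body_bounded => x0; apply: lt_le_trans (gauge_ge_norm x r0 Hr).
by rewrite divr_gt0// normr_gt0.
Qed.

(** The infimum is attained, [K] being closed; the point cannot be interior, for
then the infimum could be lowered. *)
Lemma gauge_surface x : x != 0 -> s ((gauge x)^-1 *: x) = 0.
Proof.
move=> x0; have J0 := gauge_gt0 x0; apply/on_surface; split.
  apply: contrapT => nK.
  have /nbhs_normP[e /= e0 He] : nbhs ((gauge x)^-1 *: x) (~` K).
    by apply: open_nbhs_nbhs; split=> //; exact/closed_openC/closed_body.
  have nx : 0 < `|x| by rewrite normr_gt0.
  pose d := Num.min (e / 2 / `|x|) ((gauge x)^-1 / 2).
  have d0 : 0 < d by rewrite lt_min !divr_gt0 ?invr_gt0.
  have dJ : d < (gauge x)^-1.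
    by rewrite /d gt_min; apply/orP; right; rewrite gtr_pMr ?invr_gt0// invf_lt1// ltr1n.
  apply: (He (((gauge x)^-1 - d) *: x)).
    rewrite /= -scalerBl opprB addrC subrK normrZ gtr0_norm//.
    rewrite (@le_lt_trans _ _ (e / 2))//; last by rewrite gtr_pMr// invf_lt1// ltr1n.
    by rewrite -ler_pdivlMr// /d ge_min lexx.
  rewrite -[X in K (X *: _)]invrK; apply: gauge_lt.
  by rewrite -[ltLHS]invrK ltf_pV2 ?posrE ?subr_gt0// ?invr_gt0// ?gtrBl// ltrBlDr ltrDl.
move=> /interior_ballP[e e0 He].
have nx : 0 < `|x| by rewrite normr_gt0.
pose d := e / 2 / `|x|.
have d0 : 0 < d by rewrite !divr_gt0.
have Jd : 0 < (gauge x)^-1 + d by rewrite addr_gt0 ?invr_gt0.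
have : gauge x <= ((gauge x)^-1 + d)^-1.
  apply: gauge_le; first by rewrite invr_gt0.
  rewrite invrK; apply: He; rewrite -scalerBl addrAC subrr add0r normrZ gtr0_norm//.
  by rewrite /d divfK ?gt_eqF// gtr_pMr// invf_lt1// ltr1n.
by rewrite -[X in X <= _]invrK lef_pV2 ?posrE ?invr_gt0// gerDl leNgt d0.
Qed.

Lemma gauge_on_surface x : s x = 0 -> gauge x = 1.
Proof.
move=> sx; have Kx := surface_body sx.
apply/eqP; rewrite eq_le gauge_le ?invr1 ?scale1r//= leNgt; apply/negP => J1.
pose l := (gauge x + 1) / 2.
have l0 : 0 < l by rewrite divr_gt0// ltr_wpDl// gauge_ge0.
have Jl : gauge x < l by rewrite /l; lra.
have l1 : l < 1 by rewrite /l; lra.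
have := convex_interior K0 (gauge_lt Jl) (l := 1 - l).
rewrite scaler0 add0r subKr scalerA divff ?gt_eqF// scale1r.
have [_ ni] := (on_surface x).1 sx.
by move=> ix; apply: ni; apply: ix; rewrite subr_gt0 l1 gerBl ltW.
Qed.

(** With [m = |y - x| / r], the point [y / (gauge x + m)] is a convex combination
of the surface point [x / gauge x] and of [(y - x) / m], which lies in a ball
contained in [K]. *)
Lemma gauge_lipschitz_le (r : R) x y : 0 < r -> (forall x, `|x| <= r -> K x) -> x != 0 ->
  gauge y <= gauge x + `|y - x| / r.
Proof.
move=> r0 Hr x0; have J0 := gauge_gt0 x0.
have [<-|yx] := eqVneq x y; first by rewrite subrr normr0 mul0r addr0.
have m0 : 0 < `|y - x| / r by rewrite divr_gt0// normr_gt0 subr_eq0 eq_sym.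
set m := _ / r in m0 *.
have lm0 : 0 < gauge x + m by rewrite addr_gt0.
apply: gauge_le => //.
have -> : (gauge x + m)^-1 *: y =
    (gauge x / (gauge x + m)) *: ((gauge x)^-1 *: x) + (1 - gauge x / (gauge x + m)) *: (m^-1 *: (y - x)).
  apply/rowP => i; rewrite !mxE; field.
  by rewrite (gt_eqF J0) (gt_eqF m0) (gt_eqF lm0).
apply: convex_body; first exact/surface_body/gauge_surface.
  by apply: Hr; rewrite normrZ gtr0_norm ?invr_gt0// /m invf_div divfK ?lexx// normr_eq0 subr_eq0 eq_sym.
by rewrite ler_pdivrMr// mul1r lerDl (ltW m0) divr_ge0// ltW.
Qed.

Lemma gauge_lipschitz (r : R) x y : 0 < r -> (forall x, `|x| <= r -> K x) -> x != 0 -> y != 0 ->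
  `|gauge y - gauge x| <= `|y - x| / r.
Proof.
move=> r0 Hr x0 y0; rewrite ler_norml; apply/andP; split.
  by have := gauge_lipschitz_le x r0 Hr y0; rewrite distrC; lra.
by have := gauge_lipschitz_le y r0 Hr x0; lra.
Qed.

(** The ray through [x] leaves [K] at a surface point [c], where it is transversal
to the surface, so that [s] changes sign; it meets no zero of [s] beyond [c]. *)
Lemma outside_sign x : ~ K x -> inner_sg * s x < 0.
Proof.
move=> nK; have x0 : x != 0 by apply/eqP => x0; apply: nK; rewrite x0; exact: interior_body.
have J0 := gauge_gt0 x0; have sc := gauge_surface x0.
set c := _ *: x in sc.
have J1 : 1 < gauge x.
  rewrite ltNge; apply/negP => J1; apply: nK.
  have := @convex_body0 c (gauge x) (surface_body sc).
  by rewrite scalerA divff ?gt_eqF// scale1r; apply; rewrite gauge_ge0.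
have ncx : 0 < dot (normal c) x.
  have := @support_lt c 0 sc (interior_body K0).
  have c0 : 0 != c by rewrite eq_sym scaler_eq0 negb_or x0 andbT invr_eq0 gt_eqF.
  by move=> /(_ c0); rewrite sub0r dotNr oppr_lt0 /c dotZr pmulr_rgt0// invr_gt0.
have := is_derive_ray c x 0; rewrite scale0r addr0.
move=> /derive_lt0_right; rewrite oppr_lt0 => /(_ ncx)[e e0 He].
pose h := Num.min (e / 2) (1 - (gauge x)^-1).
have Ji : 0 < 1 - (gauge x)^-1 by rewrite subr_gt0 invf_lt1.
have h0 : 0 < h by rewrite lt_min Ji divr_gt0.
have hJ : h <= 1 - (gauge x)^-1 by rewrite ge_min lexx orbT.
have he : 0 < h < e.
  by rewrite h0 /= gt_min gtr_pMr// invf_lt1// ltr1n.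
have := He h he; rewrite scale0r addr0 add0r sc mulr0 => neg.
have out (t : R) : 0 <= t <= 1 -> s (c + h *: x + t *: (x - (c + h *: x))) != 0.
  move=> /andP[t0 t1]; apply/eqP => /surface_body.
  pose k := (gauge x)^-1 + h + t * (1 - ((gauge x)^-1 + h)).
  have -> : c + h *: x + t *: (x - (c + h *: x)) = k *: x.
    by apply/rowP => i; rewrite /c /k !mxE; ring.
  have kJ : (gauge x)^-1 < k.
    have : 0 <= t * (1 - ((gauge x)^-1 + h)) by rewrite mulr_ge0//; lra.
    by rewrite /k; lra.
  have k0 : 0 < k by rewrite (lt_trans _ kJ)// invr_gt0.
  rewrite -[k]invrK => /gauge_le; rewrite invr_gt0 => /(_ k0).
  by rewrite leNgt -[ltRHS]invrK ltf_pV2 ?posrE ?invr_gt0// kJ.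
have := segment_sign out => pos.
have : 0 < (inner_sg * s (c + h *: x)) * (inner_sg * s x) by rewrite mulrACA inner_sg2 mul1r.
by rewrite nmulr_rgt0.
Qed.

Lemma top_on_surface x a : a != 0 -> K x -> (forall y, K y -> dot a y <= dot a x) -> s x = 0.
Proof.
move=> a0 Kx top; apply/on_surface; split=> // /interior_ballP[e e0 He].
have n0 : 0 < `|a| by rewrite normr_gt0.
pose h := e / 2 / `|a|.
have h0 : 0 < h by rewrite !divr_gt0.
have /top : K (x + h *: a).
  apply: He; rewrite addrAC subrr add0r normrZ gtr0_norm// /h divfK ?gt_eqF//.
  by rewrite gtr_pMr// invf_lt1// ltr1n.
by rewrite dotDr dotZr gerDl pmulr_rle0// leNgt dot_gt0.
Qed.

(** Lagrange's condition: a direction with negative component along the normal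
leads into [K], hence cannot rise in the direction [a]. *)
Lemma top_normal x a : a != 0 -> K x -> (forall y, K y -> dot a y <= dot a x) ->
  0 < dot (normal x) a /\ dot a a *: normal x = dot (normal x) a *: a.
Proof.
move=> a0 Kx top; have sx := top_on_surface a0 Kx top.
have desc v : dot (normal x) v < 0 -> dot a v <= 0.
  move=> nv; rewrite leNgt; apply/negP => av.
  have := is_derive_ray x v 0; rewrite scale0r addr0.
  move=> /derive_gt0_right; rewrite oppr_gt0 => /(_ nv)[e e0 He].
  have he : 0 < e / 2 < e by rewrite divr_gt0//= gtr_pMr// invf_lt1// ltr1n.
  have := He _ he; rewrite scale0r addr0 add0r sx mulr0 => pos.
  have Kxv : K (x + (e / 2) *: v).
    by apply: contrapT => /outside_sign neg; have := lt_trans pos neg; rewrite ltxx.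
  by have := top _ Kxv; rewrite dotDr dotZr gerDl pmulr_rle0 ?divr_gt0// leNgt av.
have n0 := dot_gt0 (normal_neq0 sx); have aa := dot_gt0 a0.
set n := normal x in desc n0 *; clearbody n.
have na : 0 < dot n a.
  rewrite ltNge; apply/negP => na.
  pose h := dot a a / (2 * (1 + `|dot a n|)).
  have h0 : 0 < h by rewrite divr_gt0// mulr_gt0// ltr_wpDr.
  have /desc : dot n (a - h *: n) < 0.
    by rewrite dotBr dotZr; have := mulr_gt0 h0 n0; lra.
  rewrite dotBr dotZr leNgt => /negP; apply.
  have : h * dot a n <= dot a a / 2.
    rewrite /h -mulrA ler_wpM2l ?(ltW aa)// invfM -mulrA ler_piMr ?invr_ge0//.
    rewrite mulrC ler_pdivrMr ?ltr_wpDr// mul1r.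
    by rewrite (le_trans (ler_norm _))// lerDr.
  lra.
split=> //; apply/eqP; rewrite -subr_eq0.
set w := _ - _.
have wa : dot a w = 0 by rewrite /w dotBr !dotZr (dotC a n); ring.
have Ew : dot n w * dot a a = dot w w.
  by rewrite {2}/w dotBl !dotZl wa mulr0 subr0 mulrC.
apply: contraT => w0; have ww := dot_gt0 w0.
(* [w] is orthogonal to [a] but not to [n]: tilting [a] by a suitable multiple
   of [w] gives a direction that points inwards and still rises *)
have nw : 0 < dot n w by rewrite -(pmulr_lgt0 _ aa) Ew.
pose h := 2 * dot n a / dot n w.
have /desc : dot n (a - h *: w) < 0.
  by rewrite dotBr dotZr /h divfK ?gt_eqF//; lra.
by rewrite dotBr dotZr wa mulr0 subr0 leNgt aa.
Qed.

Hypothesis ds1 : forall i x, differentiable ('D_(delta_mx 0 i) s) x.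
Hypothesis ds2 : forall i j x, differentiable ('D_(delta_mx 0 j) ('D_(delta_mx 0 i) s)) x.
Hypothesis ds3 : forall i j k x,
  differentiable ('D_(delta_mx 0 k) ('D_(delta_mx 0 j) ('D_(delta_mx 0 i) s))) x.

Lemma blip_grad (r : R) i : 0 <= r -> blip [set x | `|x| <= r] (fun x => grad s x 0 i).
Proof.
move=> r0; rewrite (_ : (fun x => grad s x 0 i) = 'D_(delta_mx 0 i) s); last first.
  by apply/funext => x; rewrite mxE.
apply: blip_C1 => // j; move=> x; exact: differentiable_continuous.
Qed.

Lemma blip_grad2 (r : R) i j : 0 <= r ->
  blip [set x | `|x| <= r] (fun x => grad ('D_(delta_mx 0 i) s) x 0 j).
Proof.
move=> r0; rewrite (_ : (fun x => _) = 'D_(delta_mx 0 j) ('D_(delta_mx 0 i) s)); last first.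
  by apply/funext => x; rewrite mxE.
apply: blip_C1 => // k; move=> x; exact: differentiable_continuous.
Qed.

Lemma blip_normal (r : R) i : 0 <= r -> blip [set x | `|x| <= r] (fun x => normal x 0 i).
Proof.
move=> r0; apply: (blip_ext (blipM (blip_cst _ (- inner_sg)) (blip_grad i r0))) => x.
by rewrite [RHS]mxE.
Qed.

Lemma dot_normal x : dot (normal x) (normal x) = dot (grad s x) (grad s x).
Proof. by rewrite /normal dotZl dotZr mulrA mulrNN inner_sg2 mul1r. Qed.

Lemma surface_nonempty : exists x, s x = 0.
Proof.
exists ((gauge (e_z : 'rV[R]_3))^-1 *: e_z); apply: gauge_surface.
apply/eqP => /rowP/(_ 2); rewrite !mxE !eqxx /= => /eqP; exact/negP/oner_neq0.
Qed.

(** The surface is compact and [normal] does not vanish on it. *)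
Lemma normal_bounds : exists N0 N1 : R, 0 < N0 /\
  forall x, s x = 0 -> N0 <= dot (normal x) (normal x) <= N1.
Proof.
have [r r0 Kr] := body_bounded.
have cN : {within [set x | s x = 0], continuous (fun x => dot (normal x) (normal x))}.
  apply: blip_continuous; apply: (@blip_subset _ _ [set x | `|x| <= r]).
    by move=> x /surface_body/Kr.
  by apply: blip_dot => i; apply: blip_normal; exact: ltW.
have [x0 sx0] := surface_nonempty.
have ne : [set x | s x = 0] !=set0 by exists x0.
have [x xs xmin] := compact_EVT_min ne compact_surface cN.
have [y ys ymax] := compact_EVT_max ne compact_surface cN.
exists (dot (normal x) (normal x)), (dot (normal y) (normal y)); split.
  by apply/dot_gt0/normal_neq0; rewrite inE in xs.
by move=> z sz; rewrite xmin ?ymax ?inE.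
Qed.

(** [support_lt] made uniform: a continuous function is positive on the compact
set of the pairs [(x, y)] at distance at least [e]. *)
Lemma support_uniform (e : R) : 0 < e -> exists2 d, 0 < d &
  forall x y, s x = 0 -> K y -> e <= `|x - y| -> d <= dot (normal x) (x - y).
Proof.
move=> e0; have [r r0 Kr] := body_bounded.
pose D := ([set x | s x = 0] `*` K) `&` [set z : 'rV[R]_3 * 'rV[R]_3 | e <= `|z.1 - z.2|].
have [[z0 Dz0]|nD] := pselect (D !=set0); last first.
  by exists 1 => // x y sx Ky xy; exfalso; apply: nD; exists (x, y); split.
have cD : compact D.
  apply: compact_closedI; first by apply: compact_setX => //; exact: compact_surface.
  have : continuous (fun z : 'rV[R]_3 * 'rV[R]_3 => `|z.1 - z.2|).
    move=> z; apply: (@continuous_comp _ _ _ (fun z : 'rV[R]_3 * 'rV[R]_3 => z.1 - z.2) (@Num.norm _ _)).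
      by apply: cvgB; [exact: cvg_fst|exact: cvg_snd].
    exact: norm_continuous.
  move=> cf; apply: (@closed_comp _ _ (fun z : 'rV[R]_3 * 'rV[R]_3 => `|z.1 - z.2|) [set y | e <= y]).
    by move=> z _; exact: cf.
  exact: closed_ge.
have bD : blip D (fun z => dot (normal z.1) (z.1 - z.2)).
  have p1 i : blip D (fun z => z.1 0 i).
    apply: (@blip_comp _ _ _ [set x | `|x| <= r] D fst (fun x => x 0 i) 1) => //.
    - by move=> z [[/surface_body/Kr]].
    - by move=> x y _ _; rewrite mul1r prod_normE/= le_max lexx.
    - exact/blip_coord/ltW.
  have p2 i : blip D (fun z => z.2 0 i).
    apply: (@blip_comp _ _ _ [set x | `|x| <= r] D snd (fun x => x 0 i) 1) => //.
    - by move=> z [[_ /Kr]].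
    - by move=> x y _ _; rewrite mul1r prod_normE/= le_max lexx orbT.
    - exact/blip_coord/ltW.
  apply: blip_dot => i; last first.
    by apply: (blip_ext (blipB (p1 i) (p2 i))) => z; rewrite !mxE.
  apply: (@blip_comp _ _ _ [set x | `|x| <= r] D fst (fun x => normal x 0 i) 1) => //.
  - by move=> z [[/surface_body/Kr]].
  - by move=> x y _ _; rewrite mul1r prod_normE/= le_max lexx.
  - exact/blip_normal/ltW.
have [] := compact_EVT_min _ cD (blip_continuous bD); first by exists z0.
move=> [x y]; rewrite inE => -[[/= sx Ky] /= xy] xmin.
exists (dot (normal x) (x - y)).
  rewrite -oppr_lt0 -dotNr opprB; apply: support_lt => //.
  apply/eqP => yx; move: xy; rewrite yx subrr normr0 leNgt; exact/negP/negPn.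
by move=> x' y' sx' Ky' xy'; have := xmin (x', y'); rewrite inE; apply.
Qed.

Definition radial x := (gauge x)^-1 *: x.

(** The tangent plane at the highest point [P] is horizontal, and the gauge is
Lipschitz, so the radial projection onto the surface moves the points near [P]
of this plane little; hence the normals along the resulting cap are close to the
vertical normal at [P]. The constants are uniform in the vertical direction [a]
because the length of the normals is bounded below. *)
Lemma polar_cap : exists r0 kap C rho : R, [/\ 0 < r0, 0 < kap, 0 < C & 0 < rho] /\
  forall a P u, dot a a = 1 -> K P -> (forall y, K y -> dot a y <= dot a P) ->
  dot a u = 0 -> `|u| <= rho ->
  [/\ P + u != 0, 1 <= gauge (P + u) <= 2, `|u| <= C * `|radial (P + u) - P|,
      kap <= dot (normal (radial (P + u))) a &
      [/\ 0 < dot (normal (radial (P + u))) P & r0 <= dot a (radial (P + u))]].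
Proof.
have [r0 r00 Kr0] := body_ball; have [rm rm0 Krm] := body_bounded.
have [N0 [N1 [N00 HN]]] := normal_bounds.
have [Ln [Ln0 _ HLn]] := blip_rV (fun i => blip_normal i (ltW rm0)).
pose km := Num.min 1 N0; have km0 : 0 < km by rewrite lt_min ltr01.
pose C2 := 1 + rm / r0; have C20 : 0 < C2 by rewrite addr_gt0// divr_gt0.
pose M := 3 * Ln * C2 + 1; have M0 : 0 < M.
  by rewrite ltr_wpDl// mulr_ge0 ?(ltW C20)// mulr_ge0.
pose rho := Num.min r0 (Num.min (km / 2 / M) (km * r0 / 2 / (M * rm))).
have rho0 : 0 < rho.
  by rewrite !lt_min r00 !divr_gt0// ?mulr_gt0.
have rho1 : rho <= r0 by rewrite ge_min lexx.
have rho2 : rho * M <= km / 2.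
  by rewrite -ler_pdivlMr// !ge_min lexx orbT.
have rho3 : rho * (M * rm) <= km * r0 / 2.
  by rewrite -ler_pdivlMr ?mulr_gt0// !ge_min lexx !orbT.
exists (r0 / 2), (km / 2), (1 + 6 * rm / r0), rho; split.
  by split; rewrite ?divr_gt0// ltr_wpDr// divr_ge0 ?mulr_ge0// ltW.
move=> a P u a1 KP top au urho.
have a0 : a != 0 by apply/eqP => a0; move: a1; rewrite a0 dot0l => /eqP; rewrite eq_sym oner_eq0.
have na1 := norm_le1_dot a1.
have sP := top_on_surface a0 KP top.
have [kP] := top_normal a0 KP top; rewrite a1 scale1r; set kp := dot _ a => nP.
(* [K] contains [r0 *: a], and [P] is at least as high *)
have H0 : r0 <= dot a P.
  have := top (r0 *: a); rewrite dotZr a1 mulr1; apply; apply: Kr0.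
  by rewrite normrZ gtr0_norm// ler_piMr// ltW.
have kpm : km <= kp.
  have /andP[h _] := HN P sP; rewrite nP dotZl dotZr a1 mulr1 in h.
  case: (lerP 1 kp) => k1; first by rewrite (le_trans _ k1)// ge_min lexx.
  rewrite (@le_trans _ _ N0)//; first by rewrite ge_min lexx orbT.
  by rewrite (le_trans h)// ler_piMl// ltW.
set x := P + u; have ax : dot a x = dot a P by rewrite dotDr au addr0.
have x0 : x != 0.
  by apply/eqP => x0; move: ax H0; rewrite x0 dot0r => <-; rewrite leNgt r00.
have P0 : P != 0 by apply/eqP => P0; move: H0; rewrite P0 dot0r leNgt r00.
have sc := gauge_surface x0; have Kc := surface_body sc; rewrite -/(radial x) in sc Kc.
set c := radial x in sc Kc *.
have J0 := gauge_gt0 x0; set J := gauge x in J0 *.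
have xJ : x = J *: c by rewrite /c /radial scalerA divff ?gt_eqF// scale1r.
have JP : `|J - 1| <= `|u| / r0.
  rewrite -(gauge_on_surface sP); apply: le_trans (gauge_lipschitz r00 Kr0 P0 x0) _.
  by rewrite /x addrAC subrr add0r.
have cJ : c = J^-1 *: x by [].
clearbody c J.
have J2 : J <= 2.
  have : `|u| / r0 <= 1 by rewrite ler_pdivrMr// mul1r (le_trans urho).
  by move: JP; rewrite ler_norml => /andP[_]; lra.
have J1 : 1 <= J.
  have := top c Kc; rewrite -ax xJ dotZr.
  have Hc : 0 < dot a c by rewrite -(pmulr_rgt0 _ J0) -dotZr -xJ ax (lt_le_trans r00).
  by rewrite -{1}[dot a c]mul1r ler_pM2r.
have cP : `|c - P| <= C2 * `|u|.
  have -> : c - P = J^-1 *: (u - (J - 1) *: P).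
    by apply/rowP => i; rewrite cJ /x !mxE; field; rewrite gt_eqF.
  rewrite normrZ gtr0_norm ?invr_gt0// (@le_trans _ _ `|u - (J - 1) *: P|)//.
    by rewrite ler_piMl// invf_le1.
  rewrite (le_trans (ler_normB _ _))// normrZ /C2 mulrDl mul1r lerD2l.
  have -> : rm / r0 * `|u| = `|u| / r0 * rm by ring.
  by rewrite ler_pM// Krm.
have ncn : `|normal c - normal P| <= Ln * (C2 * rho).
  apply: le_trans (HLn c P _ _) _; [exact: Krm|exact: Krm|].
  by rewrite ler_wpM2l// (le_trans cP)// ler_wpM2l// ltW.
have Hac : (J - 1) * dot a P = J * dot a (P - c).
  by rewrite dotBr mulrBr -[J * dot a c]dotZr -xJ ax; ring.
have J10 : 0 <= J - 1 by rewrite subr_ge0.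
have nc3 : 3 * `|normal c - normal P| <= rho * M.
  rewrite (@le_trans _ _ (3 * (Ln * (C2 * rho))))//; first by rewrite ler_wpM2l.
  by rewrite /M; have := rho0; lra.
split => //.
- by rewrite J1.
- have -> : u = (c - P) + (J - 1) *: c by apply/rowP => i; rewrite scalerBl -xJ scale1r /x !mxE; ring.
  rewrite (le_trans (ler_normD _ _))// mulrDl mul1r lerD2l normrZ ger0_norm//.
  have hJ : J - 1 <= 6 * `|c - P| / r0.
    rewrite ler_pdivlMr// (@le_trans _ _ ((J - 1) * dot a P))//; first by rewrite ler_wpM2l.
    rewrite Hac (@le_trans _ _ (2 * (3 * `|a| * `|P - c|)))//.
      rewrite (@le_trans _ _ (J * (3 * `|a| * `|P - c|)))//.
        by rewrite ler_wpM2l ?(ltW J0)// (le_trans (ler_norm _))// ler_norm_dot.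
      by rewrite ler_wpM2r// !mulr_ge0.
    rewrite distrC; have : `|a| * `|c - P| <= `|c - P| by rewrite ler_piMl.
    lra.
  rewrite (@le_trans _ _ (6 * `|c - P| / r0 * rm))//; last by rewrite le_eqVlt; apply/orP; left; apply/eqP; ring.
  by rewrite ler_pM// Krm.
- rewrite -[normal c](subrK (normal P)) dotDl -/kp.
  have := ler_norm_dot (normal c - normal P) a; rewrite ler_norml => /andP[h _].
  have : 3 * `|normal c - normal P| * `|a| <= 3 * `|normal c - normal P|.
    by rewrite ler_piMr// mulr_ge0.
  lra.
split.
  rewrite -[normal c](subrK (normal P)) dotDl nP dotZl.
  have := ler_norm_dot (normal c - kp *: a) P; rewrite ler_norml => /andP[h _].
  have h2 : 3 * `|normal c - kp *: a| * `|P| <= rho * (M * rm).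
    by rewrite mulrA -nP ler_pM ?mulr_ge0// Krm.
  have h3 : km * r0 <= kp * dot a P by rewrite ler_pM// ltW.
  have : 0 < km * r0 by rewrite mulr_gt0.
  lra.
have : J * dot a c = dot a P by rewrite -dotZr -xJ.
have [//|ac] := lerP (r0 / 2) (dot a c) => E.
have : J * dot a c < 2 * (r0 / 2).
  rewrite (@lt_le_trans _ _ (J * (r0 / 2)))//; first by rewrite ltr_pM2l.
  by rewrite ler_wpM2r// divr_ge0// ltW.
lra.
Qed.

(** * Motion on a surface near its top *)

(** The Hessian of [s] as a quadratic form. *)
Definition hess x v := \sum_(i < 3) v 0 i * dot (grad ('D_(delta_mx 0 i) s) x) v.

(** The acceleration of a particle of unit mass at [x] with velocity [v],
subject to the force [y] and to the reaction keeping [s] constant to second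
order. *)
Definition constrained y x v :=
  y - ((hess x v + dot (grad s x) y) / dot (grad s x) (grad s x)) *: grad s x.

Lemma grad_constrained y x v : dot (grad s x) (grad s x) != 0 ->
  dot (grad s x) (constrained y x v) = - hess x v.
Proof. by move=> g0; rewrite /constrained dotBr dotZr; field. Qed.

(** At rest only the tangential part of the force remains. *)
Lemma constrained_rest y x : constrained y x 0 =
  y - (dot (normal x) y / dot (normal x) (normal x)) *: normal x.
Proof.
rewrite /constrained /hess big1 => [|i _]; last by rewrite mxE mul0r.
rewrite add0r dot_normal /normal dotZl scalerA; congr (_ - _ *: _).
move: (dot _ _)^-1 => e; have := inner_sg2; set d := dot _ _ => h.
by rewrite -[LHS]mul1r -h; ring.
Qed.

(** Near the surface the gradient is bounded away from [0], so that
[constrained] is Lipschitz there. *)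
Lemma constrained_blip (Y : R) : 0 <= Y -> exists eta C : R, [/\ 0 < eta <= 1, 0 <= C,
  forall x c, s c = 0 -> `|x - c| <= eta -> dot (grad s x) (grad s x) != 0,
  forall y x v c, `|y| <= Y -> s c = 0 -> `|x - c| <= eta -> `|v| <= 1 ->
    `|constrained y x v| <= C &
  forall y x v c y' x' v' c', `|y| <= Y -> s c = 0 -> `|x - c| <= eta -> `|v| <= 1 ->
    `|y'| <= Y -> s c' = 0 -> `|x' - c'| <= eta -> `|v'| <= 1 -> forall d,
    `|y - y'| <= d -> `|x - x'| <= d -> `|v - v'| <= d ->
    `|constrained y x v - constrained y' x' v'| <= C * d].
Proof.
move=> Y0; have [rm rm0 Krm] := body_bounded.
have [N0 [N1 [N00 HN]]] := normal_bounds.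
have rm1 : 0 <= rm + 1 by rewrite addr_ge0// ltW.
have [Lg [Lg0 _ HLg]] := blip_dot (fun i => blip_grad i rm1) (fun i => blip_grad i rm1).
pose eta := Num.min 1 (N0 / 2 / (Lg + 1)).
have Lg1 : 0 < Lg + 1 by rewrite ltr_wpDl.
have eta0 : 0 < eta by rewrite lt_min ltr01 !divr_gt0.
have eta1 : eta <= 1 by rewrite ge_min lexx.
have eta2 : Lg * eta <= N0 / 2.
  rewrite (@le_trans _ _ ((Lg + 1) * eta))//; first by rewrite ler_wpM2r ?(ltW eta0)// lerDl.
  by rewrite mulrC -ler_pdivlMr// ge_min lexx orbT.
pose A := [set x | exists2 c, s c = 0 & `|x - c| <= eta].
have Arm x : A x -> `|x| <= rm + 1.
  move=> [c sc xc]; rewrite -(subrK c x) (le_trans (ler_normD _ _))// addrC lerD//.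
    exact/Krm/surface_body.
  exact: le_trans xc eta1.
have gA x : A x -> N0 / 2 <= `|dot (grad s x) (grad s x)|.
  move=> Ax; have [c sc xc] := Ax; have cr : `|c| <= rm + 1.
    by rewrite (@le_trans _ _ rm) ?lerDl//; exact/Krm/surface_body.
  have /andP[h1 _] := HN c sc; rewrite dot_normal in h1.
  have := HLg x c (Arm x Ax) cr; rewrite ler_norml => /andP[h2 _].
  have h3 : Lg * `|x - c| <= Lg * eta by rewrite ler_wpM2l.
  by rewrite ger0_norm ?dot_ge0//; lra.
pose E := (('rV[R]_3 * 'rV[R]_3) * 'rV[R]_3)%type.
pose W := [set p : E | [/\ `|p.1.1| <= Y, A p.1.2 & `|p.2| <= 1]].
have dist (p q : E) : [/\ `|p.1.1 - q.1.1| <= `|p - q|, `|p.1.2 - q.1.2| <= `|p - q| &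
    `|p.2 - q.2| <= `|p - q|].
  by rewrite !prod_normE /= !le_max !lexx /= ?orbT.
have bx (f : 'rV[R]_3 -> R) : blip [set x | `|x| <= rm + 1] f -> blip W (fun p => f p.1.2).
  move=> bf; apply: (@blip_comp _ _ _ _ W (fun p : E => p.1.2) f 1 _ _ _ bf) => //.
  - by move=> p [_ /Arm].
  - by move=> p q _ _; rewrite mul1r; have [] := dist p q.
have by_ i : blip W (fun p => p.1.1 0 i).
  apply: (@blip_comp _ _ _ [set x | `|x| <= Y] W (fun p : E => p.1.1) (fun x => x 0 i) 1) => //.
  - by move=> p [].
  - by move=> p q _ _; rewrite mul1r; have [] := dist p q.
  - exact: blip_coord.
have bv i : blip W (fun p => p.2 0 i).
  apply: (@blip_comp _ _ _ [set x | `|x| <= 1] W (fun p : E => p.2) (fun x => x 0 i) 1) => //.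
  - by move=> p [].
  - by move=> p q _ _; rewrite mul1r; have [] := dist p q.
  - exact: blip_coord.
have bg i : blip W (fun p => grad s p.1.2 0 i) by apply: (bx (fun x => grad s x 0 i)); exact: blip_grad.
have bgg : blip W (fun p => (dot (grad s p.1.2) (grad s p.1.2))^-1).
  apply: (@blipV _ _ _ _ (N0 / 2)); first by rewrite divr_gt0.
  - by move=> p [_ /gA].
  - exact: blip_dot.
have bh : blip W (fun p => hess p.1.2 p.2).
  apply: blip_sum => i; apply: blipM => //; apply: blip_dot => // j.
  by apply: (bx (fun x => grad ('D_(delta_mx 0 i) s) x 0 j)); exact: blip_grad2.
have bB i : blip W (fun p => constrained p.1.1 p.1.2 p.2 0 i).
  have b1 : blip W (fun p => (hess p.1.2 p.2 + dot (grad s p.1.2) p.1.1)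
      / dot (grad s p.1.2) (grad s p.1.2)).
    by apply: blipM => //; apply: blipD => //; exact: blip_dot.
  by apply: (blip_ext (blipB (by_ i) (blipM b1 (bg i)))) => p; rewrite !mxE.
have [C [C0 BC BL]] := blip_rV bB.
exists eta, C; split=> //.
- by rewrite eta0.
- move=> x c sc xc; rewrite -normr_gt0 (lt_le_trans _ (gA x _)) ?divr_gt0//.
  by exists c.
- move=> y x v c yY sc xc v1.
  by apply: (BC (y, x, v)); split=> //; exists c.
move=> y x v c y' x' v' c' yY sc xc v1 yY' sc' xc' v1' d yd xd vd.
apply: le_trans (BL (y, x, v) (y', x', v') _ _) _; [by split=> //; exists c|by split=> //; exists c'|].
by rewrite ler_wpM2l// !prod_normE /= !ge_max yd xd vd.
Qed.

(** Let [z = (s o q)']. The equation gives [z' = - k z - pi (grad s . a)], so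
[z + k s o q] is a periodic function with derivative [- pi (grad s . a)]; by the
mean value theorem this derivative vanishes somewhere, whence [pi = 0]. Then [z]
is periodic with [z' = - k z], so [z = 0]. *)
Lemma closed_curve_level (tau k pi : R) (a : 'rV[R]_3) (q v f : R -> 'rV[R]_3) :
  0 < tau -> 0 < k ->
  (forall t : R, is_derive t 1 q (v t)) ->
  (forall t : R, is_derive t 1 v (- k *: v t + (f t - pi *: a))) ->
  periodic q tau -> periodic v tau ->
  (forall t, dot (grad s (q t)) (f t) = - hess (q t) (v t)) ->
  (forall t, dot (grad s (q t)) a != 0) ->
  pi = 0 /\ forall t, s (q t) = s (q 0).
Proof.
move=> tau0 k0 dq dv pq pv gf ga.
pose z t := dot (grad s (q t)) (v t).
have dsq (t : R) : is_derive t 1 (fun t => s (q t)) (z t) by exact: is_derive_comp_grad.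
have dz (t : R) : is_derive t 1 z (- k * z t - pi * dot (grad s (q t)) a).
  have dg : is_derive t 1 (fun t => grad s (q t)) (\row_i dot (grad ('D_(delta_mx 0 i) s) (q t)) (v t)).
    pose d := \row_i dot (grad ('D_(delta_mx 0 i) s) (q t)) (v t).
    apply: (@is_derive_rV _ _ (fun t => grad s (q t)) (fun=> d)) => i.
    apply: (is_derive_ext (is_derive_comp_grad (ds1 i (q t)) (dq t))) => [x|].
      by rewrite mxE.
    by rewrite mxE.
  apply: (is_derive_ext (is_derive_dot dg (dv t))) => //.
  have -> : dot (\row_i dot (grad ('D_(delta_mx 0 i) s) (q t)) (v t)) (v t) = hess (q t) (v t).
    by apply: eq_bigr => i _; rewrite mxE mulrC.
  by rewrite dotDr dotBr !dotZr gf /z; ring.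
have pi0 : pi = 0.
  have dw (t : R) : is_derive t 1 (fun t => z t + k * s (q t)) (- pi * dot (grad s (q t)) a).
    apply: (is_derive_ext (is_deriveD (dz t) (is_deriveZ k (dsq t)))) => //.
    by rewrite /GRing.scale/=; ring.
  have [t _] := MVT_ex (ltW tau0) dw.
  have -> : q tau = q 0 by rewrite -[tau]add0r pq.
  have -> : z tau = z 0 by rewrite /z -[tau]add0r pq pv.
  move=> /eqP; rewrite subrr subr0 eq_sym !mulf_eq0 (negbTE (ga t)) (gt_eqF tau0) !orbF.
  by rewrite oppr_eq0 => /eqP.
split=> // t.
have pz : periodic z tau by move=> x; rewrite /z pq pv.
have dz0 (x : R) : is_derive x 1 z (- k * z x + 0).
  by have := dz x; rewrite pi0 mul0r subr0 addr0.
have z0 (x : R) : z x = 0.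
  apply/eqP; rewrite eq_le; apply/andP; split.
    have := @periodic_linear_le _ z (fun=> 0) k 0 tau tau0 k0 dz0 pz (fun _ => lexx _) x.
    by rewrite mul0r.
  rewrite -oppr_le0; have := @periodic_linear_le _ (fun x : R => - z x) (fun=> 0) k 0 tau tau0 k0 _ _ (fun _ => lexx _) x.
  rewrite mul0r; apply=> y; last by rewrite pz.
  by apply: (is_derive_ext (is_deriveN (dz0 y))) => //; ring.
by apply: (@is_derive_0_is_cst _ (fun t => s (q t))) => x; rewrite -(z0 x).
Qed.

Lemma top_exists a : exists2 P, K P & forall y, K y -> dot a y <= dot a P.
Proof.
have [r r0 Kr] := body_bounded.
have bd : blip K (dot a).
  apply: (@blip_subset _ _ [set x | `|x| <= r]); first by move=> x /Kr.
  apply: (@blip_dot _ _ _ (fun=> a) id) => i; [exact: blip_cst|exact/blip_coord/ltW].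
have [|P] := compact_EVT_max _ cK (blip_continuous bd); first by exists 0; exact: interior_body.
by rewrite inE => KP top; exists P => // y Ky; apply: top; rewrite inE.
Qed.

(** The constrained equation is solved by [periodic_family] for every starting
point on the cap of [polar_cap], up to a constant force. Its components along
the horizontal vectors [t1], [t2] vanish for some starting point by [disc_zero],
and the remaining component vanishes by [closed_curve_level]. The constants [k],
[be], [h0] serve every vertical direction [a] and every force [Y] that is [be]-close
to constant gravity. *)
Lemma periodic_solution_near_top (g tau : R) : 0 < g -> 0 < tau ->
  exists k be h0 : R, [/\ 0 < k, 0 < be, 0 < h0 &
  forall (t1 t2 a : 'rV[R]_3) (Y : R -> 'rV[R]_3 -> 'rV[R]_3 -> 'rV[R]_3),
    dot a a = 1 -> dot t1 t1 = 1 -> dot t2 t2 = 1 ->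
    dot t1 t2 = 0 -> dot a t1 = 0 -> dot a t2 = 0 ->
    (forall x, x = dot x t1 *: t1 + dot x t2 *: t2 + dot x a *: a) ->
    (forall q v, periodic (fun t => Y t q v) tau) ->
    (forall q v, continuous (fun t => Y t q v)) ->
    (forall t q v, `|Y t q v + g *: a| <= be * (1 + `|q| + `|v|)) ->
    (forall t q v q' v', `|Y t q v - Y t q' v'| <= be * (`|q - q'| + `|v - v'|)) ->
  exists (q v : R -> 'rV[R]_3) (l : R -> R),
    [/\ periodic q tau, forall t : R, is_derive t 1 q (v t),
      forall t : R, is_derive t 1 v (- k *: v t + (Y t (q t) (v t) + l t *: grad s (q t))),
      forall t, s (q t) = 0 & forall t, h0 <= dot a (q t)]].
Proof.
move=> g0 tau0.
have [rm rm0 Krm] := body_bounded.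
have [r0 [kap [C1 [rho [[r00 kap0 C10 rho0] cap]]]]] := polar_cap.
have [N0 [N1 [N00 HN]]] := normal_bounds.
have N10 : 0 < N1.
  have [x sx] := surface_nonempty; have /andP[h1 h2] := HN x sx.
  exact: lt_le_trans N00 (le_trans h1 h2).
have rm1 : 0 <= rm + 1 by rewrite addr_ge0// ltW.
have [Ln [Ln0 _ HLn]] := blip_rV (fun i => blip_normal i rm1).
have [eta [CB [/andP[eta0 eta1] CB0 Bnz BC BL]]] := @constrained_blip (g + 1) (ltW (addr_gt0 g0 ltr01)).
(* from the rim of the disc of radius [rho / 4] on, the displacement [u] has
   maximum norm at least [ep], and tangential gravity has a scalar product at
   least [d1] with it *)
pose ep := rho / 8; have ep0 : 0 < ep by rewrite divr_gt0.
have [de de0 Hde] := @support_uniform (ep / C1) (divr_gt0 ep0 C10).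
pose d1 := g * (kap * de / N1).
have d10 : 0 < d1 by rewrite mulr_gt0// divr_gt0// mulr_gt0.
(* an error of [rp] on the mean force leaves half of [d1] *)
pose rp := d1 / (6 * rho); have rp0 : 0 < rp by rewrite divr_gt0// mulr_gt0.
pose D := 1 + tau.
have D0 : 0 < D by rewrite addr_gt0.
(* The speed bound [V] keeps an orbit, successively, inside the domain of
   [constrained], with a force close to its value at the starting point, with a
   normal that is never horizontal, and above height [r0 / 2]. *)
pose V := Num.min (Num.min 1 (eta / D))
  (Num.min (Num.min (rp / (CB * D + 1)) (kap / 2 / ((3 * Ln + 1) * D))) (r0 / 2 / (3 * D))).
have CD1 : 0 < CB * D + 1 by rewrite ltr_wpDl// mulr_ge0// ltW.
have Ln1 : 0 < 3 * Ln + 1 by rewrite ltr_wpDl// mulr_ge0.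
have V0 : 0 < V.
  have v1 : 0 < eta / D by rewrite divr_gt0.
  have v2 : 0 < rp / (CB * D + 1) by rewrite divr_gt0.
  have v3 : 0 < kap / 2 / ((3 * Ln + 1) * D) by rewrite !divr_gt0// mulr_gt0.
  have v4 : 0 < r0 / 2 / (3 * D) by rewrite !divr_gt0// mulr_gt0.
  by rewrite !lt_min ltr01 v1 v2 v3 v4.
have V1 : V <= 1 by rewrite !ge_min lexx.
have Veta : V * D <= eta by rewrite -ler_pdivlMr// !ge_min lexx !orbT.
have Vrp : V * (CB * D + 1) <= rp by rewrite -ler_pdivlMr// !ge_min lexx !orbT.
have Vkap : V * ((3 * Ln + 1) * D) <= kap / 2 by rewrite -ler_pdivlMr ?mulr_gt0// !ge_min lexx !orbT.
have Vr0 : V * (3 * D) <= r0 / 2 by rewrite -ler_pdivlMr ?mulr_gt0// !ge_min lexx !orbT.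
pose G := 3 + rm; have G0 : 0 < G by rewrite addr_gt0.
pose be := Num.min (Num.min 1 G^-1) (rp / (CB * G + 1)).
have CG1 : 0 < CB * G + 1 by rewrite ltr_wpDl// mulr_ge0// ltW.
have be0 : 0 < be by rewrite !lt_min ltr01 /= invr_gt0 G0 divr_gt0.
have be1 : be <= 1 by rewrite !ge_min lexx.
have beG : be * G <= 1 by rewrite -ler_pdivlMr// div1r !ge_min lexx !orbT.
have berp : be * (CB * G + 1) <= rp by rewrite -ler_pdivlMr// !ge_min lexx !orbT.
(* the smallness conditions of [periodic_family] *)
pose k := 2 * CB / V + 4 * CB * (tau + 1) + 1.
have k1 : 0 <= 2 * CB / V by rewrite divr_ge0 ?mulr_ge0// ltW.
have k2 : 0 <= 4 * CB * (tau + 1) by rewrite mulr_ge0 ?mulr_ge0// ltW// addr_gt0.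
have k0 : 0 < k by rewrite /k; lra.
have VD : V * tau <= V * D by rewrite ler_wpM2l ?(ltW V0)// /D lerDr.
exists k, be, (r0 / 2); split=> //; first by rewrite divr_gt0.
move=> t1 t2 a Y a1 t11 t22 t12 at1 at2 expand pY cY bY lY.
have na1 := norm_le1_dot a1; have nt1 := norm_le1_dot t11; have nt2 := norm_le1_dot t22.
have [P KP top] := top_exists a.
pose A := [set x | exists2 c, s c = 0 & `|x - c| <= eta].
have Arm x : A x -> `|x| <= rm + 1.
  move=> [c sc xc]; rewrite -(subrK c x) (le_trans (ler_normD _ _))// addrC lerD//.
    exact/Krm/surface_body.
  exact: le_trans xc eta1.
pose Phi t q v := constrained (Y t q v) q v.
have Yga t q v : A q -> `|v| <= V -> `|Y t q v + g *: a| <= be * G.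
  move=> /Arm qr vV; rewrite (le_trans (bY _ _ _))// ler_wpM2l ?(ltW be0)// /G.
  have -> : 3 + rm = 1 + (rm + 1) + 1 by ring.
  by rewrite !lerD// (le_trans vV).
have Y1 t q v : A q -> `|v| <= V -> `|Y t q v| <= g + 1.
  move=> Aq vV; rewrite -[Y t q v](addrK (g *: a)) (le_trans (ler_normB _ _))// addrC lerD//.
    by rewrite normrZ gtr0_norm// ler_piMr// ltW.
  exact: le_trans (Yga _ _ _ Aq vV) beG.
have Phi_periodic q v : periodic (fun t => Phi t q v) tau.
  by move=> t; rewrite /Phi pY.
have Phi_continuous q v : continuous (fun t => Phi t q v).
  have cd := continuous_dotr (u := grad s q) (cY q v).
  move=> t; apply: cvgB; first exact: cY.
  apply: cvgZ; last exact: cvg_cst.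
  apply: cvgM; last exact: cvg_cst.
  by apply: cvgD; [exact: cvg_cst|exact: cd].
have Phi_bounded t q v : A q -> `|v| <= V -> `|Phi t q v| <= CB.
  move=> Aq vV; have [c sc qc] := Aq.
  by apply: (BC _ _ _ c) => //; [exact: Y1|exact: le_trans vV V1].
have Phi_lipschitz t q1 q2 v1 v2 : A q1 -> A q2 -> `|v1| <= V -> `|v2| <= V ->
    `|Phi t q1 v1 - Phi t q2 v2| <= CB * (`|q1 - q2| + `|v1 - v2|).
  move=> Aq1 Aq2 vV1 vV2; have [c1 sc1 qc1] := Aq1; have [c2 sc2 qc2] := Aq2.
  apply: (BL _ _ _ c1 _ _ _ c2) => //; try exact: Y1.
  - exact: le_trans vV1 V1.
  - exact: le_trans vV2 V1.
  - by rewrite (le_trans (lY _ _ _ _ _))// ler_piMl// addr_ge0.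
  - by rewrite lerDl.
  - by rewrite lerDr.
have kM : 2 * CB <= k * V.
  have -> : k * V = 2 * CB + (4 * CB * (tau + 1) * V + V) by rewrite /k; field; rewrite gt_eqF.
  by rewrite lerDl addr_ge0 ?(ltW V0)// mulr_ge0// ltW.
have kL : 4 * CB * (tau + 1) <= k by rewrite /k addrAC lerDr addr_ge0.
have [vf [p [family plip]]] := periodic_family tau0 k0 (ltW V0) CB0 Phi_periodic
  Phi_continuous Phi_bounded Phi_lipschitz kM kL.
have inner c : s c = 0 -> forall q, `|q - c| <= V * tau -> A q.
  by move=> sc q qc; exists c => //; exact: le_trans qc (le_trans VD Veta).
pose X (z : R * R) := P + (z.1 *: t1 + z.2 *: t2).
pose r := rho / 2; have r_gt0 : 0 < r by rewrite divr_gt0.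
pose sq := [set z : (R * R)%type | -r <= z.1 <= r /\ -r <= z.2 <= r].
have uX z : dot a (z.1 *: t1 + z.2 *: t2) = 0 by rewrite dotDr !dotZr at1 at2 !mulr0 addr0.
have nu (x y : R) : `|x *: t1 + y *: t2| <= `|x| + `|y|.
  by rewrite (le_trans (ler_normD _ _))// !normrZ lerD// ler_piMr.
have urho z : sq z -> `|z.1 *: t1 + z.2 *: t2| <= rho.
  move=> [z1 z2]; rewrite (le_trans (nu _ _))// [leRHS](splitr rho).
  by rewrite lerD// ler_norml.
have capz z : sq z -> _ := fun zs => cap a P _ a1 KP top (uX z) (urho z zs).
pose c z := radial (X z).
have sc z : sq z -> s (c z) = 0.
  by move=> /capz[x0 _ _ _ _]; exact: gauge_surface.
have gravity_dot n u : dot a u = 0 ->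
    dot (- (g *: a) - (dot n (- (g *: a)) / dot n n) *: n) u = g * (dot n a * dot n u / dot n n).
  by move=> au; rewrite dotBl dotNl !dotZl dotNr dotZr au; ring.
(* the mean force [p (c z)] is close to the tangential part of gravity *)
have pclose z : sq z -> `|p (c z) - constrained (- (g *: a)) (c z) 0| <= rp.
  move=> zs; have [q [_ _ _ _ [_ vV qc mp]]] := family (c z) (inner _ (sc z zs)).
  apply: mp => t; have Aq : A (q t) by apply: inner (sc z zs) _ _.
  have [c' sc' qc'] := Aq; pose d := Num.max (V * D) (be * G).
  have dV : V * D <= d by rewrite le_max lexx.
  have V_D : V <= V * D by rewrite ler_peMr ?(ltW V0)// /D lerDl ltW.
  apply: (@le_trans _ _ (CB * d)).
    apply: (BL _ _ _ c' _ _ _ (c z)) => //.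
    - exact: Y1.
    - exact: le_trans (vV t) V1.
    - by rewrite normrN normrZ gtr0_norm// (@le_trans _ _ g)// ?lerDl// ler_piMr// ltW.
    - exact: sc.
    - by rewrite subrr normr0 ltW.
    - by rewrite normr0.
    - by rewrite opprK (le_trans (Yga _ _ _ Aq (vV t)))// le_max lexx orbT.
    - exact: le_trans (qc t) (le_trans VD dV).
    - by rewrite subr0 (le_trans (vV t))// (le_trans V_D).
  rewrite /d; have [_|_] := leP (V * D) (be * G).
    by rewrite (le_trans _ berp)// [leRHS]mulrDr mulr1 mulrCA lerDl ltW.
  by rewrite (le_trans _ Vrp)// [leRHS]mulrDr mulr1 mulrCA lerDl ltW.
(* hence on the rim of the cap [p] points outwards *)
have F_out z : sq z -> (rho / 4) ^+ 2 <= z.1 ^+ 2 + z.2 ^+ 2 ->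
    0 < z.1 * dot (p (c z)) t1 + z.2 * dot (p (c z)) t2.
  move=> zs out; have [x0 /andP[J1 _] uC kapc [nP _]] := capz z zs.
  set u := z.1 *: t1 + z.2 *: t2 in x0 J1 uC kapc nP.
  rewrite -/(X z) in x0 J1 uC kapc nP; rewrite -/(c z) in uC kapc nP.
  have -> : z.1 * dot (p (c z)) t1 + z.2 * dot (p (c z)) t2 = dot (p (c z)) u.
    by rewrite /u dotDr !dotZr.
  have uu : dot u u = z.1 ^+ 2 + z.2 ^+ 2.
    by rewrite /u !(dotDl, dotDr, dotZl, dotZr) t11 t22 t12 (dotC t2) t12; ring.
  have ur := urho z zs; rewrite -/u in ur.
  have ue : ep <= `|u|.
    have -> : ep = rho / 4 / 2 by rewrite /ep; field.
    by apply: norm_ge_dot; rewrite ?divr_gt0// uu.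
  have sz := sc z zs; set n := normal (c z) in kapc nP.
  have nu_de : de <= dot n u.
    have hc : de <= dot n (c z - P).
      apply: Hde => //; rewrite ler_pdivrMr// mulrC; exact: le_trans ue uC.
    have Jc : X z = gauge (X z) *: c z.
      by rewrite /c /radial scalerA divff ?scale1r// gt_eqF// (lt_le_trans ltr01).
    have -> : u = gauge (X z) *: (c z - P) + (gauge (X z) - 1) *: P.
      have -> : u = X z - P by rewrite /X addrAC subrr add0r.
      by rewrite {1}Jc scalerBr scalerBl scale1r addrA subrK.
    rewrite dotDr !dotZr -[leLHS]addr0 lerD//.
      by rewrite (le_trans hc)// ler_peMl// (le_trans (ltW de0)).
    by rewrite mulr_ge0 ?subr_ge0// ltW.
  have /andP[nn0 nn1] := HN _ sz; rewrite -/n in nn0 nn1.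
  have nnp : 0 < dot n n by exact: lt_le_trans nn0.
  have big : d1 <= dot (constrained (- (g *: a)) (c z) 0) u.
    rewrite constrained_rest gravity_dot; last exact: uX.
    rewrite /d1 ler_wpM2l ?(ltW g0)// -/n.
    by rewrite ler_pM ?mulr_ge0 ?invr_ge0 ?(ltW kap0) ?(ltW de0) ?(ltW N10)// ?ler_pM ?(ltW kap0) ?(ltW de0)// lef_pV2.
  have := ler_norm_dot (p (c z) - constrained (- (g *: a)) (c z) 0) u.
  rewrite dotBl ler_norml => /andP[low _].
  have : 3 * `|p (c z) - constrained (- (g *: a)) (c z) 0| * `|u| <= 3 * rp * rho.
    by rewrite ler_pM// ?mulr_ge0// ler_wpM2l// pclose.
  have -> : 3 * rp * rho = d1 / 2 by rewrite /rp; field; rewrite gt_eqF.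
  exact: gt0_of_close d10 big low.
have b1 := blip_fst_square (ltW r_gt0); have b2 := blip_snd_square (ltW r_gt0).
have bX i : blip sq (fun z => X z 0 i).
  have bt := blipD (blipM b1 (blip_cst _ (t1 0 i))) (blipM b2 (blip_cst _ (t2 0 i))).
  by apply: (blip_ext (blipD (blip_cst _ (P 0 i)) bt)) => z; rewrite !mxE.
have [CX [CX0 _ LX]] := blip_rV bX.
have [rb rb0 Krb] := body_ball.
have bJ : blip sq (fun z => gauge (X z)).
  exists (2 + CX / rb); split=> [|z zs|z z' zs zs'].
  - by rewrite addr_ge0// divr_ge0// ltW.
  - have [_ /andP[J1 J2] _ _ _] := capz z zs.
    by rewrite ger0_norm ?(le_trans _ J1)// (le_trans J2)// lerDl divr_ge0// ltW.
  - have [x0 _ _ _ _] := capz z zs; have [x0' _ _ _ _] := capz z' zs'.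
    rewrite (le_trans (gauge_lipschitz rb0 Krb x0' x0))// ler_pdivrMr//.
    rewrite (le_trans (LX _ _ zs zs'))// mulrAC ler_wpM2r// mulrDl divfK ?gt_eqF//.
    by rewrite lerDr mulr_ge0// ltW.
have bc i : blip sq (fun z => c z 0 i).
  have bV : blip sq (fun z => (gauge (X z))^-1).
    apply: (@blipV _ _ _ _ 1) => // z zs; have [_ /andP[J1 _] _ _ _] := capz z zs.
    by rewrite ger0_norm ?(le_trans _ J1).
  by apply: (blip_ext (blipM bV (bX i))) => z; rewrite /c /radial [RHS]mxE.
have [Cc [Cc0 _ Lc]] := blip_rV bc.
have bF i : blip sq (fun z => p (c z) 0 i).
  have ct : 0 <= CB * (2 + tau) by rewrite mulr_ge0// addr_ge0// ltW.
  have crp : 0 <= CB + rp by rewrite addr_ge0// ltW.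
  exists (CB + rp + CB * (2 + tau) * Cc); split=> [|z zs|z z' zs zs'].
  - by rewrite addr_ge0// mulr_ge0.
  - rewrite (le_trans (norm_coord _ _))// (@le_trans _ _ (CB + rp))//.
      rewrite -[p (c z)](subrK (constrained (- (g *: a)) (c z) 0)) addrC.
      rewrite (le_trans (ler_normD _ _))// lerD ?pclose//.
      apply: (BC _ _ _ (c z)); rewrite ?sc ?subrr ?normr0 ?(ltW eta0)//.
      by rewrite normrN normrZ gtr0_norm// (@le_trans _ _ g)// ?lerDl// ler_piMr// ltW.
    by rewrite lerDl mulr_ge0.
  - have := norm_coord (p (c z) - p (c z')) i; rewrite !mxE => /le_trans; apply.
    apply: le_trans (plip _ _ (inner _ (sc z zs)) (inner _ (sc z' zs'))) _.
    rewrite (@le_trans _ _ (CB * (2 + tau) * (Cc * `|z - z'|)))//.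
      by rewrite ler_wpM2l// Lc.
    by rewrite mulrA ler_wpM2r// lerDr.
have bF1 t : blip sq (fun z => dot (p (c z)) t).
  by apply: (@blip_dot _ _ _ _ (fun=> t)) => // i; exact: blip_cst.
have e0 : 0 < rho / 4 by rewrite divr_gt0.
have er : rho / 4 < r by rewrite /r ltr_pM2l// ltf_pV2 ?posrE// ltr_nat.
have [z [zs z1 z2]] := disc_zero e0 er (bF1 t1) (bF1 t2) F_out.
(* at the zero found, [p (c z)] is vertical *)
have pa : p (c z) = dot (p (c z)) a *: a by rewrite {1}[p (c z)]expand z1 z2 !scale0r !add0r.
have [q [pq pv q0 dq [dv vV qc _]]] := family (c z) (inner _ (sc z zs)).
have Aq t : A (q t) by apply: inner (sc z zs) _ _.
rewrite pa in dv.
have [_ _ _ kapc [_ r0c]] := capz z zs.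
have qcD t : `|q t - c z| <= V * D by exact: le_trans (qc t) VD.
have ga t : dot (grad s (q t)) a != 0.
  have cr : `|c z| <= rm + 1.
    by rewrite (@le_trans _ _ rm) ?lerDl//; exact/Krm/surface_body/sc.
  have nq : 0 < dot (normal (q t)) a.
    rewrite -[normal (q t)](subrK (normal (c z))) dotDl.
    have := ler_norm_dot (normal (q t) - normal (c z)) a; rewrite ler_norml => /andP[h _].
    have h1 : 3 * `|normal (q t) - normal (c z)| * `|a| <= 3 * (Ln * (V * D)).
      rewrite -mulrA ler_wpM2l// -[leRHS]mulr1 ler_pM//.
      by rewrite (le_trans (HLn _ _ (Arm _ (Aq t)) cr))// ler_wpM2l.
    have := mulr_ge0 (ltW V0) (ltW D0); have := kap0; lra.
  by apply: contraTneq nq => nq; rewrite /normal dotZl nq mulr0 ltxx.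
have gf t : dot (grad s (q t)) (Phi t (q t) (vf (c z) t)) = - hess (q t) (vf (c z) t).
  have [c' sc' qc'] := Aq t.
  by rewrite grad_constrained//; exact: Bnz qc'.
have [pi0 level] := closed_curve_level tau0 k0 dq dv pq pv gf ga.
exists q, (vf (c z)), (fun t =>
  - ((hess (q t) (vf (c z) t) + dot (grad s (q t)) (Y t (q t) (vf (c z) t)))
  / dot (grad s (q t)) (grad s (q t)))); split=> // [t|t|t].
- have := dv t; rewrite pi0 scale0r subr0 /Phi /constrained -scaleNr; exact.
- by rewrite level q0 sc.
have := ler_norm_dot a (q t - c z); rewrite ler_norml dotBr => /andP[h _].
have h1 : 3 * `|a| * `|q t - c z| <= 3 * (V * D).
  by rewrite -mulrA ler_wpM2l// -[leRHS]mul1r ler_pM.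
lra.
Qed.

End Body.

(** * The cross product *)

Section Cross.
Variable R : realType.
Implicit Types u v w : 'rV[R]_3.

Lemma cross0 u v : cross u v 0 0 = u 0 1 * v 0 2 - u 0 2 * v 0 1.
Proof. by rewrite mxE !add0r. Qed.
Lemma cross1 u v : cross u v 0 1 = u 0 2 * v 0 0 - u 0 0 * v 0 2.
Proof. by rewrite mxE; congr (u _ _ * v _ _ - u _ _ * v _ _); apply: val_inj. Qed.
Lemma cross2 u v : cross u v 0 2 = u 0 0 * v 0 1 - u 0 1 * v 0 0.
Proof. by rewrite mxE; congr (u _ _ * v _ _ - u _ _ * v _ _); apply: val_inj. Qed.

Lemma row3P u v : u 0 0 = v 0 0 -> u 0 1 = v 0 1 -> u 0 2 = v 0 2 -> u = v.
Proof.
move=> h0 h1 h2; apply/rowP => -[[|[|[|//]]] ilt].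
- by rewrite (_ : Ordinal ilt = 0)//; exact: val_inj.
- by rewrite (_ : Ordinal ilt = 1)//; exact: val_inj.
- by rewrite (_ : Ordinal ilt = 2)//; exact: val_inj.
Qed.

Lemma crossDr u v w : cross u (v + w) = cross u v + cross u w.
Proof. by apply/rowP => i; rewrite !mxE; ring. Qed.
Lemma crossNr u v : cross u (- v) = - cross u v.
Proof. by apply/rowP => i; rewrite !mxE; ring. Qed.
Lemma crossBr u v w : cross u (v - w) = cross u v - cross u w.
Proof. by rewrite crossDr crossNr. Qed.

Lemma cross_cross u w : cross u (cross w u) = dot u u *: w - dot u w *: u.
Proof. by apply: row3P; rewrite !(cross0, cross1, cross2) !dotE !mxE; ring. Qed.

Lemma ler_norm_cross u v : `|cross u v| <= 2 * `|u| * `|v|.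
Proof.
apply: ler_norm_rV => [|i]; first by rewrite !mulr_ge0.
rewrite mxE (le_trans (ler_normB _ _))// -mulrA mulr_natl mulr2n.
by rewrite !normrM lerD// ler_pM// norm_coord.
Qed.

Lemma is_derive_cross (F G : R -> 'rV[R]_3) (f g : 'rV[R]_3) (t : R) :
  is_derive t 1 F f -> is_derive t 1 G g ->
  is_derive t 1 (fun t => cross (F t) (G t)) (cross f (G t) + cross (F t) g).
Proof.
move=> dF dG.
apply: (@is_derive_rV _ _ (fun t => cross (F t) (G t)) (fun=> cross f (G t) + cross (F t) g)) => i.
have d a b := is_deriveM (is_derive_coord a dF) (is_derive_coord b dG).
apply: (is_derive_ext (is_deriveB (d (i + 1) (i + 2)) (d (i + 2) (i + 1)))) => [x|].
  by rewrite mxE.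
by rewrite !mxE /GRing.scale/=; ring.
Qed.

Lemma continuous_cross (T : topologicalType) (F G : T -> 'rV[R]_3) :
  continuous F -> continuous G -> continuous (fun t => cross (F t) (G t)).
Proof.
move=> cF cG; apply: continuous_rV => i.
have -> : (fun t => cross (F t) (G t) 0 i) =
    fun t => F t 0 (i + 1) * G t 0 (i + 2) - F t 0 (i + 2) * G t 0 (i + 1).
  by apply/funext => t; rewrite mxE.
have cc a b : continuous (fun t => F t 0 a * G t 0 b).
  by move=> t; apply: cvgM; apply: continuous_row_coord.
by move=> t; apply: cvgB; exact: cc.
Qed.

Lemma continuous_dot (T : topologicalType) (F G : T -> 'rV[R]_3) :
  continuous F -> continuous G -> continuous (fun t => dot (F t) (G t)).
Proof.
move=> cF cG; have -> : (fun t => dot (F t) (G t)) =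
    fun t => F t 0 0 * G t 0 0 + F t 0 1 * G t 0 1 + F t 0 2 * G t 0 2.
  by apply/funext => t; rewrite dotE.
have cc i : continuous (fun t => F t 0 i * G t 0 i).
  by move=> t; apply: cvgM; apply: continuous_row_coord.
by move=> t; apply: cvgD; [apply: cvgD|]; exact: cc.
Qed.

Lemma continuous_addv (T : topologicalType) (F G : T -> 'rV[R]_3) :
  continuous F -> continuous G -> continuous (fun t => F t + G t).
Proof. by move=> cF cG t; apply: cvgD; [exact: cF|exact: cG]. Qed.

Lemma continuous_scalev (T : topologicalType) (f : T -> R) (F : T -> 'rV[R]_3) :
  continuous f -> continuous F -> continuous (fun t => f t *: F t).
Proof. by move=> cf cF t; apply: cvgZ; [exact: cf|exact: cF]. Qed.

Lemma continuous_sum3 (T : topologicalType) (F : 'I_3 -> T -> 'rV[R]_3) :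
  (forall i, continuous (F i)) -> continuous (fun t => \sum_(i < 3) F i t).
Proof.
move=> cF; have -> : (fun t => \sum_(i < 3) F i t) =
    (fun t => F 0 t + F (lift ord0 ord0) t + F (lift ord0 (lift ord0 ord0)) t).
  by apply/funext => t; rewrite !big_ord_recl big_ord0 addr0 addrA.
by apply: continuous_addv => //; exact: continuous_addv.
Qed.

Lemma is_derive_sum3 (F : 'I_3 -> R -> 'rV[R]_3) (f : 'I_3 -> 'rV[R]_3) (t : R) :
  (forall i, is_derive t 1 (F i) (f i)) ->
  is_derive t 1 (fun t => \sum_(i < 3) F i t) (\sum_(i < 3) f i).
Proof.
move=> dF; apply: (is_derive_ext (is_deriveD (is_deriveD (dF ord0)
  (dF (lift ord0 ord0))) (dF (lift ord0 (lift ord0 ord0))))) => [x|].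
  by rewrite !big_ord_recl big_ord0 addr0 addrA.
by rewrite !big_ord_recl big_ord0 addr0 addrA.
Qed.

End Cross.

(** * Motion in a rotating frame *)

Section Frame.
Variables (R : realType) (e : 'I_3 -> R -> 'rV[R]_3) (w : R -> 'rV[R]_3) (tau b : R).
Hypothesis frame_e : rotating_frame e.
Hypothesis tau0 : 0 < tau.
Hypothesis pe : forall i, periodic (e i) tau.
Hypothesis we : angular_velocity e w.
Hypothesis wb : forall t, enorm (in_space e t (w t)) < b.
Hypothesis dwb : forall t, enorm (in_space e t (derive1 w t)) < b.
Implicit Types (x y : 'rV[R]_3) (t : R).

Definition coords t y : 'rV[R]_3 := \row_i dot (e i t) y.

Lemma dot_frame t i j : dot (e i t) (e j t) = (i == j)%:R.
Proof. by have [_] := frame_e. Qed.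

Let E t : 'M[R]_3 := \matrix_(i, j) e i t 0 j.

Let in_spaceE t x : in_space e t x = x *m E t.
Proof.
by apply/rowP => j; rewrite summxE mxE; apply: eq_bigr => i _; rewrite !mxE.
Qed.

Let coordsE t y : coords t y = y *m (E t)^T.
Proof. by apply/rowP => j; rewrite !mxE; apply: eq_bigr => i _; rewrite !mxE mulrC. Qed.

Let EET t : E t *m (E t)^T = 1%:M.
Proof.
apply/matrixP => i j; rewrite !mxE -(dot_frame t).
by apply: eq_bigr => l _; rewrite !mxE.
Qed.

Let ETE t : (E t)^T *m E t = 1%:M.
Proof. exact/mulmx1C/EET. Qed.

Lemma coordsK t y : in_space e t (coords t y) = y.
Proof. by rewrite in_spaceE coordsE -mulmxA ETE mulmx1. Qed.

Lemma in_spaceK t x : coords t (in_space e t x) = x.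
Proof. by rewrite in_spaceE coordsE -mulmxA EET mulmx1. Qed.

Lemma in_spaceD t x y : in_space e t (x + y) = in_space e t x + in_space e t y.
Proof. by rewrite !in_spaceE mulmxDl. Qed.

Lemma in_spaceZ t (k : R) x : in_space e t (k *: x) = k *: in_space e t x.
Proof. by rewrite !in_spaceE scalemxAl. Qed.

Lemma in_spaceN t x : in_space e t (- x) = - in_space e t x.
Proof. by rewrite !in_spaceE mulNmx. Qed.

Lemma in_spaceB t x y : in_space e t (x - y) = in_space e t x - in_space e t y.
Proof. by rewrite in_spaceD in_spaceN. Qed.

Lemma coordsD t x y : coords t (x + y) = coords t x + coords t y.
Proof. by rewrite !coordsE mulmxDl. Qed.

Lemma coordsN t y : coords t (- y) = - coords t y.
Proof. by rewrite !coordsE mulNmx. Qed.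

Lemma coordsB t x y : coords t (x - y) = coords t x - coords t y.
Proof. by rewrite coordsD coordsN. Qed.

Let dotmx x y : dot x y = (x *m y^T) 0 0.
Proof. by rewrite mxE; apply: eq_bigr => i _; rewrite !mxE. Qed.

Lemma dot_coords t x y : dot (coords t x) (coords t y) = dot x y.
Proof. by rewrite !dotmx !coordsE trmx_mul trmxK -mulmxA [(E t)^T *m _]mulmxA ETE mul1mx. Qed.

Lemma norm_frame t i : `|e i t| <= 1.
Proof. by apply: norm_le1_dot; rewrite dot_frame eqxx. Qed.

Lemma ler_norm_coords t y : `|coords t y| <= 3 * `|y|.
Proof.
apply: ler_norm_rV => [|i]; first by rewrite mulr_ge0.
rewrite mxE (le_trans (ler_norm_dot _ _))// ler_wpM2r// ler_piMr//; exact: norm_frame.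
Qed.

Lemma ler_norm_in_space t x : `|in_space e t x| <= 3 * `|x|.
Proof.
rewrite (le_trans (ler_norm_sum _ _ _))// (@le_trans _ _ (\sum_(i < 3) `|x|))//.
  apply: ler_sum => i _; rewrite normrZ (@le_trans _ _ (`|x| * 1))//.
    by rewrite ler_pM// ?norm_coord// norm_frame.
  by rewrite mulr1.
by rewrite sumr_const card_ord mulr_natl.
Qed.

Lemma norm_le_enorm x : `|x| <= enorm x.
Proof.
by rewrite -ler_sqr ?nnegrE ?sqrtr_ge0// sqr_sqrtr ?dot_ge0// dot_ge_norm.
Qed.

Let e1 i := derive1 (e i).
Let e2 i := derive1 (e1 i).

Let derive_e i (t : R) : is_derive t 1 (e i) (e1 i t).
Proof. by rewrite /e1 derive1E; apply/derivableP; have [/(_ i 0%N t)] := frame_e. Qed.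

Let derive_e1 i (t : R) : is_derive t 1 (e1 i) (e2 i t).
Proof. by rewrite /e2 derive1E; apply/derivableP; have [/(_ i 1%N t)] := frame_e. Qed.

Let continuous_e i : continuous (e i).
Proof. exact: is_derive_continuous (derive_e i). Qed.

Let continuous_e1 i : continuous (e1 i).
Proof. exact: is_derive_continuous (derive_e1 i). Qed.

Let continuous_e2 i : continuous (e2 i).
Proof.
have d (t : R) : is_derive t 1 (e2 i) (derive1 (e2 i) t).
  by rewrite derive1E; apply/derivableP; have [/(_ i 2%N t)] := frame_e.
exact: is_derive_continuous d.
Qed.

Lemma periodic_derive (F F' : R -> 'rV[R]_3) : periodic F tau ->
  (forall t, is_derive t 1 F (F' t)) -> periodic F' tau.
Proof.
move=> pF dF t.
have h1 := is_derive_shift_arg (dF (t + tau)).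
have h2 : is_derive t 1 F (F' (t + tau)).
  by apply: (is_derive_ext h1) => // x; rewrite pF.
by rewrite -(@derive_val _ _ _ _ _ _ _ h2) (@derive_val _ _ _ _ _ _ _ (dF t)).
Qed.

(** The formula [omega = 1/2 sum e_i x e_i'] recovers the angular velocity from
the frame, which shows that it is as regular and as periodic as the frame. *)
Definition spin (t : R) : 'rV[R]_3 := 2^-1 *: \sum_(i < 3) cross (e i t) (derive1 (e i) t).

Lemma angular_velocityE (t : R) : in_space e t (w t) = spin t.
Proof.
rewrite /spin; set W := in_space e t (w t).
have -> : \sum_(i < 3) cross (e i t) (derive1 (e i) t) =
    \sum_(i < 3) (W - coords t W 0 i *: e i t).
  apply: eq_bigr => i _.
  by rewrite we -/W cross_cross dot_frame eqxx scale1r mxE.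
rewrite sumrB sumr_const card_ord.
have -> : \sum_(i < 3) coords t W 0 i *: e i t = W by exact: coordsK.
by clearbody W; rewrite mulrSr addrK mulr2n; apply/rowP => i; rewrite !mxE; lra.
Qed.

Let wE (t : R) : w t = coords t (spin t).
Proof. by rewrite -[w t](in_spaceK t) angular_velocityE. Qed.

Let dspin (t : R) : 'rV[R]_3 :=
  2^-1 *: \sum_(i < 3) (cross (e1 i t) (e1 i t) + cross (e i t) (e2 i t)).

Let derive_spin (t : R) : is_derive t 1 spin (dspin t).
Proof.
exact: is_deriveZ (is_derive_sum3 (fun i => is_derive_cross (derive_e i t) (derive_e1 i t))).
Qed.

Let continuous_spin : continuous spin.
Proof. exact: is_derive_continuous derive_spin. Qed.

Let continuous_dspin : continuous dspin.
Proof.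
apply: continuous_scalev; first by move=> t; exact: cvg_cst.
by apply: continuous_sum3 => i; apply: continuous_addv; exact: continuous_cross.
Qed.

Let w' (t : R) : 'rV[R]_3 := (\row_j dot (e1 j t) (spin t)) + coords t (dspin t).

Let derive_w (t : R) : is_derive t 1 w (w' t).
Proof.
apply: is_derive_rV => j.
apply: (is_derive_ext (is_derive_dot (derive_e j t) (derive_spin t))) => [x|].
  by rewrite wE mxE.
by rewrite !mxE.
Qed.

Let derive1_w : derive1 w = w'.
Proof. by apply/funext => t; rewrite derive1E; exact: (@derive_val _ _ _ _ _ _ _ (derive_w t)). Qed.

Let continuous_in_space (F : R -> 'rV[R]_3) : continuous F ->
  continuous (fun t => in_space e t (F t)).
Proof.
by move=> cF; apply: continuous_sum3 => i; apply: continuous_scalev => //; exact: continuous_row_coord.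
Qed.

Let continuous_row_dot (F : 'I_3 -> R -> 'rV[R]_3) (G : R -> 'rV[R]_3) :
  (forall i, continuous (F i)) -> continuous G -> continuous (fun t => \row_i dot (F i t) (G t)).
Proof.
move=> cF cG; apply: continuous_rV => i.
have -> : (fun t => (\row_i dot (F i t) (G t)) 0 i) = fun t => dot (F i t) (G t).
  by apply/funext => t; rewrite mxE.
exact: continuous_dot.
Qed.

Let continuous_coords (F : R -> 'rV[R]_3) : continuous F -> continuous (fun t => coords t (F t)).
Proof. by move=> cF; exact: continuous_row_dot. Qed.

Let continuous_w' : continuous w'.
Proof.
exact: (continuous_addv (continuous_row_dot continuous_e1 continuous_spin) (continuous_coords continuous_dspin)).
Qed.

Lemma periodic_in_space x : periodic (fun t => in_space e t x) tau.
Proof. by move=> t; apply: eq_bigr => i _; rewrite pe. Qed.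

Lemma periodic_coords x : periodic (fun t => coords t x) tau.
Proof. by move=> t; apply/rowP => i; rewrite !mxE pe. Qed.

Let periodic_spin : periodic spin tau.
Proof.
move=> t; have pe1 i : e1 i (t + tau) = e1 i t by exact: (periodic_derive (pe i) (derive_e i)).
congr (_ *: _); apply: eq_bigr => i _; rewrite pe; congr (cross _ _); exact: pe1.
Qed.

Lemma periodic_w : periodic w tau.
Proof. by move=> t; rewrite !wE periodic_spin; exact: periodic_coords. Qed.

Lemma periodic_dw : periodic (derive1 w) tau.
Proof. by rewrite derive1_w; apply: periodic_derive derive_w; exact: periodic_w. Qed.

(** The Euler, centrifugal and Coriolis accelerations; the inertial forces are
their opposites. *)
Definition inertial t q v :=
  cross (in_space e t (derive1 w t)) (in_space e t q)
  + cross (in_space e t (w t)) (cross (in_space e t (w t)) (in_space e t q))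
  + 2 *: cross (in_space e t (w t)) (in_space e t v).

(** The forces other than friction and reaction, per unit mass and in rotating
coordinates. *)
Definition applied (g : R) t q v := - (g *: coords t e_z) - coords t (inertial t q v).

Lemma inertialB t q v q' v' : inertial t q v - inertial t q' v' = inertial t (q - q') (v - v').
Proof.
rewrite /inertial !in_spaceB !crossBr !scalerBr.
by apply/rowP => i; rewrite !mxE; ring.
Qed.

Lemma ler_norm_inertial t q v : b <= 1 -> `|inertial t q v| <= 18 * b * (`|q| + `|v|).
Proof.
move=> b1; have b0 : 0 <= b by rewrite (le_trans (sqrtr_ge0 _) (ltW (wb t))).
set W := in_space e t (w t); have Wb : `|W| <= b by exact: le_trans (norm_le_enorm _) (ltW (wb t)).
set dW := in_space e t (derive1 w t).
have dWb : `|dW| <= b by exact: le_trans (norm_le_enorm _) (ltW (dwb t)).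
have hq := ler_norm_in_space t q; have hv := ler_norm_in_space t v.
have h1 : `|cross dW (in_space e t q)| <= 2 * b * (3 * `|q|).
  by rewrite (le_trans (ler_norm_cross _ _))// ler_pM// ?mulr_ge0// ler_wpM2l.
have h2 : `|cross W (in_space e t q)| <= 2 * b * (3 * `|q|).
  by rewrite (le_trans (ler_norm_cross _ _))// ler_pM// ?mulr_ge0// ler_wpM2l.
have h3 : `|cross W (in_space e t v)| <= 2 * b * (3 * `|v|).
  by rewrite (le_trans (ler_norm_cross _ _))// ler_pM// ?mulr_ge0// ler_wpM2l.
have h4 : `|cross W (cross W (in_space e t q))| <= 2 * 1 * (2 * b * (3 * `|q|)).
  rewrite (le_trans (ler_norm_cross _ _))// ler_pM// ?mulr_ge0// ler_wpM2l//.
  exact: le_trans Wb b1.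
rewrite /inertial (le_trans (ler_normD _ _))// normrZ ger0_norm//.
have := ler_normD (cross dW (in_space e t q)) (cross W (cross W (in_space e t q))).
have := mulr_ge0 b0 (normr_ge0 v); have := mulr_ge0 b0 (normr_ge0 q).
rewrite -/W -/dW; lra.
Qed.

(** The vertical, seen in the rotating frame, is periodic and moves at a speed
controlled by [b], so it drifts from its initial value during one period only. *)
Lemma vertical_drift t : `|coords t e_z - coords 0 e_z| <= 6 * b * tau.
Proof.
have [t0 /andP[t00 t0tau] Ht] := periodic_reduce tau0 t.
rewrite (Ht _ _ (periodic_coords e_z)).
pose f t : 'rV[R]_3 := \row_i dot (e1 i t) e_z.
have dc (x : R) : is_derive x 1 (fun t => coords t e_z) (f x).
  apply: (@is_derive_rV _ _ (fun t => coords t e_z) f) => i; rewrite mxE.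
  apply: (is_derive_ext (is_derive_dot (derive_e i x) (is_derive_cst e_z x (1 : R)))) => [y|].
    by rewrite mxE.
  by rewrite dot0r addr0.
have b0 : 0 <= b by rewrite (le_trans (sqrtr_ge0 _) (ltW (wb 0))).
have fb (x : R) : `|f x| <= 6 * b.
  apply: ler_norm_rV => [|i]; first by rewrite mulr_ge0.
  have ez1 : `|e_z : 'rV[R]_3| <= 1.
    apply: norm_le1_dot; rewrite /dot (bigD1 2)//= big1 ?addr0 => [|j j2].
      by rewrite !mxE !eqxx mulr1.
    by rewrite !mxE (negbTE j2) andbF mul0r.
  rewrite mxE /e1 we (le_trans (ler_norm_dot _ _))//.
  have h : `|cross (in_space e x (w x)) (e i x)| <= 2 * b * 1.
    rewrite (le_trans (ler_norm_cross _ _))// ler_pM ?mulr_ge0// ?norm_frame//.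
    by rewrite ler_wpM2l// (le_trans (norm_le_enorm _))// ltW.
  rewrite (@le_trans _ _ (3 * (2 * b * 1) * 1))//; last by rewrite !mulr1 mulrA; lra.
  by rewrite ler_pM// ?mulr_ge0// ler_wpM2l.
have := MVT_le t00 dc (fun t _ => fb t); rewrite subr0 => /le_trans; apply.
by rewrite ler_wpM2l// mulr_ge0.
Qed.

Lemma periodic_applied g q v : periodic (fun t => applied g t q v) tau.
Proof.
move=> t; have pc x : coords (t + tau) x = coords t x := periodic_coords x t.
have pi x : in_space e (t + tau) x = in_space e t x := periodic_in_space x t.
by rewrite /applied /inertial !pc !pi periodic_w periodic_dw.
Qed.

Lemma continuous_applied g q v : continuous (fun t => applied g t q v).
Proof.
have cst (x : 'rV[R]_3) : continuous (fun _ : R => x) by move=> t; exact: cvg_cst.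
have cr (x : R) : continuous (fun _ : R => x) by move=> t; exact: cvg_cst.
have cw : continuous w by apply: is_derive_continuous derive_w.
have cW := continuous_in_space cw.
have cq := continuous_in_space (cst q); have cv := continuous_in_space (cst v).
have cdw : continuous (fun t => in_space e t (derive1 w t)).
  by rewrite derive1_w; exact: continuous_in_space.
have ci : continuous (fun t => inertial t q v).
  have c1 := continuous_cross cdw cq.
  have c2 := continuous_cross cW (continuous_cross cW cq).
  have c3 := continuous_scalev (cr 2) (continuous_cross cW cv).
  exact: (continuous_addv (continuous_addv c1 c2) c3).
move=> t; apply: cvgB; last exact: (continuous_coords ci).
by apply: cvgN; exact: (continuous_scalev (cr g) (continuous_coords (cst e_z))).
Qed.

End Frame.

Section Motion.
Variables (R : realType) (e : 'I_3 -> R -> 'rV[R]_3) (w : R -> 'rV[R]_3) (tau b g : R).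
Hypothesis frame_e : rotating_frame e.
Hypothesis tau0 : 0 < tau.
Hypothesis g0 : 0 < g.
Hypothesis pe : forall i, periodic (e i) tau.
Hypothesis we : angular_velocity e w.
Hypothesis wb : forall t, enorm (in_space e t (w t)) < b.
Hypothesis dwb : forall t, enorm (in_space e t (derive1 w t)) < b.
Hypothesis b1 : b <= 1.
Implicit Types (x y q v : 'rV[R]_3) (t : R).

Lemma coords_expand t y :
  y = dot y (coords e t (delta_mx 0 0)) *: coords e t (delta_mx 0 0)
    + dot y (coords e t (delta_mx 0 1)) *: coords e t (delta_mx 0 1)
    + dot y (coords e t e_z) *: coords e t e_z.
Proof.
rewrite -[y](in_spaceK frame_e t) !dot_coords//; set x := in_space e t y; clearbody x.
have {1}-> : x = x 0 0 *: delta_mx 0 0 + x 0 1 *: delta_mx 0 1 + x 0 2 *: e_z.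
  by apply: row3P; rewrite !mxE/=; ring.
have cZ (k : R) z : coords e t (k *: z) = k *: coords e t z.
  apply/rowP => i; rewrite !mxE /dot mulr_sumr.
  by apply: eq_bigr => j _; rewrite !mxE mulrCA.
rewrite !coordsD// !cZ.
have d i : dot x (delta_mx 0 i) = x 0 i.
  rewrite /dot (bigD1 i)//= big1 ?addr0 => [|j ji]; first by rewrite !mxE !eqxx mulr1.
  by rewrite !mxE (negbTE ji) andbF mulr0.
by rewrite !d.
Qed.

Lemma dot_delta i j : dot (delta_mx 0 i : 'rV[R]_3) (delta_mx 0 j) = (i == j)%:R.
Proof.
rewrite /dot (bigD1 i)//= big1 ?addr0 => [|l li]; first by rewrite !mxE !eqxx mul1r.
by rewrite !mxE (negbTE li) andbF mul0r.
Qed.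

Lemma applied_gravity t q v :
  `|applied e w g t q v + g *: coords e 0 e_z| <= (6 * tau * g + 54) * b * (1 + `|q| + `|v|).
Proof.
have -> : applied e w g t q v + g *: coords e 0 e_z =
    - (g *: (coords e t e_z - coords e 0 e_z) + coords e t (inertial e w t q v)).
  by rewrite /applied scalerBr opprD opprB addrAC [- _ + g *: _]addrC.
rewrite normrN (le_trans (ler_normD _ _))// normrZ gtr0_norm//.
have := vertical_drift frame_e tau0 pe we wb t => h1.
have h2 := ler_norm_coords frame_e t (inertial e w t q v).
have h3 := ler_norm_inertial frame_e wb dwb t q v b1.
have b0 : 0 <= b by rewrite (le_trans (sqrtr_ge0 _) (ltW (wb t))).
have h4 := ler_wpM2l (ltW g0) h1.
have h5 : 0 <= 6 * tau * g * b * (`|q| + `|v|) by rewrite !mulr_ge0// ?addr_ge0// ltW.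
have -> : (6 * tau * g + 54) * b * (1 + `|q| + `|v|) = 
  6 * tau * g * b * (`|q| + `|v|) + g * (6 * b * tau) + 54 * b + 54 * b * (`|q| + `|v|) by ring.
have {h2 h3} h : `|coords e t (inertial e w t q v)| <= 54 * b * (`|q| + `|v|).
  by rewrite (le_trans h2)// (le_trans (ler_wpM2l _ h3))// !mulrA -natrM.
rewrite lerD// (le_trans h4)// -addrA ler_wpDl// ler_wpDr// mulr_ge0//.
Qed.

Lemma applied_lipschitz t q v q' v' :
  `|applied e w g t q v - applied e w g t q' v'| <= 54 * b * (`|q - q'| + `|v - v'|).
Proof.
have -> : applied e w g t q v - applied e w g t q' v' =
    - coords e t (inertial e w t (q - q') (v - v')).
  rewrite -inertialB coordsB// /applied.
  set z := g *: _; set x := coords _ _ _; set y := coords _ _ _.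
  by clearbody x y z; apply/rowP => i; rewrite !mxE; ring.
rewrite normrN (le_trans (ler_norm_coords frame_e _ _))//.
rewrite (le_trans (ler_wpM2l _ (ler_norm_inertial frame_e wb dwb t (q - q') (v - v') b1)))//.
by rewrite !mulrA -natrM.
Qed.

Lemma height_ge t q : dot (coords e 0 e_z) q - 18 * b * tau * `|q| <= height e t q.
Proof.
have -> : height e t q = dot (coords e 0 e_z) q + dot (coords e t e_z - coords e 0 e_z) q.
  rewrite -dotDl addrC subrK /height /dot; apply: eq_bigr => i _.
  by rewrite mxE -/(dot _ _) dotC.
rewrite lerD2l lerNl (le_trans (ler_norm _))// normrN (le_trans (ler_norm_dot _ _))//.
rewrite ler_wpM2r//.
by have := vertical_drift frame_e tau0 pe we wb t; lra.
Qed.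

(** [in_space] and [coords] being inverse linear maps, this is the equation of
motion in the fixed frame divided by [m]; the reaction is [m l grad s]. *)
Lemma applied_motion (m k : R) (s : 'rV[R]_3 -> R) (q v : R -> 'rV[R]_3) (l : R -> R) :
  (forall t, is_derive t 1 q (v t)) ->
  (forall t, is_derive t 1 v
    (- k *: v t + (applied e w g t (q t) (v t) + l t *: grad s (q t)))) ->
  (forall t, s (q t) = 0) ->
  is_motion m g (m * k) s e w q.
Proof.
move=> dq dv sq.
have q1 : derive1 q = v.
  by apply/funext => t; rewrite derive1E; exact: (@derive_val _ _ _ _ _ _ _ (dq t)).
have q2 t : derive1 v t = - k *: v t + (applied e w g t (q t) (v t) + l t *: grad s (q t)).
  by rewrite derive1E; exact: (@derive_val _ _ _ _ _ _ _ (dv t)).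
split=> [t|t|//|]; first exact: (@ex_derive _ _ _ _ _ _ _ (dq t)).
  by rewrite q1; exact: (@ex_derive _ _ _ _ _ _ _ (dv t)).
exists (fun t => (m * l t) *: in_space e t (grad s (q t))); split=> [t|t /=]; first by exists (m * l t).
rewrite q1 q2 !(in_spaceD, in_spaceZ, in_spaceN, coordsK) // /inertial.
set c1 := cross _ _; set c2 := cross _ (cross _ _); set c3 := cross _ _.
set n := in_space _ _ _; set y := in_space _ _ _.
by clearbody c1 c2 c3 n y; apply/rowP => i; rewrite !mxE; ring.
Qed.

End Motion.

Theorem theorem3p4 (R : realType) (m g tau : R) (s : 'rV[R]_3 -> R)
    (m_gt0 : 0 < m) (g_gt0 : 0 < g) (tau_gt0 : 0 < tau)
    (s_surface : closed_strictly_convex_surface s) :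
  exists b mu : R, [/\ 0 < b, 0 < mu &
    forall (e : 'I_3 -> R -> 'rV[R]_3) (w : R -> 'rV[R]_3),
      rotating_frame e ->
      (forall i, periodic (e i) tau) ->
      angular_velocity e w ->
      (forall t, enorm (in_space e t (w t)) < b) ->
      (forall t, enorm (in_space e t (derive1 w t)) < b) ->
      exists q : R -> 'rV[R]_3,
        [/\ is_motion m g mu s e w q,
            periodic q tau &
            forall t, 0 < height e t (q t)]].
Proof.
have [sm gn0 [K [cK scK K0 bd]]] := s_surface.
have ds : forall x, differentiable s x := sm [::].
have [k [be [h0 [k0 be0 h00 sol]]]] := periodic_solution_near_top
  ds gn0 cK scK K0 bd
  (fun i x => sm [:: delta_mx 0 i] x)
  (fun i j x => sm [:: delta_mx 0 j; delta_mx 0 i] x)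
  (fun i j l x => sm [:: delta_mx 0 l; delta_mx 0 j; delta_mx 0 i] x) g_gt0 tau_gt0.
have [r r0 Kr] := body_bounded cK.
(* [b] is small enough for the forces to be [be]-close to gravity, and for the
   drift of the vertical to change heights by at most [h0 / 2] *)
pose C := 6 * tau * g + 54; pose D := 36 * tau * r.
have C0 : 0 < C by rewrite addr_gt0// !mulr_gt0.
have D0 : 0 < D by rewrite !mulr_gt0.
pose b := Num.min 1 (Num.min (be / C) (h0 / D)).
have b0 : 0 < b by rewrite !lt_min ltr01 !divr_gt0.
have b1 : b <= 1 by rewrite ge_min lexx.
have bC : C * b <= be by rewrite mulrC -ler_pdivlMr// !ge_min lexx orbT.
have bD : D * b <= h0 by rewrite mulrC -ler_pdivlMr// !ge_min lexx !orbT.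
clearbody b.
exists b, (m * k); split=> [//||e w frame_e pe we wb dwb]; first exact: mulr_gt0.
have [] := sol (coords e 0 (delta_mx 0 0)) (coords e 0 (delta_mx 0 1)) (coords e 0 e_z)
  (applied e w g); rewrite ?dot_coords// ?dot_delta//.
- exact: (coords_expand frame_e).
- by move=> q v; exact: periodic_applied.
- by move=> q v; exact: continuous_applied.
- move=> t q v; rewrite (le_trans (applied_gravity frame_e tau_gt0 g_gt0 pe we wb dwb b1 t q v))//.
  by rewrite ler_wpM2r// !addr_ge0.
- move=> t q v q' v'; rewrite (le_trans (applied_lipschitz _ frame_e wb dwb b1 t q v q' v'))//.
  rewrite ler_wpM2r// ?addr_ge0// (le_trans _ bC)// ler_wpM2r// ?(ltW b0)//.
  by rewrite /C lerDr !mulr_ge0// ltW.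
move=> q [v [l [pq dq dv sq hq]]]; exists q; split=> // [|t].
  by apply: (@applied_motion R e w g frame_e m k s q v l).
rewrite (lt_le_trans _ (height_ge frame_e tau_gt0 pe we wb t (q t)))//.
have hr : 18 * b * tau * `|q t| <= 18 * b * tau * r.
  by rewrite ler_wpM2l// ?(Kr _ (surface_body bd (sq t)))// !mulr_ge0// ltW.
have := hq t; move: bD; rewrite /D; set X := dot _ _; clearbody X.
have -> : 36 * tau * r * b = 2 * (18 * b * tau * r) by ring.
by lra.
Qed.
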